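(* Let $G$ be a finitely presented group, and let $p$ be a prime. Suppose that the lower central $p$-series for $G$ has linear growth of mod $p$ homology. Then $G$ is $p$-large.
   Context: The lower central $p$-series $\{\gamma_i^{(p)}(G)\}$ of $G$ is defined recursively by $\gamma_1^{(p)}(G)=G$ and $\gamma_{i+1}^{(p)}(G)=[\gamma_i^{(p)}(G),G]\,(\gamma_i^{(p)}(G))^p$; its terms are finite index subgroups of $G$. For a group $H$, $d_p(H)$ is the dimension of $H_1(H;\mathbb{F}_p)$ over the field $\mathbb{F}_p$ of order $p$. A nested sequence of finite index subgroups $\{G_i\}$ of $G$ has linear growth of mod $p$ homology if $\inf_i d_p(G_i)/[G:G_i]>0$. A group is $p$-large if it contains a normal subgroup with index a power of $p$ that admits a surjective homomorphism onto a free non-abelian group. *)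

(* Defs.v *)
From HB Require Import structures.
From mathcomp Require Import all_boot all_order all_algebra finmap.
From mathcomp Require Import boolp classical_sets functions cardinality reals.
From mathcomp Require Import freeg.

Local Open Scope classical_set_scope.

(** * Subgroups of a possibly infinite group *)

Section Subgroups.
Context {G : groupType}.
Implicit Types A B H N : set G.
Local Open Scope group_scope.

Definition is_subgroup H : Prop :=
  H 1 /\ forall x y, H x -> H y -> H (x / y).

Definition is_normal N : Prop :=
  is_subgroup N /\ forall x g, N x -> N (x ^ g).

Definition generated A : set G := smallest is_subgroup A.

Definition normal_closure A : set G := smallest is_normal A.

Definition commutator_subgroup A B : set G :=
  generated [set [~ x, y] | x in A & y in B].

Definition power_subgroup (n : nat) A : set G :=
  generated [set x ^+ n | x in A].

Definition left_cosets H : set (set G) :=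
  [set [set g * h | h in H] | g in [set: G]].

Definition finite_index H : Prop := finite_set (left_cosets H).

(* [subgroup_index H] is 0 when H has infinite index. *)
Definition subgroup_index H : nat := #|` fset_set (left_cosets H)|.

End Subgroups.

(* The numbering is shifted: [lower_central_p G p i] is the term of index
   i + 1 of the series. *)
Fixpoint lower_central_p (G : groupType) (p i : nat) : set G :=
  if i is j.+1 then
    [set (x * y)%g
       | x in commutator_subgroup (lower_central_p G p j) [set: G]
       & y in power_subgroup p (lower_central_p G p j)]
  else [set: G].

(** * First homology with coefficients in F_p *)

Section QuotientDimension.
Context {K : fieldType} {V : lmodType K}.
Implicit Types Z B : set V.
Local Open Scope ring_scope.

(* For subspaces B of Z of V, the images in Z / B of the e i form a basis. *)
Definition is_quotient_basis Z B {n : nat} (e : 'I_n -> V) : Prop :=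
  (forall i, Z (e i)) /\
  (forall z, Z z -> exists! a : {ffun 'I_n -> K}, B (z - \sum_i a i *: e i)).

(* [quotient_dim Z B] is 0 when Z / B is infinite dimensional. *)
Definition quotient_dim Z B : nat :=
  xget 0%N [set n | exists e : 'I_n -> V, is_quotient_basis Z B e].

End QuotientDimension.

Section Homology.
Context {G : groupType}.
Implicit Types H : set G.
Local Open Scope ring_scope.

(* Bar complex with trivial coefficients in F_p: the n-chains of a subgroup H
   are the F_p-linear combinations of n-tuples [h_1 | ... | h_n] in H. *)
Definition bar_chains1 (p : nat) H : set {freeg G / 'F_p} :=
  [set c | forall g, g \in dom c -> H g].

Definition bar_chains2 (p : nat) H : set {freeg (G * G)%type / 'F_p} :=
  [set c | forall g, g \in dom c -> H g.1 /\ H g.2].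

(* The boundary d_2 [g | h] = [h] - [g h] + [g], extended linearly. *)
Definition bar_boundary2 (p : nat) (c : {freeg (G * G)%type / 'F_p}) :
    {freeg G / 'F_p} :=
  \sum_(g <- dom c)
     coeff g c *: (<< g.2 >> - << (g.1 * g.2)%g >> + << g.1 >>).

(* The boundary d_1 [g] = [] - [] vanishes, hence every 1-chain is a cycle and
   H_1(H; F_p) is the quotient of the 1-chains of H by the image of d_2. *)
Definition dim_H1 (p : nat) H : nat :=
  quotient_dim (bar_chains1 p H) (bar_boundary2 p @` bar_chains2 p H).

(* A term of infinite index contributes x / 0 = 0, so a sequence with
   such a term does not have linear growth. *)
Definition linear_growth (R : realType) (p : nat) (H_ : nat -> set G) : Prop :=
  0 < inf [set ((dim_H1 p (H_ i))%:R / (subgroup_index (H_ i))%:R : R)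
             | i in [set: nat]].

End Homology.

(** * Free groups, finite presentations, p-large groups *)

Definition free_on {F : groupType} (X : set F) : Prop :=
  forall (H : groupType) (f : F -> H), exists! phi : F -> H,
    {morph phi : x y / (x * y)%g} /\ (forall x, X x -> phi x = f x).

Definition is_free (F : groupType) : Prop := exists X : set F, free_on X.

Definition is_abelian (G : groupType) : Prop := forall x y : G, commute x y.

Definition finitely_presented (G : groupType) : Prop :=
  exists (F : groupType) (X S : set F) (pi : F -> G),
    [/\ free_on X /\ finite_set X,
        {morph pi : x y / (x * y)%g},
        range pi = [set: G],
        pi @^-1` [set 1%g] = normal_closure S
      & finite_set S].

Definition p_large (p : nat) (G : groupType) : Prop :=
  exists N : set G,
    [/\ is_normal N,
        finite_index N,
        exists k : nat, subgroup_index N = (p ^ k)%N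
      & exists (F : groupType) (f : G -> F),
          [/\ is_free F, ~ is_abelian F,
              forall x y, N x -> N y -> f (x * y)%g = (f x * f y)%g
            & f @` N = [set: F]]].

(* Main.v *)
Require Import Defs.
From HB Require Import structures.
From mathcomp Require Import boolp classical_sets functions cardinality reals.
From mathcomp Require Import finmap.
From mathcomp Require freeg.
From mathcomp Require Import all_boot all_order all_algebra all_fingroup all_solvable all_field.
From mathcomp Require Import zify ring.

Set Implicit Arguments. Unset Strict Implicit. Unset Printing Implicit Defensive.
Import Order.TTheory GRing.Theory Num.Theory.
Local Open Scope ring_scope.

(** Let G be presented by finitely many letters, closed under inversion, and relators
    that are words in these letters. A finite set Y on which G acts has a Cayley
    graph, with an edge (x, y) for each letter x and point y; a cocycle is a function
    on the edges whose sum along every relator path is 0, and the rank of Y is the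
    dimension of its space of F_p-valued cocycles. Linear growth is used through one
    inequality: there is l such that (l + 1) |Y| <= l rank(Y) for every finite Y on
    which the elements of G act with p-power order. Indeed some term N_i of the series
    acts trivially on Y, the quotients G / N_i satisfy such an inequality because
    their cocycles contain the homomorphisms from N_i to F_p, and the quotient
    rank(Y) / |Y| is bounded below by that of G / N_i: in the product G / N_i x Y, a
    union of copies of G / N_i, the p-group G / N_i acts on the cocycles and has those
    of Y as invariants (growth_of_p_actions, rank_ratio).

    The first step is an integral cocycle whose sum along some loop is prime to p
    (nontrivial_integral_cocycle). Take Y with rank(Y) / |Y| almost minimal and put the
    matrix of the relators into Smith normal form. If the p-part of many elementary
    divisors were equal to q = p^b with b > 0, these would define an abelian covering
    of Y with group (Z / q)^J. Its cocycles are counted by polynomials: they correspond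
    to functions with values in K[X] / X^q, K a large finite field of characteristic p,
    that satisfy the cocycle equations twisted by units prod_j (1 + c_j X)^(N_j), and
    the point sets of parameters c that occur are small because the c_j^q are
    polynomials of low degree on them (covering_bound). The covering would then have
    too small a rank (few_exact_torsion). Hence most elementary divisors that vanish
    modulo p vanish modulo a high power p^a, and Y has many cocycles modulo p^a. But if
    integral cocycles were all coboundaries modulo p, they would be coboundaries modulo
    p^a, and by the pigeonhole principle there would be few cocycles modulo p^a
    (siegel_count).

    Reducing the integral cocycle modulo p^j gives finite p-groups, quotients of G,
    whose Cayley graphs map onto a circle of length p^j with edges of bounded length
    (height_cover). Cut the circle into long arcs. Cocycles that vanish near the cuts
    are sums of cocycles supported over single arcs, and as the rank exceeds the
    number of points by a fixed proportion, many arcs carry cocycles that are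
    independent modulo coboundaries (separated_cocycles). On a further p-quotient V
    they become coboundaries of functions phi_0, ..., phi_r, which commuting elements
    g_k of V translate independently (translations_exist).

    The supports of phi_0 on the one hand and of the other phi_k on the other hand,
    which no relator connects, cut V into the pieces of a graph of spaces. The products
    phi_0 phi_k show that the graph has first Betti number at least r (products_indep,
    card_free_roots). With r the number of generators of the free group F of the
    presentation, labels in F on the edges of V realise a homomorphism from the
    fundamental group of that graph onto F (labelled_quotient). The labels make G act
    on V x F, and the kernel N of the map from G to V, a normal subgroup of p-power
    index, is mapped onto F. Finally F is not abelian: on a point the inequality gives
    a rank, hence a number of generators, greater than 1. *)

(** * Paths and cocycles on a set with an action *)

Section Paths.
Context {n : nat}.

Section OneSet.
Context {Y : Type} (st : 'I_n -> Y -> Y).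
Implicit Types (y : Y) (w : seq 'I_n).

Fixpoint run y w := if w is x :: w' then run (st x y) w' else y.

Fixpoint edges y w : seq ('I_n * Y) :=
  if w is x :: w' then (x, y) :: edges (st x y) w' else [::].

Lemma run_cat y w1 w2 : run y (w1 ++ w2) = run (run y w1) w2.
Proof. by elim: w1 y => //= x w1 IH y; rewrite IH. Qed.

Lemma edges_cat y w1 w2 :
  edges y (w1 ++ w2) = edges y w1 ++ edges (run y w1) w2.
Proof. by elim: w1 y => //= x w1 IH y; rewrite IH. Qed.

Lemma size_edges y w : size (edges y w) = size w.
Proof. by elim: w y => //= x w IH y; rewrite IH. Qed.

End OneSet.

Definition relsum {Y : Type} {A : nmodType} (st : 'I_n -> Y -> Y)
  (f : 'I_n * Y -> A) y w : A := \sum_(e <- edges st y w) f e.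

Lemma relsum_nil Y (A : nmodType) st (f : 'I_n * Y -> A) y :
  relsum st f y [::] = 0.
Proof. exact: big_nil. Qed.

Lemma relsum_cons Y (A : nmodType) st (f : 'I_n * Y -> A) y x w :
  relsum st f y (x :: w) = f (x, y) + relsum st f (st x y) w.
Proof. by rewrite /relsum /= big_cons. Qed.

Lemma relsum_cat Y (A : nmodType) st (f : 'I_n * Y -> A) y w1 w2 :
  relsum st f y (w1 ++ w2) = relsum st f y w1 + relsum st f (run st y w1) w2.
Proof. by rewrite /relsum edges_cat big_cat. Qed.

Lemma edges_map Y Y' (st : 'I_n -> Y -> Y) (st' : 'I_n -> Y' -> Y')
    (h : Y -> Y') y w :
  (forall x y, h (st x y) = st' x (h y)) ->
  edges st' (h y) w = [seq (e.1, h e.2) | e <- edges st y w].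
Proof. by move=> hst; elim: w y => //= x w IH y; rewrite -hst IH. Qed.

Lemma relsum_map Y Y' (A : nmodType) (st : 'I_n -> Y -> Y)
    (st' : 'I_n -> Y' -> Y') (h : Y -> Y') (f : 'I_n * Y' -> A) y w :
  (forall x y, h (st x y) = st' x (h y)) ->
  relsum st' f (h y) w = relsum st (fun e => f (e.1, h e.2)) y w.
Proof. by move=> hst; rewrite /relsum (edges_map _ _ hst) big_map. Qed.

(** The covering of Y with fibre A defined by the labels k. *)
Definition ext {Y : Type} {A : nmodType} (st : 'I_n -> Y -> Y)
  (k : 'I_n * Y -> A) : 'I_n -> Y * A -> Y * A :=
  fun x z => (st x z.1, z.2 + k (x, z.1)).

Lemma run_ext Y (A : nmodType) st (k : 'I_n * Y -> A) z w :
  run (ext st k) z w = (run st z.1 w, z.2 + relsum st k z.1 w).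
Proof.
elim: w z => [|x w IH] [y a] /=; first by rewrite relsum_nil addr0.
by rewrite IH /= relsum_cons addrA.
Qed.

Context {m : nat} (rel : 'I_m -> seq 'I_n).

Definition is_action {Y : Type} (st : 'I_n -> Y -> Y) :=
  forall i y, run st y (rel i) = y.

Definition cocycle {Y : Type} {A : nmodType} (st : 'I_n -> Y -> Y)
  (f : 'I_n * Y -> A) := forall i y, relsum st f y (rel i) = 0.

Lemma ext_action Y (A : nmodType) st (k : 'I_n * Y -> A) :
  is_action st -> cocycle st k -> is_action (ext st k).
Proof. by move=> ast ck i [y a]; rewrite run_ext /= ast ck addr0. Qed.

Section Space.
Context {K : fieldType} {Y : finType} (st : 'I_n -> Y -> Y).

Definition relmap (f : {ffun 'I_n * Y -> K^o}) : {ffun 'I_m * Y -> K^o} :=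
  [ffun c => relsum st f c.2 (rel c.1)].

Fact relmap_linear : linear relmap.
Proof.
move=> a f g; apply/ffunP=> c; rewrite !ffunE /relsum scaler_sumr -big_split.
by apply: eq_bigr => e _; rewrite !ffunE.
Qed.
HB.instance Definition _ :=
  GRing.isLinear.Build K {ffun 'I_n * Y -> K^o} {ffun 'I_m * Y -> K^o} _
    relmap relmap_linear.

(** For a transitive action, the quotient of this space by the coboundaries is the
    space of homomorphisms from a point stabiliser to K. *)
Definition cocycles : {vspace {ffun 'I_n * Y -> K^o}} := lker (linfun relmap).

Lemma cocyclesP (f : {ffun 'I_n * Y -> K^o}) :
  reflect (cocycle st f) (f \in cocycles).
Proof.
rewrite memv_ker lfunE; apply: (iffP eqP) => [/ffunP ff i y|ff].
  by have := ff (i, y); rewrite !ffunE.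
by apply/ffunP=> c; rewrite !ffunE ff.
Qed.

End Space.
End Paths.
Arguments cocycles {n m} rel K {Y} st.

(** * Nilpotent operators and invariants of p-groups *)

Lemma prime_power_gt1 p b : prime p -> (0 < b)%N -> (1 < p ^ b)%N.
Proof. by move=> p_pr b0; rewrite -{1}(exp1n b) ltn_exp2r // prime_gt1. Qed.

Lemma ffun_sum_delta {K : fieldType} {T : finType} (f : {ffun T -> K^o}) :
  f = \sum_t f t *: ([ffun s => (s == t)%:R] : {ffun T -> K^o}).
Proof.
apply/ffunP=> s; rewrite sum_ffunE (bigD1 s) //= big1 => [|t ts].
  by rewrite !ffunE eqxx addr0 /GRing.scale /= mulr1.
by rewrite !ffunE eq_sym (negPf ts) scaler0.
Qed.

Lemma dim_ffun (K : finFieldType) (T : finType) :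
  \dim (fullv : {vspace {ffun T -> K^o}}) = #|T|.
Proof.
have := card_vspace (fullv : {vspace {ffun T -> K^o}}).
rewrite (eq_card (B := predT)) => [|f]; last by rewrite memvf.
rewrite cardT /= -cardT card_ffun => E.
by rewrite -(expnI (finNzRing_gt1 K) E).
Qed.

Section Nilpotent.
Context {K : fieldType} {V : vectType K}.
Implicit Types (U : {vspace V}) (b : 'End(V)).

(** The layers of the filtration of U by the images of the powers of b are
    quotients of one another, and each embeds into the kernel of b. *)
Lemma dim_nilpotent U b m : (b @: U <= U)%VS ->
  (forall u, u \in U -> iter m b u = 0) ->
  (\dim U <= m * \dim (U :&: lker b))%N.
Proof.
move=> bU; elim: m U bU => [|m IH] U bU nil.
  rewrite mul0n leqn0 dimv_eq0 -subv0; apply/subvP => u uU.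
  by rewrite memv0; apply/eqP; have:= nil u uU.
rewrite -(limg_ker_dim b U) mulSn leq_add2l.
have bbU : (b @: (b @: U) <= b @: U)%VS by apply: limgS.
apply: leq_trans (IH _ bbU _) _.
  by move=> u /memv_imgP [v vU ->]; rewrite -iterSr nil.
by rewrite leq_mul2l dimvS ?orbT // capvS.
Qed.

(** The operators commute, so that each acts on the common kernel of the
    preceding ones. *)
Lemma dim_nilpotents U (bs : seq 'End(V)) q :
  {in bs, forall b, (b @: U <= U)%VS} ->
  {in bs, forall b u, u \in U -> iter q b u = 0} ->
  {in bs &, forall b b' u, b (b' u) = b' (b u)} ->
  (\dim U <= q ^ size bs * \dim (U :&: \bigcap_(b <- bs) lker b))%N.
Proof.
elim: bs U => [|b bs IH] U bU nil com.
  by rewrite big_nil capvf expn0 mul1n.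
have bb : b \in b :: bs by rewrite mem_head.
apply: leq_trans (dim_nilpotent (bU b bb) (nil b bb)) _.
rewrite expnS -mulnA leq_mul2l; apply/orP; right.
rewrite big_cons capvA; apply: IH.
- move=> b' b'bs; have b'in : b' \in b :: bs by rewrite inE b'bs orbT.
  apply/subvP => _ /memv_imgP [v /memv_capP [vU vb] ->].
  rewrite memv_cap (subvP (bU _ b'in)) ?memv_img //= memv_ker com //.
  by move: vb; rewrite memv_ker => /eqP ->; rewrite linear0.
- move=> b' b'bs u /memv_capP [uU _]; apply: nil => //.
  by rewrite inE b'bs orbT.
- by move=> b1 b2 h1 h2; apply: com; rewrite inE ?h1 ?h2 orbT.
Qed.

End Nilpotent.

(** Endomorphisms of a nonzero space form a ring of characteristic p, in which
    the Frobenius map is additive on commuting elements. *)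
Lemma iter_pcharD {K : fieldType} {p : nat} (pK : p \in [pchar K])
    {V : vectType K} (a b : 'End(V)) k u :
  (forall v, a (b v) = b (a v)) ->
  iter (p ^ k) (a + b)%VF u = iter (p ^ k) a u + iter (p ^ k) b u.
Proof.
move=> ab; have [V0|Vpos] := posnP (dim V).
  have z (v : V) : v = 0.
    apply/eqP; rewrite -memv0; suff <- : fullv = 0%VS :> {vspace V} by rewrite memvf.
    by apply/eqP; rewrite -dimv_eq0 dimvf V0.
  by rewrite [LHS]z [RHS]z.
pose R : nzRingType := lfun_comp_nzRingType Vpos.
have pR : p \in [pchar R].
  apply/andP; split; first by case/andP: pK.
  have N j v : ((j%:R : R) : 'End(V)) v = (j%:R : K) *: v.
    elim: j => [|j IH]; first by rewrite !mulr0n scale0r; apply: zero_lfunE.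
    have E1 : (j.+1%:R : R) = (((1 : R) : 'End(V)) + ((j%:R : R) : 'End(V)))%VF.
      exact: (mulrS (1 : R) j).
    by rewrite E1 add_lfunE IH id_lfunE -nat1r scalerDl scale1r.
  by apply/eqP/lfunP => v; rewrite N (pcharf0 pK) scale0r zero_lfunE.
have E (c : R) m v : (c ^+ m : 'End(V)) v = iter m (c : 'End(V)) v.
  elim: m v => [|m IH] v; first by rewrite expr0 /= id_lfunE.
  by rewrite exprS /= -IH comp_lfunE.
have cm : GRing.comm (a : R) (b : R).
  by apply/lfunP => v; rewrite !comp_lfunE ab.
have F (c d : R) : GRing.comm c d ->
    (c + d) ^+ (p ^ k) = c ^+ (p ^ k) + d ^+ (p ^ k).
  elim: k => [|k IH] cd; first by rewrite expn0 !expr1.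
  rewrite expnSr !exprM IH //.
  by apply: (pFrobenius_autD_comm pR); apply: commrX; apply/commr_sym/commrX/commr_sym.
by have := congr1 (fun f : 'End(V) => f u) (F _ _ cm); rewrite add_lfunE !E.
Qed.

Lemma iter_pcharB1 {K : fieldType} {p : nat} (pK : p \in [pchar K])
    {V : vectType K} (a : 'End(V)) k u :
  iter (p ^ k) (a - \1)%VF u = iter (p ^ k) a u - u.
Proof.
rewrite (iter_pcharD pK); last by move=> v; rewrite !opp_lfunE !id_lfunE linearN.
congr (_ + _); have -> : - u = (-1) ^+ (p ^ k) *: u.
  have -> : (-1) ^+ (p ^ k) = -1 :> K; last by rewrite scaleN1r.
  elim: k => [|k IH]; first by rewrite expr1.
  by rewrite expnSr exprM IH -(pFrobenius_autE pK) pFrobenius_autN pFrobenius_aut1.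
elim: (p ^ k)%N => [|m IH] /=; first by rewrite expr0 scale1r.
by rewrite IH linearZ /= opp_lfunE id_lfunE scalerN exprS mulN1r scaleNr.
Qed.

Section PGroupInvariants.
Context {K : fieldType} {p : nat} (pK : p \in [pchar K]).
Context {gT : finGroupType} {V : vectType K} (act : gT -> 'End(V)).
Hypothesis act1 : forall u, act 1%g u = u.
Hypothesis actM : forall g h u, act (g * h)%g u = act g (act h u).

Definition invariants (U : {vspace V}) (Q : {set gT}) : {vspace V} :=
  (U :&: \bigcap_(g in Q) lker (act g - \1)%VF)%VS.

Lemma invariantsP (U : {vspace V}) (Q : {set gT}) u :
  reflect (u \in U /\ {in Q, forall g, act g u = u}) (u \in invariants U Q).
Proof.
apply: (iffP memv_capP) => [[uU /subv_bigcapP iu]|[uU iu]]; split=> //.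
  move=> g gQ; have := iu g gQ; rewrite -memvE memv_ker.
  by rewrite add_lfunE opp_lfunE id_lfunE subr_eq0 => /eqP.
apply/subv_bigcapP=> g gQ; rewrite -memvE memv_ker.
by rewrite add_lfunE opp_lfunE id_lfunE iu // subrr.
Qed.

Lemma act_iter g k u : iter k (act g) u = act (g ^+ k)%g u.
Proof. by elim: k => [|k IH] /=; rewrite ?expg0 ?act1 // IH -actM -expgS. Qed.

(** Induction on a maximal subgroup H, which is normal of index p: on the
    invariants of H, the p-th power of act x - 1 is act (x ^+ p) - 1 = 0. *)
Lemma dim_invariants (Q : {group gT}) (U : {vspace V}) :
  (p.-group Q)%g -> {in Q, forall g, (act g @: U <= U)%VS} ->
  (\dim U <= #|Q| * \dim (invariants U Q))%N.
Proof.
have [N] := ubnP #|Q|; elim: N Q => // N IH Q leQN pQ QU.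
have [Q1|ntQ] := eqVneq Q 1%G.
  rewrite Q1 cards1 mul1n dimvS //; apply/subvP => u uU; apply/invariantsP.
  by split=> // g /set1P ->; rewrite act1.
have [Q0|[H maxH _]] := maximal_exists (sub1G Q); first by rewrite -val_eqE /= -Q0 eqxx in ntQ.
have sHQ : H \subset Q := proper_sub (maxgroupp maxH).
have ltHQ : (#|H| < #|Q|)%N by rewrite proper_card // (maxgroupp maxH).
have nHQ := p_maximal_normal pQ maxH.
have iHQ := p_maximal_index pQ maxH.
apply: leq_trans (IH H (leq_trans ltHQ leQN) (pgroupS sHQ pQ) _) _.
  by move=> g gH; apply: QU; apply: (subsetP sHQ).
rewrite -(Lagrange sHQ) iHQ -mulnA leq_mul2l; apply/orP; right.
have [_ [x xQ xH]] := properP (maxgroupp maxH).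
have nHx : x \in 'N(H)%g by apply: (subsetP (normal_norm nHQ)).
have xpH : (x ^+ p)%g \in H.
  rewrite coset_idr ?groupX // morphX //= -iHQ -card_quotient ?normal_norm //.
  by apply: expg_cardG; rewrite mem_quotient.
apply: leq_trans (dim_nilpotent (b := (act x - \1)%VF) (m := p) _ _) _.
- apply/subvP => _ /memv_imgP [u /invariantsP [uU iu] ->].
  rewrite add_lfunE opp_lfunE id_lfunE; apply: rpredB; apply/invariantsP; last first.
    by [].
  split; first by rewrite (subvP (QU _ xQ)) ?memv_img.
  move=> h hH; rewrite -actM.
  have -> : (h * x = x * h ^ x)%g by rewrite conjgE !mulgA mulgV mul1g.
  by rewrite actM iu // memJ_norm.
- move=> u /invariantsP [uU iu].
  by rewrite -[p]expn1 (iter_pcharB1 pK) expn1 act_iter iu // subrr.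
rewrite leq_mul2l dimvS ?orbT //; apply/subvP => u /memv_capP [/invariantsP [uU iu]].
rewrite memv_ker add_lfunE opp_lfunE id_lfunE subr_eq0 => /eqP xu.
apply/invariantsP; split=> // g gQ.
have : g \in (<<x |: H>>)%g.
  suff -> : (<<x |: H>>)%g = Q by [].
  have [] := maxgroupP maxH => _ /(_ <<x |: H>>%G) maxQ.
  have sub : (<<x |: H>> \subset Q)%g by rewrite gen_subG subUset sub1set xQ.
  apply/eqP; rewrite eqEproper sub /=; apply/negP => /maxQ.
  rewrite (subset_trans (subsetUr [set x] H) (subset_gen _)) => /(_ isT) E.
  by case/negP: xH; rewrite -E mem_gen // inE set11.
case/gen_prodgP => m [c cP ->]; elim: m c cP => [|m IHm] c cP.
  by rewrite big_ord0 act1.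
rewrite big_ord_recl actM IHm //.
by have := cP ord0; rewrite inE => /orP [/set1P -> //|]; apply: iu.
Qed.

End PGroupInvariants.

(** * Point sets on which q-th powers of coordinates have low degree *)

Section LowDegree.
Context {K : finFieldType} {J S : finType} (x : J -> S -> K).
Implicit Types f g : {ffun S -> K^o}.

Definition fmul (u : S -> K) f : {ffun S -> K^o} := [ffun s => u s * f s].

Fact fmul_linear u : linear (fmul u).
Proof.
by move=> a f g; apply/ffunP=> s; rewrite !ffunE mulrDr /GRing.scale /= mulrCA.
Qed.
HB.instance Definition _ u :=
  GRing.isLinear.Build K {ffun S -> K^o} {ffun S -> K^o} _ (fmul u) (fmul_linear u).

(** The functions on S that are polynomials of degree at most k in the x j; the
    inductive presentation spares polynomials in several variables. *)
Inductive pol : nat -> {ffun S -> K^o} -> Prop :=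
| pol_const k a : pol k [ffun=> a]
| pol_var k j f : pol k f -> pol k.+1 (fmul (x j) f)
| pol_add k f g : pol k f -> pol k g -> pol k (f + g).

Lemma polW k l f : (k <= l)%N -> pol k f -> pol l f.
Proof.
move=> kl pf; elim: pf l kl => {k f} [k a|k j f _ IH|k f g _ IHf _ IHg] l kl.
- exact: pol_const.
- by case: l kl => // l kl; apply/pol_var/IH.
- by apply: pol_add; [apply: IHf | apply: IHg].
Qed.

Lemma polZ k a f : pol k f -> pol k (a *: f).
Proof.
elim=> {k f} [k b|k j f _ IH|k f g _ IHf _ IHg].
- suff -> : a *: [ffun=> b] = [ffun=> a * b] :> {ffun S -> K^o}.
    exact: pol_const.
  by apply/ffunP=> s; rewrite !ffunE.
- suff -> : a *: fmul (x j) f = fmul (x j) (a *: f) by apply: pol_var.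
  by apply/ffunP=> s; rewrite !ffunE /= /GRing.scale /= mulrCA.
- by rewrite scalerDr; apply: pol_add.
Qed.

Lemma pol_mul k l f g : pol k f -> pol l g -> pol (k + l) (fmul f g).
Proof.
move=> pf pg; elim: pf => {k f} [k a|k j f _ IH|k f h _ IHf _ IHg].
- suff -> : fmul [ffun=> a] g = a *: g.
    by apply: polW (polZ a pg); rewrite leq_addl.
  by apply/ffunP=> s; rewrite !ffunE.
- suff -> : fmul (fmul (x j) f) g = fmul (x j) (fmul f g).
    by rewrite addSn; apply: pol_var.
  by apply/ffunP=> s; rewrite !ffunE mulrA.
- suff -> : fmul (f + h) g = fmul f g + fmul h g by apply: pol_add.
  by apply/ffunP=> s; rewrite !ffunE mulrDl.
Qed.

Lemma pol_sum (I : Type) (r : seq I) (P : pred I) k (F : I -> {ffun S -> K^o}) :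
  (forall i, P i -> pol k (F i)) -> pol k (\sum_(i <- r | P i) F i).
Proof.
move=> PF; apply: big_ind => //; first exact: (pol_const k 0).
exact: pol_add.
Qed.

Lemma polN k f : pol k f -> pol k (- f).
Proof. by rewrite -scaleN1r; apply: polZ. Qed.

Definition mono (e : J -> nat) : {ffun S -> K^o} :=
  [ffun s => \prod_j x j s ^+ e j].

Lemma eq_mono e e' : e =1 e' -> mono e = mono e'.
Proof. by move=> ee; apply/ffunP=> s; rewrite !ffunE; apply: eq_bigr => j _; rewrite ee. Qed.

Lemma fmul_mono j e c :
  fmul (fun s => x j s ^+ c) (mono e) =
  mono (fun i => (if i == j then c else 0) + e i)%N.
Proof.
apply/ffunP=> s; rewrite !ffunE (bigD1 j) //= [RHS](bigD1 j) //= eqxx.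
rewrite exprD -mulrA; congr (_ * (_ * _)).
by apply: eq_bigr => i /negPf ->.
Qed.

Lemma pol_mono e : pol (\sum_j e j) (mono e).
Proof.
rewrite /mono; elim: (index_enum J) => [|j r IH].
  rewrite big_nil (_ : finfun _ = [ffun=> 1]); first exact: pol_const.
  by apply/ffunP=> s; rewrite !ffunE big_nil.
rewrite big_cons (_ : finfun _ = fmul (fun s => x j s ^+ e j)
   [ffun s => \prod_(i <- r) x i s ^+ e i]); last first.
  by apply/ffunP=> s; rewrite !ffunE big_cons.
elim: (e j) => [|c IHc].
  rewrite add0n (_ : fmul _ _ = [ffun s => \prod_(i <- r) x i s ^+ e i]) //.
  by apply/ffunP=> s; rewrite !ffunE mul1r.
rewrite addSn (_ : fmul _ _ = fmul (x j) (fmul (fun s => x j s ^+ c)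
   [ffun s => \prod_(i <- r) x i s ^+ e i])); first exact: pol_var.
by apply/ffunP=> s; rewrite !ffunE exprS mulrA.
Qed.

Context (q : nat).

Definition reduced k : {vspace {ffun S -> K^o}} :=
  <<[seq mono (fun j => e j : nat) | e : {ffun J -> 'I_q} <- enum predT &
                                     (\sum_j e j <= k)%N]>>.

Lemma mem_reduced k e :
  (forall j, e j < q)%N -> (\sum_j e j <= k)%N -> mono e \in reduced k.
Proof.
move=> eq le; pose e' := [ffun j => Ordinal (eq j)].
rewrite -(_ : mono (fun j => e' j : nat) = mono e); last first.
  by apply: eq_mono => j; rewrite ffunE.
apply/memv_span/(map_f (fun e : {ffun J -> 'I_q} => mono (fun j => e j : nat))).
rewrite mem_filter mem_enum andbT (eq_bigr e) // => j _; by rewrite ffunE.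
Qed.

Lemma reducedW k l : (k <= l)%N -> (reduced k <= reduced l)%VS.
Proof.
move=> kl; apply/span_subvP => _ /mapP [e + ->]; rewrite mem_filter => /andP [ek _].
by apply: mem_reduced => //; apply: leq_trans ek kl.
Qed.

Lemma dim_reduced k : (\dim (reduced k) <= q ^ #|J|)%N.
Proof.
apply: leq_trans (dim_span _) _; rewrite size_map size_filter.
by apply: leq_trans (count_size _ _) _; rewrite -cardT card_ffun card_ord.
Qed.

Hypothesis q_gt0 : (0 < q)%N.
Hypothesis xq : forall j, pol q.-1 [ffun s => x j s ^+ q].

(** An exponent that reaches q is traded, by xq, for terms of smaller degree. *)
Lemma pol_reduced D f : pol D f -> f \in reduced D.
Proof.
have [N] := ubnP D; elim: N D f => // N IH D f DN pf.
elim: pf DN => {D f} [k a|k j f pf _|k f g _ IHf _ IHg] DN.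
- rewrite (_ : finfun _ = a *: mono (fun=> 0%N)).
    by apply/memvZ/mem_reduced => //; rewrite big1.
  by apply/ffunP=> s; rewrite !ffunE big1 /GRing.scale /= ?mulr1.
- have fD := IH k f DN pf.
  suff sub : (linfun (fmul (x j)) @: reduced k <= reduced k.+1)%VS.
    by rewrite -[fmul _ _](lfunE (fmul (x j))) (subvP sub) // memv_img.
  rewrite limg_span; apply/span_subvP => _ /mapP [_ /mapP [e + ->] ->].
  rewrite mem_filter => /andP [ek _]; rewrite lfunE /=.
  have [ltq|geq] := ltnP (e j).+1 q.
    rewrite (_ : fmul _ _ = mono (fun i => (if i == j then 1 else 0) + e i)%N).
      apply: mem_reduced => [i|]; first by case: eqP => [->|_]; rewrite ?add1n ?add0n.
      by rewrite big_split /= -big_mkcond big_pred1_eq add1n.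
    by rewrite -fmul_mono; apply/ffunP=> s; rewrite !ffunE.
  have ej : e j = q.-1 :> nat by have := ltn_ord (e j); lia.
  pose e' i := if i == j then 0%N else e i : nat.
  have e'j : e' j = 0%N by rewrite /e' eqxx.
  have se : (\sum_i e i = q.-1 + \sum_i e' i)%N.
    rewrite (bigD1 j) //= ej [in RHS](bigD1 j) //= e'j add0n.
    by congr (_ + _)%N; apply: eq_bigr => i /negPf ij; rewrite /e' ij.
  have -> : fmul (x j) (mono (fun i => e i : nat)) =
            fmul [ffun s => x j s ^+ q] (mono e').
    apply/ffunP=> s; rewrite !ffunE (bigD1 j) //= [in RHS](bigD1 j) //=.
    rewrite ej e'j mulrA -exprS prednK // mul1r; congr (_ * _).
    by apply: eq_bigr => i /negPf ij; rewrite /e' ij.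
  apply: (subvP (reducedW (leqnSn k))); apply: IH; first exact: DN.
  by apply: polW (pol_mul (xq j) (pol_mono e')); rewrite -se.
- by apply: rpredD; [apply: IHf | apply: IHg].
Qed.

(** Every function on S is a polynomial in the coordinates, hence a combination of
    the q ^ #|J| monomials with exponents below q. *)
Lemma card_low_degree :
  (forall s t, (forall j, x j s = x j t) -> s = t) -> (#|S| <= q ^ #|J|)%N.
Proof.
move=> x_inj; have K2 : (1 < #|K|)%N := finNzRing_gt1 K.
(* The indicator of s0 is the product over j of the functions
   1 - (x j - x j s0) ^+ (#|K| - 1). *)
have ind s0 : exists k, pol k [ffun s => (s == s0)%:R].
  exists (\sum_(j : J) #|K|.-1)%N.
  suff -> : [ffun s => (s == s0)%:R] =
            [ffun s => \prod_j (1 - (x j s - x j s0) ^+ #|K|.-1)] :> {ffun S -> K^o}.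
    elim: (index_enum J) => [|j r IH].
      rewrite big_nil (_ : finfun _ = [ffun=> 1]); first exact: pol_const.
      by apply/ffunP=> s; rewrite !ffunE big_nil.
    rewrite big_cons (_ : finfun _ = fmul
        ([ffun=> 1] - [ffun s => (x j s - x j s0) ^+ #|K|.-1] : {ffun S -> K^o})
       [ffun s => \prod_(i <- r) (1 - (x i s - x i s0) ^+ #|K|.-1)]).
      apply: pol_mul => //; apply: pol_add; first exact: pol_const.
      apply: polN; elim: (#|K|.-1) => [|c IHc].
        rewrite (_ : finfun _ = [ffun=> 1]); first exact: pol_const.
        by apply/ffunP=> s; rewrite !ffunE.
      rewrite (_ : finfun _ = fmul (fmul (x j) [ffun=> 1] - [ffun=> x j s0])
         [ffun s => (x j s - x j s0) ^+ c]).
        apply: (@pol_mul 1) => //; apply: pol_add; last exact/polN/pol_const.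
        exact/pol_var/pol_const.
      by apply/ffunP=> s; rewrite !ffunE mulr1 exprS.
    by apply/ffunP=> s; rewrite !ffunE big_cons.
  apply/ffunP=> s; rewrite !ffunE.
  have [->|ne] := eqVneq s s0.
    have K1 : (0 < #|K|.-1)%N by lia.
    by rewrite big1 // => j _; rewrite subrr expr0n; case: (#|K|.-1) K1 => // c _; rewrite subr0.
  have [j xj] : exists j, x j s != x j s0.
    apply/existsP; apply: contraR ne => /existsPn h.
    by apply/eqP/x_inj => j; apply/eqP; have := h j; rewrite negbK.
  rewrite (bigD1 j) //= (_ : _ ^+ _ = 1) ?subrr ?mul0r //.
  have nz : x j s - x j s0 != 0 by rewrite subr_eq0.
  apply: (mulfI nz); rewrite -exprS mulr1 prednK ?expf_card //; exact: ltnW K2.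
have [D allD] : exists D, forall s0, pol D [ffun s => (s == s0)%:R].
  have [k kP] := choice ind.
  by exists (\max_s k s) => s0; apply: polW (kP s0); apply: leq_bigmax.
have full : (fullv <= reduced D)%VS.
  apply/subvP=> f _; rewrite [f]ffun_sum_delta.
  by apply: memv_suml => s0 _; apply/memvZ/pol_reduced.
by rewrite -(dim_ffun K S); apply: leq_trans (dimvS full) (dim_reduced D).
Qed.

End LowDegree.

(** * Smith normal form of the relator matrix *)

Section Smith.
Local Open Scope ring_scope.

(** A Smith normal form L' M = d R', M R = L d over arbitrary finite index sets. The
    diagonal is indexed by the columns, with zeros where there is no row; only
    the inverse pair R, R' is square. *)
Record smith {A E : finType} (M : A -> E -> int) := Smith {
  sm_d : E -> int;
  sm_L : A -> E -> int;
  sm_L' : E -> A -> int;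
  sm_R : E -> E -> int;
  sm_R' : E -> E -> int;
  sm_row : forall i e, \sum_a sm_L' i a * M a e = sm_d i * sm_R' i e;
  sm_col : forall a i, \sum_e M a e * sm_R e i = sm_d i * sm_L a i;
  sm_RR' : forall e e', \sum_i sm_R e i * sm_R' i e' = (e == e')%:R;
  sm_R'R : forall i j, \sum_e sm_R' i e * sm_R e j = (i == j)%:R }.

Lemma smith_exists {A E : finType} (M : A -> E -> int) : inhabited (smith M).
Proof.
pose Mm := \matrix_(a < #|A|, e < #|E|) M (enum_val a) (enum_val e).
have [Lm uL [Rm uR [d _ MLR]]] := int_Smith_normal_form Mm.
have sumE (I : finType) (F : I -> int) :
  \sum_i F i = \sum_(i < #|I|) F (enum_val i) :> int.
  by rewrite (reindex (@enum_val I predT)) //; apply/onW_bij/enum_val_bij.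
have ME a e : M a e = Mm (enum_rank a) (enum_rank e) by rewrite mxE !enum_rankK.
pose k i : option 'I_#|A| := insub (enum_rank (i : E) : nat).
have kP i l : k i = Some l -> l = enum_rank i :> nat.
  by move=> kl; have := insubK 'I_#|A| (enum_rank i : nat); rewrite -/(k i) kl.
exists; exists (fun i => if k i is Some l then d`_l else 0)
  (fun a i => if k i is Some l then Lm (enum_rank a) l else 0)
  (fun i a => if k i is Some l then invmx Lm l (enum_rank a) else 0)
  (fun e i => invmx Rm (enum_rank e) (enum_rank i))
  (fun i e => Rm (enum_rank i) (enum_rank e)).
- move=> i e; case kl: (k i) => [l|]; last first.
    by rewrite mul0r big1 // => a _; rewrite mul0r.
  have lE := kP _ _ kl.
  transitivity ((invmx Lm *m Mm) l (enum_rank e)).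
    by rewrite mxE sumE; apply: eq_bigr => a _; rewrite ME enum_valK.
  rewrite MLR -mulmxA mulKmx // mxE (bigD1 (enum_rank i)) //= big1 => [|j ji].
    by rewrite !mxE lE eqxx mulr1n addr0.
  by rewrite !mxE lE eq_sym [_ == _](negPf ji) mulr0n mul0r.
- move=> a i; transitivity ((Mm *m invmx Rm) (enum_rank a) (enum_rank i)).
    by rewrite mxE sumE; apply: eq_bigr => e _; rewrite ME enum_valK.
  rewrite MLR mulmxK // mxE; case kl: (k i) => [l|].
    have lE := kP _ _ kl.
    rewrite (bigD1 l) //= big1 => [|j jl]; first by rewrite mxE lE eqxx addr0 mulrC.
    by rewrite mxE -lE [_ == _](negPf jl) mulr0n mulr0.
  rewrite mul0r big1 // => j _; rewrite mxE; case: eqP => [jE|]; last by rewrite mulr0.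
  have h : (enum_rank i < #|A|)%N by rewrite -jE.
  by move: kl; rewrite /k insubT.
- move=> e e'; transitivity ((invmx Rm *m Rm) (enum_rank e) (enum_rank e')).
    by rewrite mxE sumE; apply: eq_bigr => i _; rewrite !enum_valK.
  by rewrite mulVmx // mxE (inj_eq enum_rank_inj).
- move=> e e'; transitivity ((Rm *m invmx Rm) (enum_rank e) (enum_rank e')).
    by rewrite mxE sumE; apply: eq_bigr => i _; rewrite !enum_valK.
  by rewrite mulmxV // mxE (inj_eq enum_rank_inj).
Qed.

Section Relators.
Context {n m : nat} (rel : 'I_m -> seq 'I_n) {Y : finType} (st : 'I_n -> Y -> Y).
Local Notation E := ('I_n * Y)%type.
Local Notation A := ('I_m * Y)%type.

(** The matrix of the system of linear equations that defines the cocycles. *)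
Definition incidence (c : A) (e : E) : int :=
  relsum st (fun e' => (e' == e)%:R) c.2 (rel c.1).

Lemma relsum_incidence (V : zmodType) (f : E -> V) i y :
  relsum st f y (rel i) = \sum_e f e *~ incidence (i, y) e.
Proof.
rewrite /incidence /relsum /=; elim: (edges _ _ _) => [|e s IH].
  by rewrite big_nil big1 // => e _; rewrite big_nil mulr0z.
rewrite big_cons IH (bigD1 e) //= [in RHS](bigD1 e) //= addrA big_cons eqxx.
rewrite mulrzDr mulr1z; congr (_ + _); apply: eq_bigr => e' /negPf ne.
by rewrite big_cons eq_sym ne add0r.
Qed.

Context (S : smith incidence).
Local Notation d := (sm_d S).
Local Notation R := (sm_R S).
Local Notation R' := (sm_R' S).

Definition sm_coord (V : zmodType) (f : E -> V) i : V := \sum_e f e *~ R' i e.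

Lemma sum_mulrz (V : zmodType) (I J : finType) (f : I -> V) (a : I -> J -> int)
  (b : J -> int) :
  \sum_j (\sum_i f i *~ a i j) *~ b j = \sum_i f i *~ (\sum_j a i j * b j).
Proof.
under eq_bigr do rewrite mulrz_suml.
rewrite exchange_big; apply: eq_bigr => i _ /=; rewrite mulrz_sumr.
by apply: eq_bigr => j _; rewrite mulrzA.
Qed.

Lemma sum_delta (V : zmodType) (I : finType) (f : I -> V) j :
  \sum_i f i *~ (i == j)%:R = f j.
Proof.
rewrite (bigD1 j) //= eqxx mulr1z big1 ?addr0 // => i /negPf ->.
by rewrite mulr0z.
Qed.

Lemma sm_coordK (V : zmodType) (f : E -> V) e :
  \sum_i sm_coord f i *~ R e i = f e.
Proof.
rewrite (sum_mulrz f (fun e i => R' i e)) -[RHS](sum_delta f); apply: eq_bigr => e' _.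
rewrite eq_sym -(sm_RR' S); congr (_ *~ _).
by apply: eq_bigr => i _; rewrite mulrC.
Qed.

Lemma sm_coord_sum (V : zmodType) (t : E -> V) i :
  sm_coord (fun e => \sum_j t j *~ R e j) i = t i.
Proof.
rewrite /sm_coord (sum_mulrz t (fun j e => R e j)) -[RHS](sum_delta t); apply: eq_bigr => j _.
rewrite eq_sym -(sm_R'R S); congr (_ *~ _).
by apply: eq_bigr => e _; rewrite mulrC.
Qed.

Lemma sm_relsum (V : zmodType) (f : E -> V) i y :
  relsum st f y (rel i) = \sum_j sm_coord f j *~ (d j * sm_L S (i, y) j).
Proof.
rewrite relsum_incidence; under eq_bigr do rewrite -sm_coordK.
rewrite (sum_mulrz (sm_coord f) (fun j e => R e j)); apply: eq_bigr => j _; rewrite -sm_col; congr (_ *~ _).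
by apply: eq_bigr => e _; rewrite mulrC.
Qed.

Lemma sm_row_relsum (V : zmodType) (f : E -> V) i :
  \sum_c relsum st f c.2 (rel c.1) *~ sm_L' S i c = sm_coord f i *~ d i.
Proof.
rewrite /sm_coord mulrz_suml.
have -> : \sum_e f e *~ R' i e *~ d i =
          \sum_e f e *~ (\sum_c incidence c e * sm_L' S i c).
  apply: eq_bigr => e _; rewrite -mulrzA mulrC -sm_row; congr (_ *~ _).
  by apply: eq_bigr => c _; rewrite mulrC.
rewrite -(sum_mulrz f (fun e c => incidence c e)).
by apply: eq_bigr => -[j y] _; rewrite -relsum_incidence.
Qed.

(** In the coordinates of the normal form the cocycle equations are uncoupled. *)
Lemma sm_cocycle (V : zmodType) (f : E -> V) :
  (cocycle rel st f) <-> (forall i, sm_coord f i *~ d i = 0).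
Proof.
split=> [cf i|cf i y]; last first.
  by rewrite sm_relsum big1 // => j _; rewrite mulrzA cf mul0rz.
by rewrite -sm_row_relsum big1 // => c _; rewrite cf mul0rz.
Qed.

Lemma sm_cocycle_comb (V : zmodType) (t : E -> V) :
  (forall i, t i *~ d i = 0) -> cocycle rel st (fun e => \sum_j t j *~ R e j).
Proof. by move=> td; apply/sm_cocycle => i; rewrite sm_coord_sum. Qed.

(** A set and not a space: the coefficients will also be integers modulo a
    prime power. *)
Definition cocycle_set (V : finZmodType) : {set {ffun E -> V}} :=
  [set f : {ffun E -> V} | [forall i, forall y, relsum st f y (rel i) == 0]].

Lemma cocycle_setP (V : finZmodType) (f : {ffun E -> V}) :
  reflect (cocycle rel st f) (f \in cocycle_set V).
Proof.
rewrite inE; apply: (iffP forallP) => cf i.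
  by move=> y; apply/eqP; have /forallP := cf i; apply.
by apply/forallP => y; rewrite cf.
Qed.

Lemma card_cocycles_ge (V : finZmodType) (P : {set E}) :
  (forall i, i \in P -> forall v : V, v *~ d i = 0) ->
  (#|V| ^ #|P| <= #|cocycle_set V|)%N.
Proof.
move=> kill.
pose ex (t : {ffun {i | i \in P} -> V}) (i : E) := if insub i is Some j then t j else 0.
pose F t : {ffun E -> V} := [ffun e => \sum_j ex t j *~ R e j].
have Fi : injective F.
  move=> t t' tt; apply/ffunP=> j.
  have exE u : ex u (val j) = u j by rewrite /ex valK.
  rewrite -2!exE -[LHS]sm_coord_sum -[RHS]sm_coord_sum.
  by apply: eq_bigr => e _; have /ffunP /(_ e) := tt; rewrite !ffunE => ->.
rewrite -[#|P|](card_sig (mem P)) -card_ffun -(card_imset _ Fi).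
apply: subset_leq_card; apply/subsetP => _ /imsetP [t _ ->].
apply/cocycle_setP => i y.
have kt j : ex t j *~ d j = 0.
  rewrite /ex; case: insubP => [[j' /= jP] _ jj'|_]; last by rewrite mul0rz.
  by apply: kill; rewrite -jj'.
rewrite -[RHS](@sm_cocycle_comb V (ex t) kt i y).
by rewrite /relsum; apply: eq_bigr => e _; rewrite ffunE.
Qed.

Lemma card_cocycles_le (V : finZmodType) (P : {set E}) :
  (forall i, i \notin P -> forall v : V, v *~ d i = 0 -> v = 0) ->
  (#|cocycle_set V| <= #|V| ^ #|P|)%N.
Proof.
move=> inj.
pose F (f : {ffun E -> V}) := [ffun j : {i | i \in P} => sm_coord f (val j)].
rewrite -[#|P|](card_sig (mem P)) -card_ffun -(card_in_imset (f := F)) ?max_card //.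
move=> f g /cocycle_setP cf /cocycle_setP cg fg; apply/ffunP=> e.
rewrite -(sm_coordK f) -(sm_coordK g); apply: eq_bigr => i _; congr (_ *~ _).
have [iP|iP] := boolP (i \in P).
  by have /ffunP /(_ (exist _ i iP)) := fg; rewrite !ffunE.
have kf := (sm_cocycle f).1 cf i; have kg := (sm_cocycle g).1 cg i.
by rewrite (inj _ iP _ kf) (inj _ iP _ kg).
Qed.

Lemma card_cocycles_dim (K : finFieldType) :
  #|cocycle_set K| = (#|K| ^ \dim (cocycles rel K st))%N.
Proof.
rewrite -card_vspace; apply: eq_card => f.
by apply/cocycle_setP/cocyclesP.
Qed.

(** An elementary divisor 0 counts for every q. *)
Definition torsion (q : nat) : {set E} := [set i | (q%:Z %| d i)%Z].

Lemma mulrz_pchar (K : fieldType) (p : nat) (v : K) z : p \in [pchar K] ->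
  (v *~ z == 0) = (v == 0) || (p%:Z %| z)%Z.
Proof.
move=> pK; rewrite -mulrzr mulf_eq0; congr (_ || _).
by rewrite (dvdz_pcharf pK).
Qed.

Lemma dim_cocycles (K : finFieldType) (p : nat) :
  p \in [pchar K] -> \dim (cocycles rel K st) = #|torsion p|.
Proof.
move=> pK; apply/eqP; rewrite -(eqn_exp2l _ _ (finNzRing_gt1 K)).
rewrite -card_cocycles_dim eqn_leq; apply/andP; split.
  apply: card_cocycles_le => i; rewrite inE => ni v /eqP.
  by rewrite (mulrz_pchar _ _ pK) (negPf ni) orbF => /eqP.
apply: card_cocycles_ge => i; rewrite inE => di v.
by apply/eqP; rewrite (mulrz_pchar _ _ pK) di orbT.
Qed.

End Relators.
End Smith.

(** * Cocycles of a covering and twisted cocycles *)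

Section Twisted.
Context {n : nat} {K : fieldType} {E : Type}.

(** A crossed homomorphism along a word: the edge e acts on the coefficients by the
    multiplication by u e. *)
Fixpoint tw (u f : E -> {poly K}) (s : seq E) : {poly K} :=
  if s is e :: s' then f e + u e * tw u f s' else 0.

Lemma twD u f g s : tw u (fun e => f e + g e) s = tw u f s + tw u g s.
Proof.
elim: s => [|e s IH] /=; first by rewrite addr0.
by rewrite IH mulrDr addrACA.
Qed.

Lemma twN u f s : tw u (fun e => - f e) s = - tw u f s.
Proof. by elim: s => [|e s IH] /=; rewrite ?oppr0 // IH mulrN opprD. Qed.

Lemma tw_subr1 u s : tw u (fun e => u e - 1) s = \prod_(e <- s) u e - 1.
Proof.
elim: s => [|e s IH] /=; first by rewrite big_nil subrr.
by rewrite IH big_cons mulrBr mulr1 addrC addrA subrK.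
Qed.

Lemma tw_mull u f g s : tw u (fun e => g * f e) s = g * tw u f s.
Proof.
by elim: s => [|e s IH] /=; rewrite ?mulr0 // IH mulrCA -mulrDr.
Qed.

Lemma eq_tw u f g s : f =1 g -> tw u f s = tw u g s.
Proof. by move=> fg; elim: s => //= e s ->; rewrite fg. Qed.

End Twisted.

Section Covering.
Context {n m : nat} (rel : 'I_m -> seq 'I_n) {Y : finType} (st : 'I_n -> Y -> Y).
Context {K : fieldType} {p b : nat} (pK : p \in [pchar K]) (b_gt0 : (0 < b)%N).
Let q := (p ^ b)%N.
Context {J : finType} (N : 'I_n * Y -> {ffun J -> 'Z_q}).
Local Notation E := ('I_n * Y)%type.
Local Notation A := {ffun J -> 'Z_q}.
Local Notation V := {ffun 'I_n * (Y * A) -> K^o}.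

Let q_gt1 : (1 < q)%N.
Proof. exact: prime_power_gt1 (pcharf_prime pK) b_gt0. Qed.

(** The unit of K[X] / X^q by which an edge acts: the generator j of the
    group A of the covering acts as 1 + c j X. *)
Definition label (c : {ffun J -> K}) (e : E) : {poly K} :=
  \prod_j (1 + c j *: 'X) ^+ (N e j : nat).

(** The rows of length q stand for the elements of K[X] / X^q. *)
Definition twisted_cocycle (c : {ffun J -> K}) (f : {ffun E -> 'rV[K]_q}) :=
  forall i y k, (k < q)%N ->
    (tw (label c) (fun e => rVpoly (f e)) (edges st y (rel i)))`_k = 0.

Definition shift_fun (d : A) (F : V) : V :=
  [ffun e : 'I_n * (Y * A) => F (e.1, (e.2.1, (e.2.2 + d : A)))].

Fact shift_linear d : linear (shift_fun d).
Proof. by move=> a F G; apply/ffunP=> e; rewrite !ffunE. Qed.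
HB.instance Definition _ d := GRing.isLinear.Build K V V _ _ (shift_linear d).

Definition shift d : 'End(V) := linfun (shift_fun d).

Lemma shiftE d F e : shift d F e = F (e.1, (e.2.1, (e.2.2 + d : A))).
Proof. by rewrite lfunE ffunE. Qed.

Lemma shiftD d d' F : shift (d + d') F = shift d (shift d' F).
Proof. by apply/ffunP=> e; rewrite !shiftE /= addrA. Qed.

Lemma shift_cocycle d F :
  F \in cocycles rel K (ext st N) -> shift d F \in cocycles rel K (ext st N).
Proof.
move=> /cocyclesP cF; apply/cocyclesP => i y.
rewrite -[RHS](cF i (y.1, y.2 + d)).
rewrite (@relsum_map _ _ _ _ (ext st N) _ (fun z => (z.1, z.2 + d))).
  by rewrite /relsum; apply: eq_bigr => e _; rewrite shiftE.
by move=> x z; rewrite /ext /= addrAC.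
Qed.

Definition unitv j : A := [ffun i => (i == j)%:R].

Definition dif j : 'End(V) := (shift (unitv j) - \1)%VF.

Lemma difE j F : dif j F = shift (unitv j) F - F.
Proof. by rewrite add_lfunE opp_lfunE id_lfunE. Qed.

Lemma difC i j F : dif i (dif j F) = dif j (dif i F).
Proof.
rewrite !difE !linearB /= -!shiftD [unitv j + _]addrC !opprK !addrA.
by congr (_ + _); apply: addrAC.
Qed.

Lemma dif_nil j F : iter q (dif j) F = 0.
Proof.
rewrite (iter_pcharB1 pK); apply/eqP; rewrite subr_eq0; apply/eqP.
have it k : iter k (shift (unitv j)) F = shift (unitv j *+ k) F.
  elim: k => [|k IH]; last by rewrite iterS IH mulrS shiftD.
  by apply/ffunP=> -[x [y a]]; rewrite shiftE mulr0n addr0.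
rewrite it; apply/ffunP=> -[x [y a]]; rewrite shiftE /=.
suff -> : unitv j *+ p ^ b = 0 by rewrite addr0.
apply/ffunP=> i; rewrite ffunMnE !ffunE; case: (i == j); last by rewrite mul0rn.
exact: (pchar_Zp q_gt1).
Qed.

Context (c : {ffun J -> K}) (j1 : J) (cj1 : c j1 != 0).

(** The shifts commute and the difference operators dif j are nilpotent of order q.
    Cutting down to the common kernel of the bend j, which makes every dif j
    proportional to dif j1, costs a factor q for each j other than j1. *)
Definition bend j : 'End(V) := (dif j - (c j / c j1) *: dif j1)%VF.

(** The cocycles on which every shift is the polynomial 1 + c j T in one nilpotent
    operator T, namely nilop below. *)
Definition bent : {vspace V} :=
  (cocycles rel K (ext st N) :&:
   \bigcap_(j | j != j1) lker (bend j))%VS.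

Definition nilop : 'End(V) := (c j1)^-1 *: dif j1.

Lemma bendE j F : bend j F = dif j F - (c j / c j1) *: dif j1 F.
Proof. by rewrite add_lfunE opp_lfunE scale_lfunE. Qed.

Lemma nilopE F : nilop F = (c j1)^-1 *: dif j1 F.
Proof. by rewrite scale_lfunE. Qed.

Lemma dif_cocycle j F :
  F \in cocycles rel K (ext st N) -> dif j F \in cocycles rel K (ext st N).
Proof. by move=> cF; rewrite difE rpredB // shift_cocycle. Qed.

Lemma bentP F : reflect (F \in cocycles rel K (ext st N) /\
  forall j, dif j F = c j *: nilop F) (F \in bent).
Proof.
apply: (iffP memv_capP) => [[cF kF]|[cF kF]]; split=> //.
  move=> j; rewrite nilopE scalerA; have [->|ne] := eqVneq j j1.
    by rewrite divff // scale1r.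
  apply/eqP; rewrite -subr_eq0 -bendE -memv_ker.
  by have /subv_bigcapP /(_ j ne) := kF; apply.
apply/subv_bigcapP => j _; rewrite -memvE memv_ker bendE kF nilopE scalerA.
by rewrite subrr.
Qed.

Lemma bendC i j F : bend i (bend j F) = bend j (bend i F).
Proof.
have dC k F' : dif k (dif j1 F') = dif j1 (dif k F') by apply: difC.
rewrite !bendE !linearB /= !linearZ /= !scalerA !dC.
rewrite (difC i j) [c i / _ * (_ / _)]mulrC !addrA; congr (_ + _).
by rewrite addrAC.
Qed.

Lemma bend_nil j F : iter q (bend j) F = 0.
Proof.
have -> : bend j = (dif j + (- (c j / c j1)) *: dif j1)%VF.
  by apply/lfunP=> G; rewrite bendE add_lfunE scale_lfunE scaleNr.
rewrite (iter_pcharD pK) => [|G]; last first.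
  by rewrite !scale_lfunE linearZ /= difC.
rewrite -/q dif_nil add0r.
suff E k : iter k ((- (c j / c j1)) *: dif j1)%VF F =
    (- (c j / c j1)) ^+ k *: iter k (dif j1) F by rewrite E dif_nil scaler0.
elim: k => [|k IH] /=; first by rewrite scale1r.
by rewrite IH scale_lfunE linearZ /= scalerA exprS.
Qed.

Lemma dim_bent :
  (\dim (cocycles rel K (ext st N)) <= q ^ #|J|.-1 * \dim bent)%N.
Proof.
pose bs := [seq bend j | j <- enum [pred j | j != j1]].
have -> : #|J|.-1 = size bs by rewrite size_map -cardE cardC1.
have -> : bent = (cocycles rel K (ext st N) :&: \bigcap_(f <- bs) lker f)%VS.
  by rewrite big_map big_enum.
apply: dim_nilpotents.
- move=> _ /mapP [j _ ->]; apply/subvP=> _ /memv_imgP [F cF ->].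
  by rewrite bendE rpredB ?rpredZ ?dif_cocycle.
- by move=> _ /mapP [j _ ->] F _; apply: bend_nil.
- by move=> _ _ /mapP [i _ ->] /mapP [j _ ->] F; apply: bendC.
Qed.

Lemma nilop_nil F : iter q nilop F = 0.
Proof.
suff E k : iter k nilop F = (c j1)^-1 ^+ k *: iter k (dif j1) F.
  by rewrite E dif_nil scaler0.
elim: k => [|k IH] /=; first by rewrite scale1r.
by rewrite IH nilopE linearZ /= scalerA exprS.
Qed.

Lemma nilop_bent F : F \in bent -> nilop F \in bent.
Proof.
case/bentP => cF dF; apply/bentP; split.
  by rewrite nilopE rpredZ // dif_cocycle.
by move=> j; rewrite [nilop F in LHS]nilopE linearZ /= difC dF linearZ /=
   scalerA mulrC -scalerA -nilopE.
Qed.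

Lemma iter_nilop_bent k F : F \in bent -> iter k nilop F \in bent.
Proof. by move=> uF; elim: k => //= k; apply: nilop_bent. Qed.

Definition evalop F (g : {poly K}) : V := \sum_(k < q) g`_k *: iter k nilop F.

Lemma evalopD F g h : evalop F (g + h) = evalop F g + evalop F h.
Proof.
by rewrite -big_split; apply: eq_bigr => k _; rewrite coefD scalerDl.
Qed.

Lemma evalopZ F a g : evalop F (a *: g) = a *: evalop F g.
Proof.
by rewrite scaler_sumr; apply: eq_bigr => k _; rewrite coefZ scalerA.
Qed.

Lemma evalopX F g : evalop F ('X * g) = nilop (evalop F g).
Proof.
rewrite /evalop linear_sum /=.
have H (r : nat) : (0 < r)%N -> iter r nilop F = 0 ->
  \sum_(k < r) ('X * g)`_k *: iter k nilop F =
  \sum_(k < r) nilop (g`_k *: iter k nilop F).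
  case: r => // r _ nil; rewrite big_ord_recl coefXM /= scale0r add0r.
  rewrite [RHS]big_ord_recr /= linearZ /= -[nilop _]iterS nil scaler0 addr0.
  by apply: eq_bigr => k _; rewrite coefXM /= linearZ.
by apply: H; [apply: ltnW | apply: nilop_nil].
Qed.

Lemma evalop_bent F g : F \in bent -> evalop F g \in bent.
Proof.
by move=> uF; apply: memv_suml => k _; apply/memvZ/iter_nilop_bent.
Qed.

Lemma evalop_var F j g : F \in bent ->
  evalop F ((1 + c j *: 'X) * g) = shift (unitv j) (evalop F g).
Proof.
move=> uF; have /bentP [_ dF] := evalop_bent g uF.
rewrite mulrDl mul1r -scalerAl evalopD evalopZ evalopX -dF difE.
by rewrite addrC subrK.
Qed.

(** Multiplying by the label of an edge is moving along it in the covering. *)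
Lemma evalop_label F e g : F \in bent ->
  evalop F (label c e * g) = shift (N e) (evalop F g).
Proof.
move=> uF; have -> : N e = \sum_j unitv j *+ (N e j : nat).
  apply/ffunP=> i; rewrite sum_ffunE (bigD1 i) //= big1 => [|j ji].
    by rewrite ffunMnE ffunE eqxx addr0 natr_Zp.
  by rewrite ffunMnE ffunE eq_sym (negPf ji) mul0rn.
rewrite /label; elim: (index_enum J) g => [|j r IH] g.
  rewrite !big_nil mul1r; apply/ffunP=> -[x [y a]].
  by rewrite shiftE addr0.
rewrite !big_cons -mulrA; set g' := _ * g.
have -> : shift (unitv j *+ (N e j : nat) + \sum_(j <- r) unitv j *+ (N e j : nat))
   (evalop F g) = shift (unitv j *+ (N e j : nat)) (evalop F g').
  by rewrite shiftD /g' IH.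
elim: (N e j : nat) => [|k IHk].
  rewrite mul1r mulr0n; apply/ffunP=> -[x [y a]].
  by rewrite shiftE addr0.
by rewrite exprS -mulrA evalop_var // IHk mulrS shiftD.
Qed.

(** The values over Y x 0 of the iterates of T on F, read backwards as the
    coefficients of a truncated polynomial: T becomes the multiplication by X. *)
Definition germ (F : V) : {ffun E -> 'rV[K]_q} :=
  [ffun e => \row_(i < q) iter (q.-1 - i) nilop F (e.1, (e.2, 0))].

Lemma coef_germ F g e :
  (g * rVpoly (germ F e))`_q.-1 = evalop F g (e.1, (e.2, 0)).
Proof.
rewrite coefM sum_ffunE; have E : q.-1.+1 = q by rewrite prednK // ltnW.
rewrite (big_ord_widen_cond q (fun=> true) (fun k => g`_k * (rVpoly (germ F e))`_(q.-1 - k))) ?E //.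
apply: eq_big => [k|k _]; first by rewrite /= ltn_ord.
have lt : (q.-1 - k < q)%N by lia.
rewrite (coef_rVpoly_ord _ (Ordinal lt)) !ffunE mxE /= subKn //.
by have := ltn_ord k; lia.
Qed.

Lemma relsum_shift d F (y : Y) a w :
  relsum (ext st N) (shift d F) (y, a) w = relsum (ext st N) F (y, a + d) w.
Proof.
rewrite (@relsum_map _ _ _ _ (ext st N) (ext st N) (fun z => (z.1, z.2 + d)) _ (y, a)).
  by rewrite /relsum; apply: eq_bigr => e _; rewrite shiftE.
by move=> x z; rewrite /ext /= addrAC.
Qed.

Lemma germ_path F g w y : F \in bent ->
  (g * tw (label c) (fun e => rVpoly (germ F e)) (edges st y w))`_q.-1 =
  relsum (ext st N) (evalop F g) (y, 0) w.
Proof.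
move=> uF; elim: w y g => [|x w IH] y g /=.
  by rewrite mulr0 coef0 relsum_nil.
rewrite mulrDr coefD coef_germ relsum_cons mulrA IH; congr (_ + _).
by rewrite mulrC evalop_label // relsum_shift /ext /= add0r.
Qed.

(** The coefficients of the twisted sum of the germ along a path are the sums along
    the lifted path of the iterates of T on F, which are cocycles. *)
Lemma germ_twisted F : F \in bent -> twisted_cocycle c (germ F).
Proof.
move=> uF i y k kq.
have : relsum (ext st N) (iter (q.-1 - k) nilop F) (y, 0) (rel i) = 0.
  by have /bentP [/cocyclesP cF _] := iter_nilop_bent (q.-1 - k) uF.
have -> : (tw (label c) (fun e => rVpoly (germ F e)) (edges st y (rel i)))`_k =
  ('X^(q.-1 - k) * tw (label c) (fun e => rVpoly (germ F e)) (edges st y (rel i)))`_q.-1.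
  rewrite coefXnM ifF; last by lia.
  by congr (_`_ _); lia.
have lt : (q.-1 - k < q)%N by lia.
have -> : iter (q.-1 - k) nilop F = evalop F 'X^(q.-1 - k).
  rewrite /evalop (bigD1 (Ordinal lt)) //= big1 => [|l ll].
    by rewrite coefXn eqxx scale1r addr0.
  rewrite coefXn (_ : (l == _ :> nat) = false) ?scale0r //.
  by apply: contraNF ll => /eqP ll; apply/eqP/val_inj.
by rewrite -germ_path.
Qed.

Lemma germB F G : germ (F - G) = germ F - germ G.
Proof.
apply/ffunP=> e; apply/rowP=> i; rewrite !ffunE !mxE.
suff -> k : iter k nilop (F - G) = iter k nilop F - iter k nilop G by rewrite !ffunE.
by elim: k => //= k ->; rewrite linearB.
Qed.

(** The shifts are polynomials in T, so that the values of F over Y x a are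
    combinations of the values of the iterates of T over Y x 0. *)
Lemma germ_inj : {in bent &, injective germ}.
Proof.
move=> F G uF uG FG; apply/eqP; rewrite -subr_eq0; apply/eqP.
have: germ (F - G) = 0 by rewrite germB FG subrr.
have: F - G \in bent by apply: rpredB.
move: (F - G) => {F G uF uG FG} F uF F0.
have ev0 g e : evalop F g (e.1, (e.2, 0)) = 0.
  by rewrite -coef_germ F0 ffunE linear0 mulr0 coef0.
have ev1 : evalop F 1 = F.
  rewrite /evalop (bigD1 (Ordinal (ltnW q_gt1))) //= big1 => [|k k0].
    by rewrite coef1 scale1r addr0.
  by rewrite coef1 (_ : (k == 0%N :> nat) = false) ?scale0r //; apply: contraNF k0 => /eqP k0; apply/eqP/val_inj.
apply/ffunP=> -[x [y a]]; rewrite [RHS]ffunE.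
suff [g ag] : exists g, evalop F g = shift a F.
  by have := ev0 g (x, y); rewrite ag shiftE /= add0r.
have -> : a = \sum_j unitv j *+ (a j : nat).
  apply/ffunP=> i; rewrite sum_ffunE (bigD1 i) //= big1 => [|j ji].
    by rewrite ffunMnE ffunE eqxx addr0 natr_Zp.
  by rewrite ffunMnE ffunE eq_sym (negPf ji) mul0rn.
elim/big_rec: _ => [|j d _ [g gd]].
  exists 1; rewrite ev1; apply/ffunP=> -[x' [y' a']].
  by rewrite shiftE addr0.
elim: (a j : nat) => [|k [h hk]].
  by exists g; rewrite mulr0n add0r.
exists ((1 + c j *: 'X) * h); rewrite evalop_var // hk.
by rewrite mulrS -addrA !shiftD.
Qed.

End Covering.

(** * Labels read off the elementary divisors *)

Section ExactLabels.
Context {n m : nat} (rel : 'I_m -> seq 'I_n) {Y : finType} (st : 'I_n -> Y -> Y).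
Context (p b : nat) (p_pr : prime p) (b_gt0 : (0 < b)%N).
Let q := (p ^ b)%N.
Local Notation E := ('I_n * Y)%type.
Local Notation A := ('I_m * Y)%type.
Context (S : smith (incidence rel st)).
Local Notation d := (sm_d S).

Definition exact_torsion : {set E} := torsion S q :\: torsion S (q * p).
Definition exact_index := {i : E | i \in exact_torsion}.
Local Notation J := exact_index.

Let q_gt1 : (1 < q)%N.
Proof. exact: prime_power_gt1. Qed.

Lemma q_dvd (j : J) : (q%:Z %| d (val j))%Z.
Proof. by case: j => i /= /setDP [+ _]; rewrite inE. Qed.

Lemma p_dvd (j : J) : (p%:Z %| d (val j))%Z.
Proof.
apply: dvdz_trans (q_dvd j); rewrite /q; case: b b_gt0 => // b' _.
by rewrite expnS; apply: dvdn_mulr.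
Qed.

Lemma pN_dvd (j : J) : ~~ (p%:Z %| (d (val j) %/ q)%Z)%Z.
Proof.
apply/negP => pd; have := valP j; rewrite !inE => /andP [/negP nd _]; apply: nd.
by rewrite -(divzK (q_dvd j)) PoszM [_%:Z * p%:Z]mulrC; apply: dvdz_mul.
Qed.

(** The columns of R at the exact indices, reduced modulo q: they satisfy the
    cocycle equations modulo q because q divides the elementary divisors. *)
Definition exact_label (e : E) : {ffun J -> 'Z_q} :=
  [ffun j => (`|(sm_R S e (val j) %% q)%Z|%N)%:R].

Lemma exact_labelE e j :
  (exact_label e j : nat)%:Z = (sm_R S e (val j) %% q)%Z.
Proof.
have q0 : q%:Z != 0 by rewrite -lt0n (ltnW q_gt1).
rewrite ffunE val_Zp_nat ?q_gt1 // modn_small ?gez0_abs ?modz_ge0 //.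
by rewrite -ltz_nat gez0_abs ?modz_ge0 // ltz_pmod // ltz_nat (ltnW q_gt1).
Qed.

(** The sum of the representatives of the labels along a relator, divided by q. *)
Definition exact_mult (c : A) (j : J) : int :=
  (d (val j) %/ q)%Z * sm_L S c (val j) -
  \sum_e incidence rel st c e * (sm_R S e (val j) %/ q)%Z.

Lemma exact_labelD e j :
  (exact_label e j : nat)%:Z = sm_R S e (val j) - (sm_R S e (val j) %/ q)%Z * q.
Proof.
by rewrite exact_labelE {2}(divz_eq (sm_R S e (val j)) q) addrC addKr.
Qed.

Lemma sum_exact_label c j :
  \sum_e incidence rel st c e * (exact_label e j : nat)%:Z = q%:Z * exact_mult c j.
Proof.
under eq_bigr do rewrite exact_labelD mulrBr.
rewrite sumrB sm_col /exact_mult mulrBr mulrA [q%:Z * _]mulrC (divzK (q_dvd j)).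
by congr (_ - _); rewrite mulr_sumr; apply: eq_bigr => e _; ring.
Qed.

(** Modulo p the normal form diagonalises these multiplicities, and the diagonal
    is invertible because q is the exact power of p. *)
Lemma row_exact_mult (K : fieldType) (pK : p \in [pchar K]) (i j : J) :
  (\sum_c sm_L' S (val i) c * exact_mult c j)%:~R =
     (d (val i) %/ q)%Z%:~R * (i == j)%:R :> K.
Proof.
pose t := \sum_e sm_R' S (val i) e * (sm_R S e (val j) %/ q)%Z.
have q0 : q%:Z != 0 by rewrite -lt0n (ltnW q_gt1).
have -> : \sum_c sm_L' S (val i) c * exact_mult c j =
          (d (val i) %/ q)%Z * ((i == j)%:R - q%:Z * t).
  apply: (mulfI q0); rewrite mulr_sumr.
  under eq_bigr do rewrite mulrCA -sum_exact_label mulr_sumr.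
  rewrite exchange_big /= [RHS]mulrA [in RHS](mulrC q%:Z) (divzK (q_dvd i)) mulrBr.
  transitivity (\sum_e d (val i) * sm_R' S (val i) e * (exact_label e j : nat)%:Z).
    apply: eq_bigr => e _; rewrite -sm_row mulr_suml.
    by apply: eq_bigr => c _; rewrite mulrA.
  under eq_bigr do rewrite exact_labelD mulrBr -mulrA.
  rewrite sumrB -mulr_sumr sm_R'R; congr (_ * _ - _).
  by rewrite /t !mulr_sumr; apply: eq_bigr => e _; ring.
rewrite rmorphM rmorphB rmorphM /=; congr (_ * _).
have -> : q%:Z%:~R = 0 :> K.
  apply/eqP; rewrite -(dvdz_pcharf pK) /q; case: b b_gt0 => // b' _.
  by rewrite expnS; apply: dvdn_mulr.
by rewrite mul0r subr0; case: eqP.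
Qed.

Lemma ffun_mulrz (I : finType) (V : zmodType) (f : {ffun I -> V}) z i :
  (f *~ z) i = f i *~ z.
Proof.
case: z => k; first by rewrite -!pmulrn ffunMnE.
by rewrite NegzE !mulrNz ffunE -!pmulrn ffunMnE.
Qed.

Lemma exact_label_cocycle : cocycle rel st exact_label.
Proof.
move=> i y; rewrite relsum_incidence; apply/ffunP=> j; rewrite sum_ffunE [RHS]ffunE.
transitivity ((\sum_e incidence rel st (i, y) e * (exact_label e j : nat)%:Z)%:~R : 'Z_q).
  rewrite rmorph_sum; apply: eq_bigr => e _; rewrite rmorphM /=.
  rewrite [(_ : nat)%:Z%:~R](_ : _ = exact_label e j); last exact: natr_Zp.
  by rewrite mulrzl ffun_mulrz.
rewrite sum_exact_label rmorphM /= (_ : q%:Z%:~R = 0 :> 'Z_q) ?mul0r //.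
exact: (pchar_Zp q_gt1).
Qed.

End ExactLabels.

(** * Coefficients of twisted sums *)

Section TwistedCoefs.
Context {K : finFieldType} {J T : finType} (x : J -> T -> K).
Local Notation pol := (pol x).

Lemma tw_lead (E : Type) (u g : E -> {poly K}) k s :
  (forall e, (u e)`_0 = 1) -> (forall e l, (l < k)%N -> (g e)`_l = 0) ->
  (tw u g s)`_k = \sum_(e <- s) (g e)`_k.
Proof.
move=> u0 g0; suff [] : (forall l, (l < k)%N -> (tw u g s)`_l = 0) /\
   (tw u g s)`_k = \sum_(e <- s) (g e)`_k by [].
elim: s => [|e s [IH0 IH]] /=.
  by split=> [l _|]; rewrite coef0 ?big_nil.
have low l : (l <= k)%N -> (u e * tw u g s)`_l = (tw u g s)`_l.
  move=> lk; rewrite coefM big_ord_recl u0 mul1r subn0 big1 ?addr0 // => j _.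
  by rewrite IH0 ?mulr0 //= /bump /=; have := ltn_ord j; lia.
split=> [l lk|]; rewrite coefD low ?big_cons ?IH // 1?ltnW //.
by rewrite g0 // IH0 // addr0.
Qed.

Definition coefs (u : T -> {poly K}) k : {ffun T -> K^o} := [ffun s => (u s)`_k].

Lemma pol_coefM u v k :
  (forall l, (l <= k)%N -> pol l (coefs u l)) ->
  (forall l, (l <= k)%N -> pol l (coefs v l)) ->
  pol k (coefs (fun s => u s * v s) k).
Proof.
move=> pu pv.
have -> : coefs (fun s => u s * v s) k =
   \sum_(j < k.+1) fmul (coefs u j) (coefs v (k - j)).
  by apply/ffunP=> s; rewrite sum_ffunE ffunE coefM; apply: eq_bigr => j _; rewrite !ffunE.
apply: pol_sum => j _; have jk : (j <= k)%N by rewrite -ltnS.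
rewrite -{1}(subnKC jk); apply: pol_mul; [exact: pu | apply: pv; exact: leq_subr].
Qed.

(** The twist contributes to the coefficient of X^k only products of a positive
    coefficient of u with a coefficient of g of degree below k. *)
Lemma pol_tw (E : Type) (u g : T -> E -> {poly K}) k (s : seq E) :
  (forall e t, (u t e)`_0 = 1) ->
  (forall e l, pol l (coefs (fun t => u t e) l)) ->
  (forall e l, (l < k)%N -> pol l (coefs (fun t => g t e) l)) ->
  pol k [ffun t => (tw (u t) (g t) s)`_k - \sum_(e <- s) (g t e)`_k].
Proof.
move=> u0 pu pg; suff [] : (forall l, (l < k)%N -> pol l (coefs (fun t => tw (u t) (g t) s) l)) /\
  pol k [ffun t => (tw (u t) (g t) s)`_k - \sum_(e <- s) (g t e)`_k] by [].
elim: s => [|e s [IH0 IH]] /=.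
  split=> [l _|].
    rewrite (_ : coefs _ _ = [ffun=> 0]); first exact: pol_const.
    by apply/ffunP=> t; rewrite !ffunE coef0.
  rewrite (_ : finfun _ = [ffun=> 0]); first exact: pol_const.
  by apply/ffunP=> t; rewrite !ffunE coef0 big_nil subrr.
split=> [l lk|].
  rewrite (_ : coefs _ _ = coefs (g^~ e) l + coefs (fun t => u t e * tw (u t) (g t) s) l).
    apply: pol_add; first exact: pg.
    apply: pol_coefM => l' l'l; first exact: pu.
    by apply: IH0; apply: leq_ltn_trans lk.
  by apply/ffunP=> t; rewrite !ffunE coefD.
pose G t := (tw (u t) (g t) s)`_k - \sum_(e <- s) (g t e)`_k.
rewrite (_ : finfun _ = [ffun t => G t] + \sum_(j < k)
    fmul (coefs (u^~ e) (lift ord0 j)) (coefs (fun t => tw (u t) (g t) s) (k - lift ord0 j))).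
  apply: pol_add => //; apply: pol_sum => j _.
  have jk : (lift ord0 j <= k)%N by rewrite -ltnS ltn_ord.
  rewrite -{1}(subnKC jk); apply: pol_mul; first exact: pu.
  by apply: IH0; rewrite /= /bump /=; have := ltn_ord j; lia.
apply/ffunP=> t; rewrite !ffunE sum_ffunE big_cons coefD coefM big_ord_recl u0 mul1r subn0 /G.
rewrite (eq_bigr (fun j : 'I_k => fmul (coefs (u^~ e) (lift ord0 j))
   (coefs (fun t0 => tw (u t0) (g t0) s) (k - lift ord0 j)) t)); last first.
  by move=> j _; rewrite !ffunE.
by ring.
Qed.

End TwistedCoefs.

Section TwistedCount.
Context {n m : nat} (rel : 'I_m -> seq 'I_n) {Y : finType} (st : 'I_n -> Y -> Y).
Context (p b : nat) (p_pr : prime p) (b_gt0 : (0 < b)%N).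
Let q := (p ^ b)%N.
Local Notation E := ('I_n * Y)%type.
Local Notation A := ('I_m * Y)%type.
Context (S : smith (incidence rel st)).
Local Notation d := (sm_d S).
Local Notation J := (exact_index p b S).
Context {K : finFieldType} (pK : p \in [pchar K]).
Local Notation C := {ffun J -> K}.
Local Notation F := {ffun E -> 'rV[K]_q}.
Local Notation N := (exact_label p b S).

Let q_gt1 : (1 < q)%N.
Proof. exact: prime_power_gt1. Qed.

Lemma label_coef0 (c : C) e : (label N c e)`_0 = 1.
Proof.
rewrite -horner_coef0 horner_prod big1 // => j _.
by rewrite horner_exp !hornerE expr1n.
Qed.

(** label - 1 is the twisted coboundary of the constant 1. Divided by X, it satisfies
    the twisted cocycle equations in degrees below q - 1, as tw_quot shows. *)
Definition quot (c : C) (e : E) : {poly K} := drop_poly 1 (label N c e).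

Lemma quotE c e : 'X * quot c e = label N c e - 1.
Proof.
apply/polyP=> -[|k]; rewrite coefXM coefB coef1 /=.
  by rewrite label_coef0 subrr.
by rewrite coef_drop_poly addn1 subr0.
Qed.

Definition first_order (a : K) (P : {poly K}) :=
  exists R : {poly K}, P = 1 + a *: 'X^q + 'X^(q.+1) * R.

Lemma first_orderM a a' P P' :
  first_order a P -> first_order a' P' -> first_order (a + a') (P * P').
Proof.
move=> [R ->] [R' ->].
exists (R + R' + (a * a') *: 'X^(q.-1) + a *: ('X^q * R') + a' *: ('X^q * R) + 'X^(q.+1) * R * R').
have E : 'X^q * 'X^q = 'X^(q.+1) * 'X^(q.-1) :> {poly K}.
  by rewrite -!exprD; congr (_ ^+ _); lia.
rewrite -!mul_polyC !rmorphD !rmorphM /= !mulrDl !mulrDr !mulr1 !mul1r.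
have -> : a%:P * 'X^q * (a'%:P * 'X^q) = a%:P * a'%:P * ('X^q * 'X^q) :> {poly K} by ring.
rewrite E; ring.
Qed.

Lemma first_order1 : first_order 0 1.
Proof. by exists 0; rewrite scale0r mulr0 !addr0. Qed.

Lemma first_order_exp a P k : first_order a P -> first_order (k%:R * a) (P ^+ k).
Proof.
move=> oP; elim: k => [|k IH]; first by rewrite mul0r expr0; apply: first_order1.
by rewrite exprS -nat1r mulrDl mul1r; apply: first_orderM.
Qed.

Lemma first_order_prod (I : finType) (a : I -> K) (P : I -> {poly K}) :
  (forall i, first_order (a i) (P i)) -> first_order (\sum_i a i) (\prod_i P i).
Proof.
move=> oP; elim/big_rec2: _ => [|i P' a' _ oP']; first exact: first_order1.
exact: first_orderM.
Qed.

Lemma first_order_coef a P k : first_order a P -> (k < q)%N ->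
  (P - 1)`_k.+1 = if k == q.-1 then a else 0.
Proof.
move=> [R ->] kq; rewrite coefB !coefD coef1 /= subr0 add0r coefZ coefXn coefXnM.
rewrite ltnS kq addr0; have -> : (k.+1 == q) = (k == q.-1) by lia.
by case: eqP; rewrite ?mulr1 ?mulr0.
Qed.

(** Along a relator the exponents of 1 + c j X add up to q times the multiplicity
    of j, and (1 + c j X)^q = 1 + (c j)^q X^q in characteristic p. *)
Lemma path_label (c : C) i y :
  first_order (\sum_j (exact_mult (i, y) j)%:~R * c j ^+ q)
    (\prod_(e <- edges st y (rel i)) label N c e).
Proof.
rewrite exchange_big /=; apply: first_order_prod => j.
rewrite prodrXr.
have [mu muE] : exists mu : nat, exact_mult (i, y) j = mu.
  have : 0 <= q%:Z * exact_mult (i, y) j.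
    rewrite -(sum_exact_label p_pr b_gt0); apply: sumr_ge0 => e _; apply: mulr_ge0 => //.
    rewrite /incidence /relsum; apply: sumr_ge0 => e' _.
    by case: eqP.
  rewrite pmulr_rge0 ?ltz_nat ?(ltnW q_gt1) //.
  by case: (exact_mult _ _) => // mu _; exists mu.
have -> : (\sum_(e <- edges st y (rel i)) (N e j : nat) = q * mu)%N.
  apply/eqP; rewrite -eqz_nat PoszM -muE -(sum_exact_label p_pr b_gt0).
  have := relsum_incidence rel st (fun e => (N e j : nat)%:Z) i y.
  rewrite /relsum -(big_morph Posz PoszD (erefl 0%:Z)) => ->.
  by apply/eqP; apply: eq_bigr => e _; rewrite mulrzz mulrC.
rewrite muE -pmulrn exprM; apply: first_order_exp.
exists 0; rewrite mulr0 addr0 -[q](erefl (p ^ b)%N).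
have pP : p \in [pchar {poly K}] by rewrite pchar_poly.
rewrite /q; move: (c j) => a; elim: b => [|b' IH]; first by rewrite expn0 !expr1.
rewrite expnSr !exprM IH -(pFrobenius_autE pP) rmorphD rmorph1 /=.
by rewrite pFrobenius_autE exprZn.
Qed.

(** The twisted sum of label - 1 telescopes to the product of the labels minus 1. *)
Lemma tw_quot c i y k : (k < q)%N ->
  (tw (label N c) (quot c) (edges st y (rel i)))`_k =
  if k == q.-1 then \sum_j (exact_mult (i, y) j)%:~R * c j ^+ q else 0.
Proof.
move=> kq; rewrite -(first_order_coef (path_label c i y) kq) -tw_subr1.
under [in RHS]eq_tw do rewrite -quotE.
by rewrite tw_mull coefXM.
Qed.

Section Fibre.
Context {T : finType} (x : J -> T -> K).
Local Notation pol := (pol x).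

Lemma pol_label e l : pol l (coefs (fun s => label N [ffun j => x j s] e) l).
Proof.
rewrite /label; elim: (index_enum _) l => [|j r IH] l.
  rewrite (_ : coefs _ _ = [ffun=> (l == 0%N)%:R]); first exact: pol_const.
  by apply/ffunP=> s; rewrite !ffunE big_nil coef1.
rewrite (_ : coefs _ _ = coefs (fun s => (1 + x j s *: 'X) ^+ (N e j : nat) *
   \prod_(j <- r) (1 + [ffun j => x j s] j *: 'X) ^+ (N e j : nat)) l); last first.
  by apply/ffunP=> s; rewrite [LHS]ffunE [RHS]ffunE big_cons (ffunE (x^~ s)). 
apply: pol_coefM => {}l _ //; elim: (N e j : nat) l => [|k IHk] l.
  rewrite (_ : coefs _ _ = [ffun=> (l == 0%N)%:R]); first exact: pol_const.
  by apply/ffunP=> s; rewrite !ffunE expr0 coef1.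
rewrite (_ : coefs _ _ = coefs (fun s => (1 + x j s *: 'X) * (1 + x j s *: 'X) ^+ k) l); last first.
  by apply/ffunP=> s; rewrite !ffunE exprS.
apply: pol_coefM => {}l _ //.
have -> : coefs (fun s => 1 + x j s *: 'X) l =
    [ffun=> (l == 0%N)%:R] + fmul (x j) [ffun=> (l == 1%N)%:R].
  by apply/ffunP=> s; rewrite !ffunE coefD coef1 coefZ coefX.
apply: pol_add; first exact: pol_const.
case: l => [|l]; last exact/pol_var/pol_const.
rewrite (_ : fmul _ _ = [ffun=> 0]); first exact: pol_const.
by apply/ffunP=> s; rewrite !ffunE mulr0.
Qed.

End Fibre.

End TwistedCount.

(** * Counting twisted cocycles *)

Section FibreBound.
Context {n m : nat} (rel : 'I_m -> seq 'I_n) {Y : finType} (st : 'I_n -> Y -> Y).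
Context (p b : nat) (p_pr : prime p) (b_gt0 : (0 < b)%N).
Let q := (p ^ b)%N.
Local Notation E := ('I_n * Y)%type.
Local Notation A := ('I_m * Y)%type.
Context (S : smith (incidence rel st)).
Local Notation d := (sm_d S).
Local Notation J := (exact_index p b S).
Context {K : finFieldType} (pK : p \in [pchar K]).
Local Notation C := {ffun J -> K}.
Local Notation F := {ffun E -> 'rV[K]_q}.
Local Notation N := (exact_label p b S).

Let q_gt1 : (1 < q)%N.
Proof. exact: prime_power_gt1. Qed.

Definition twisted_set : {set C * F} :=
  [set s | `[< twisted_cocycle rel st N s.1 s.2 >]].

(** By tw_quot, the twisted sum of quot s.1 along a relator is a combination of the
    q-th powers of the parameters in degree q - 1 and vanishes below, and that of a
    twisted cocycle vanishes altogether: the defect knows these q-th powers. *)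
Definition defect (s : C * F) (e : E) : {poly K} := quot s.1 e - rVpoly (s.2 e).

Definition defect_coord (s : C * F) i k : K := sm_coord S (fun e => (defect s e)`_k) i.

Definition torsion_part (s : C * F) : {ffun {i | i \in torsion S p} * 'I_q -> K} :=
  [ffun z : {i | i \in torsion S p} * 'I_q => defect_coord s (val z.1) z.2].

Lemma tw_defect s i y k : s \in twisted_set -> (k < q)%N ->
  (tw (label N s.1) (defect s) (edges st y (rel i)))`_k =
  if k == q.-1 then \sum_j (exact_mult (i, y) j)%:~R * s.1 j ^+ q else 0.
Proof.
rewrite inE => /asboolP ts kq.
rewrite twD twN coefB ts // subr0.
exact: (tw_quot p_pr b_gt0 pK).
Qed.

(** The twisted cocycles whose defect has prescribed coordinates at the divisors
    that vanish modulo p; they are determined by their parameters. *)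
Section Fibre.
Context (t : {ffun {i | i \in torsion S p} * 'I_q -> K}).
Definition fibre : {set C * F} := [set s in twisted_set | torsion_part s == t].
Local Notation T := {s | s \in fibre}.
Local Notation coord_fun := (fun (j : J) (s : T) => (val s).1 j).
Local Notation pol := (pol coord_fun).

Lemma fibre_twisted (s : T) : val s \in twisted_set.
Proof. by case: s => s /=; rewrite inE => /andP []. Qed.

Lemma fibre_torsion (s : T) i k (iE : i \in torsion S p) (kq : (k < q)%N) :
  defect_coord (val s) i k = t (exist _ i iE, Ordinal kq).
Proof.
by case: s => s /=; rewrite inE => /andP [_ /eqP <-]; rewrite ffunE.
Qed.

(** A row of the normal form, applied to the coefficient of X^k in the twisted sums
    of the defect. *)
Lemma fibre_row i k :
  (forall e l, (l < k)%N -> pol l (coefs (fun s : T => defect (val s) e) l)) ->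
  (k < q)%N ->
  exists2 P, pol k P & forall s : T, defect_coord (val s) i k *~ d i =
    \sum_c (if k == q.-1 then \sum_j (exact_mult c j)%:~R * (val s).1 j ^+ q
            else 0) *~ sm_L' S i c + P s.
Proof.
move=> low kq.
pose Pc c : {ffun T -> K^o} := [ffun s : T =>
  (tw (label N (val s).1) (defect (val s)) (edges st c.2 (rel c.1)))`_k -
  \sum_(e <- edges st c.2 (rel c.1)) (defect (val s) e)`_k].
have polPc c : pol k (Pc c).
  apply: (pol_tw (u := fun s : T => label N (val s).1) (g := fun s : T => defect (val s))).
  - by move=> e s; apply: label_coef0.
  - move=> e l; have := pol_label coord_fun e l.
    congr pol; apply/ffunP=> s; rewrite [LHS]ffunE [RHS]ffunE.
    by congr (label _ _ _)`_ _; apply/ffunP=> j; rewrite ffunE.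
  - exact: low.
exists (- \sum_c (sm_L' S i c)%:~R *: Pc c).
  by apply: polN; apply: pol_sum => c _; apply: polZ.
move=> s; rewrite -sm_row_relsum ffunE sum_ffunE -sumrB.
apply: eq_bigr => -[a y] _ /=; rewrite -(tw_defect _ _ (fibre_twisted s) kq).
by rewrite !ffunE /GRing.scale /= mulrzl -mulrzBl opprB addrC subrK.
Qed.

(** Below degree q - 1 no q-th power of a parameter occurs in the rows, and those
    with d i invertible modulo p give the other coordinates, degree by degree. *)
Lemma fibre_pol k e : (k < q.-1)%N -> pol k (coefs (fun s : T => defect (val s) e) k).
Proof.
elim/ltn_ind: k e => k IH e kq1; have kq : (k < q)%N by lia.
have -> : coefs (fun s : T => defect (val s) e) k =
    \sum_i (sm_R S e i)%:~R *: ([ffun s : T => defect_coord (val s) i k] : {ffun T -> K^o}).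
  apply/ffunP=> s; rewrite ffunE sum_ffunE.
  rewrite -(sm_coordK S (fun e => (defect (val s) e)`_k)); apply: eq_bigr => i _.
  by rewrite !ffunE /GRing.scale /= mulrzl.
apply: pol_sum => i _; apply: polZ.
have [iE|iE] := boolP (i \in torsion S p).
  rewrite (_ : finfun _ = [ffun=> t (exist _ i iE, Ordinal kq)]); first exact: pol_const.
  by apply/ffunP=> s; rewrite !ffunE (fibre_torsion s iE kq).
have [e' l lk|P pP PE] := fibre_row i _ kq; first by apply: IH => //; lia.
have di : (d i)%:~R != 0 :> K by rewrite -(dvdz_pcharf pK); rewrite inE in iE.
rewrite (_ : finfun _ = (d i)%:~R^-1 *: P); first exact: polZ.
apply/ffunP=> s; rewrite !ffunE /GRing.scale /=; apply: (mulfI di).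
rewrite mulVKf // mulrzl PE big1 ?add0r // => c _.
by rewrite ifF ?mul0rz //; lia.
Qed.

(** For equal parameters the difference of the two defects is a twisted cocycle
    whose coordinates at the divisors that vanish modulo p are 0; the other rows
    make it 0, degree by degree. *)
Lemma fibre_inj (s s' : T) : (forall j, (val s).1 j = (val s').1 j) -> s = s'.
Proof.
move=> ss; apply: val_inj; case: (val s) (fibre_twisted s) (fibre_torsion s) ss
  => c f tf Ef; case: (val s') (fibre_twisted s') (fibre_torsion s')
  => c' f' /= tf' Ef' cc'; have {cc'} cc : c' = c by apply/ffunP=> j; rewrite cc'.
move: tf' Ef'; rewrite {}cc => tf' Ef'; congr (_, _).
pose g e := rVpoly (f e) - rVpoly (f' e).
suff g0 k : (k < q)%N -> forall e, (g e)`_k = 0.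
  apply/ffunP=> e; apply/rowP=> k; apply/eqP; rewrite -subr_eq0.
  by rewrite -!(coef_rVpoly_ord) -coefB g0.
elim/ltn_ind: k => k IH kq e.
have row0 a y : relsum st (fun e => (g e)`_k) y (rel a) = 0.
  rewrite /relsum -(tw_lead (u := label N c)) => [|e'|e' l lk].
  - rewrite twD twN coefB; move: tf tf'; rewrite !inE => /asboolP /= tf /asboolP /= tf'.
    by rewrite tf // tf' // subrr.
  - exact: label_coef0.
  - by apply: IH => //; apply: ltn_trans kq.
rewrite -(sm_coordK S (fun e => (g e)`_k)) big1 // => i _.
suff -> : sm_coord S (fun e => (g e)`_k) i = 0 by rewrite mul0rz.
have [iE|iE] := boolP (i \in torsion S p).
  transitivity (defect_coord (c, f') i k - defect_coord (c, f) i k); last first.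
    by rewrite (Ef i k iE kq) (Ef' i k iE kq) subrr.
  rewrite /defect_coord /sm_coord -sumrB.
  apply: eq_bigr => e' _; rewrite -mulrzBl; congr (_ *~ _).
  by rewrite /g /defect /= !coefB; ring.
apply/eqP; have := sm_row_relsum S (fun e => (g e)`_k) i.
rewrite big1 => [/esym/eqP|a _]; last by rewrite row0 mul0rz.
by rewrite (mulrz_pchar _ _ pK); move: iE; rewrite inE => /negPf ->; rewrite orbF.
Qed.

(** In degree q - 1, the row of an exact index j has d j = 0 modulo p on the left,
    and on the right (d j / q) (c j)^q plus a polynomial of degree less than q in the
    parameters: on the fibre, (c j)^q is such a polynomial. *)
Lemma card_fibre : (#|fibre| <= q ^ #|{: J}|)%N.
Proof.
rewrite -[#|fibre|](card_sig (mem fibre)).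
apply: (card_low_degree (x := coord_fun)); first exact: ltnW.
- move=> j; have kq : (q.-1 < q)%N by lia.
  have [e l lk|P pP PE] := fibre_row (val j) _ kq; first exact: fibre_pol.
  have dj : (d (val j))%:~R = 0 :> K.
    by apply/eqP; rewrite -(dvdz_pcharf pK) (p_dvd b_gt0).
  have dq : (d (val j) %/ q)%Z%:~R != 0 :> K.
    by rewrite -(dvdz_pcharf pK) pN_dvd.
  rewrite (_ : finfun _ = - ((d (val j) %/ q)%Z%:~R^-1 *: P)); first exact/polN/polZ.
  apply/ffunP=> s; rewrite !ffunE /GRing.scale /=; apply: (mulfI dq).
  rewrite mulrN mulVKf //; apply/eqP; rewrite -addr_eq0; apply/eqP.
  have := PE s; rewrite -mulrzr dj mulr0 eqxx => ->; congr (_ + _).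
  under [in RHS]eq_bigr do rewrite mulrz_suml.
  rewrite exchange_big /=.
  have E i : \sum_c ((exact_mult c i)%:~R * (val s).1 i ^+ q) *~ sm_L' S (val j) c =
    (d (val j) %/ q)%Z%:~R * (j == i)%:R * (val s).1 i ^+ q.
    rewrite -(row_exact_mult p_pr b_gt0 pK) rmorph_sum mulr_suml.
    by apply: eq_bigr => c _; rewrite rmorphM /= -mulrzr mulrAC [X in X * _]mulrC.
  rewrite (bigD1 j) //= E eqxx mulr1 big1 ?addr0 // => i ij.
  by rewrite E eq_sym (negPf ij) mulr0 mul0r.
- exact: fibre_inj.
Qed.

End Fibre.

Lemma card_twisted_set :
  (#|twisted_set| <= q ^ #|{: J}| * #|K| ^ (q * #|torsion S p|))%N.
Proof.
rewrite -sum1_card (partition_big torsion_part predT) //=.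
apply: leq_trans (_ : \sum_(t : {ffun {i | i \in torsion S p} * 'I_q -> K}) q ^ #|{: J}| <= _)%N.
  apply: leq_sum => t _; apply: leq_trans (card_fibre t).
  by rewrite -sum1_card; apply/eq_leq/eq_bigl => s; rewrite !inE.
rewrite sum_nat_const card_ffun card_prod card_sig card_ord mulnC.
by rewrite (mulnC q).
Qed.

Lemma card_twisted_bent (c : C) (j1 : J) : c j1 != 0 ->
  (#|K| ^ \dim (bent rel st N c j1) <=
   #|[set f : F | (c, f) \in twisted_set]|)%N.
Proof.
move=> cj; rewrite -card_vspace -(card_in_imset (germ_inj pK b_gt0 cj)).
apply: subset_leq_card; apply/subsetP => _ /imsetP [G uG ->].
by rewrite !inE; apply/asboolP; apply: (germ_twisted pK b_gt0 cj uG).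
Qed.

Lemma card_ffun_neq0 (j1 : J) :
  #|[set c : C | c j1 != 0]| = (#|K|.-1 * #|K| ^ #|{: J}|.-1)%N.
Proof.
pose P (j : J) : {pred K} := if j == j1 then predC1 0 else predT.
have -> : #|[set c : C | c j1 != 0]| = #|(family P : {pred C})|.
  apply: eq_card => c; rewrite inE; apply/idP/familyP => [c1 j|cP].
    by rewrite /P; case: eqP => // ->.
  by have := cP j1; rewrite /P eqxx.
rewrite card_family foldrE big_map big_enum /= (bigD1 j1) //= {1}/P eqxx.
rewrite cardC1; congr (_ * _)%N.
rewrite (eq_bigr (fun=> #|K|)) => [|j /negPf jj1]; last by rewrite /P jj1.
by rewrite prod_nat_const -(cardC1 j1).
Qed.

(** Averaging card_twisted_set over the parameters c with c j1 <> 0 yields one with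
    few twisted cocycles, hence with few bent cocycles, and dim_bent applies. The
    field must be large for the average to lose less than one dimension. *)
Lemma covering_bound (j1 : J) : (q ^ #|{: J}| < #|K|.-1)%N ->
  (\dim (cocycles rel K (ext st N)) + #|{: J}| * q ^ #|{: J}|.-1 <=
   q ^ #|{: J}| * \dim (cocycles rel K st))%N.
Proof.
move=> bigK; rewrite (dim_cocycles S pK); set z := #|torsion S p|.
have K1 : (1 < #|K|)%N := finNzRing_gt1 K.
have Jpos : (0 < #|{: J}|)%N by apply/card_gt0P; exists j1.
have [c cj le] : exists2 c : C, c j1 != 0 &
    (#|{: J}| + \dim (bent rel st N c j1) <= q * z)%N.
  apply: contrapT => no.
  have big (c : C) : c j1 != 0 ->
      (#|K| ^ (q * z) <= #|K| ^ #|{: J}|.-1 * #|K| ^ \dim (bent rel st N c j1))%N.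
    move=> cj; rewrite -expnD leq_exp2l // leqNgt; apply/negP => lt.
    by apply: no; exists c => //; lia.
  suff : (#|K|.-1 * (#|K| ^ #|{: J}|.-1 * #|K| ^ (q * z)) <=
     q ^ #|{: J}| * (#|K| ^ #|{: J}|.-1 * #|K| ^ (q * z)))%N.
    by rewrite leq_pmul2r ?muln_gt0 ?expn_gt0 ?(ltnW K1) // leqNgt bigK.
  rewrite mulnA -(card_ffun_neq0 j1) mulnCA.
  apply: leq_trans (_ : _ <= #|K| ^ #|{: J}|.-1 * #|twisted_set|)%N _; last first.
    by rewrite leq_mul2l card_twisted_set orbT.
  rewrite -[#|twisted_set|]sum1_card (partition_big fst predT) //= big_distrr /=.
  rewrite -sum_nat_const [leqRHS](bigID (fun c : C => c j1 != 0)) /=.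
  apply: leq_trans (leq_addr _ _).
  rewrite big_mkcond [leqRHS]big_mkcond /=; apply: leq_sum => c _.
  rewrite inE; case: ifP => // cj; apply: leq_trans (big c cj) _.
  rewrite leq_mul2l; apply/orP; right.
  apply: leq_trans (card_twisted_bent cj) _.
  rewrite -(card_imset (f := fun f : F => (c, f))) => [|f f' [] //].
  rewrite sum1_card; apply: subset_leq_card; apply/subsetP => _ /imsetP [f + ->].
  by rewrite inE => fT; apply/andP; split=> /=.
have := dim_bent rel st pK b_gt0 N c j1; rewrite -/q => le'.
apply: leq_trans (leq_add le' (leqnn _)) _.
rewrite [(#|_| * _)%N]mulnC -mulnDr [X in (_ * X <= _)%N]addnC.
have -> : (q ^ #|{: J}| = q ^ #|{: J}|.-1 * q)%N by rewrite -expnSr prednK.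
by rewrite -mulnA leq_mul2l le orbT.
Qed.

End FibreBound.

(** * Finite sets with an action of p-power order *)

Section PSets.
Context {n m : nat} (rel : 'I_m -> seq 'I_n) (p : nat).

Definition p_action {Y : Type} (st : 'I_n -> Y -> Y) :=
  is_action rel st /\
  forall w, exists k, forall y, iter (p ^ k) (fun z => run st z w) y = y.

Definition repw k (w : seq 'I_n) : seq 'I_n := flatten (nseq k w).

Lemma run_repw Y (st : 'I_n -> Y -> Y) k w y :
  run st y (repw k w) = iter k (fun z => run st z w) y.
Proof.
by elim: k y => //= k IH y; rewrite /repw /= run_cat -[flatten _]/(repw k w) IH -iterSr.
Qed.

Lemma p_action_ext (Y : Type) (st : 'I_n -> Y -> Y) (A : zmodType)
    (N : 'I_n * Y -> A) k :
  p_action st -> cocycle rel st N -> (forall a : A, a *+ p ^ k = 0) ->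
  p_action (ext st N).
Proof.
move=> [ast pst] cN Ak; split; first exact: ext_action.
move=> w; have [l wl] := pst w; exists (l + k)%N => -[y a].
rewrite expnD; set P := (p ^ l)%N.
have it j y' a' : iter (j * P) (fun z => run (ext st N) z w) (y', a') =
    (y', a' + relsum st N y' (repw P w) *+ j).
  elim: j a' => [|j IH] a'; first by rewrite mulr0n addr0.
  rewrite mulSn addnC iterD -(run_repw _ P) run_ext /= run_repw -/P wl IH.
  by rewrite -addrA mulrS.
by rewrite mulnC it Ak addr0.
Qed.

Lemma reach_sym (Y : Type) (st : 'I_n -> Y -> Y) w y : (0 < p)%N ->
  p_action st -> exists w', run st (run st y w) w' = y.
Proof.
move=> p0 [_ /(_ w) [k wk]]; exists (repw (p ^ k).-1 w).
by rewrite run_repw -iterSr prednK ?wk // expn_gt0 p0.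
Qed.

(** A function on the edges that sums to 0 along every loop is the coboundary
    of its sums along paths from base points. *)
Lemma loops_coboundary (Y : finType) (st : 'I_n -> Y -> Y) (V : zmodType)
    (f : 'I_n * Y -> V) : (0 < p)%N -> p_action st ->
  (forall y w, run st y w = y -> relsum st f y w = 0) ->
  exists psi : Y -> V, forall x y, f (x, y) = psi (st x y) - psi y.
Proof.
move=> p0 pst loop.
pose R y : pred Y := fun z => `[< exists w, run st z w = y >].
have Ry y : R y y by apply/asboolP; exists [::].
pose base y := choose (R y) y.
have baseP y : exists w, run st (base y) w = y.
  by apply/asboolP; exact: (chooseP (Ry y)).
have base_st x y : base (st x y) = base y.
  have Rst : R (st x y) =1 R y.
    move=> z; apply/asboolP/asboolP => -[w zw]; last first.
      by exists (w ++ [:: x]); rewrite run_cat zw.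
    have [w' yw'] := reach_sym [:: x] y p0 pst.
    by exists (w ++ w'); rewrite run_cat zw.
  rewrite /base (eq_choose Rst); apply: choose_id => //.
  by rewrite -Rst.
have [wd wdP] := choice baseP.
exists (fun y => relsum st f (base y) (wd y)) => x y.
apply/esym/eqP; rewrite subr_eq addrC; apply/eqP.
rewrite base_st.
have E : relsum st f (base y) (wd y) + f (x, y) = relsum st f (base y) (wd y ++ [:: x]).
  by rewrite relsum_cat wdP relsum_cons relsum_nil addr0.
rewrite E; have [w' w'P] := reach_sym (wd y ++ [:: x]) (base y) p0 pst.
have Ex : run st (base y) (wd y ++ [:: x]) = st x y by rewrite run_cat wdP.
rewrite Ex in w'P.
have l1 : relsum st f (base y) ((wd y ++ [:: x]) ++ w') = 0.
  by apply: loop; rewrite run_cat Ex.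
have l2 : relsum st f (base y) (wd (st x y) ++ w') = 0.
  by apply: loop; rewrite run_cat -{1}(base_st x y) wdP.
have e2 : run st (base y) (wd (st x y)) = st x y by rewrite -(base_st x y) wdP.
apply: (addIr (relsum st f (st x y) w')).
move: l1 l2; rewrite relsum_cat Ex => -> ; rewrite relsum_cat e2 => ->.
by [].
Qed.

Lemma p_action_point : p_action (fun (_ : 'I_n) (u : unit) => u).
Proof.
by split=> [i u|w]; [case: u (run _ _ _) => -[] | exists 0%N => u; case: u (iter _ _ _) => -[]].
Qed.

Context (p_pr : prime p).

Definition rank {Y : finType} (st : 'I_n -> Y -> Y) := \dim (cocycles rel 'F_p st).

Definition rank_bound k D := forall (Y : finType) (st : 'I_n -> Y -> Y),
  p_action st -> (k * #|Y| <= D * rank st)%N.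

(** The dimension over any field of characteristic p is the number of elementary
    divisors that vanish modulo p. *)
Lemma rankE (Y : finType) (st : 'I_n -> Y -> Y) (K : finFieldType) :
  p \in [pchar K] -> \dim (cocycles rel K st) = rank st.
Proof.
move=> pK; have [S] := smith_exists (incidence rel st).
by rewrite /rank (dim_cocycles S pK) (dim_cocycles S (pchar_Fp p_pr)).
Qed.

(** For the largest k such that rank_bound k D, some set violates rank_bound k.+1 D. *)
Lemma almost_minimal D :
  exists k (Y : finType) (st : 'I_n -> Y -> Y),
    [/\ p_action st, rank_bound k D & (D * rank st < k.+1 * #|Y|)%N].
Proof.
pose P k := `[< rank_bound k D >].
have P0 : exists k, P k by exists 0%N; apply/asboolP.
have Pb k : P k -> (k <= D * rank (fun (_ : 'I_n) (u : unit) => u))%N.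
  by move=> /asboolP /(_ _ _ p_action_point); rewrite card_unit muln1.
case: (ex_maxnP P0 Pb) => k /asboolP Pk maxk; exists k.
apply: contrapT => no; have : P k.+1.
  apply/asboolP => Y st pst; rewrite leqNgt; apply/negP => lt.
  by apply: no; exists Y, st.
by move=> /maxk; rewrite ltnn.
Qed.

(** Otherwise the covering of covering_bound would have a smaller ratio. *)
Lemma few_exact_torsion D k b (Y : finType) (st : 'I_n -> Y -> Y)
    (S : smith (incidence rel st)) : (0 < b)%N -> p_action st ->
  rank_bound k D -> (D * rank st < k.+1 * #|Y|)%N ->
  (D * #|exact_torsion p b S| < p ^ b * #|Y|)%N.
Proof.
move=> b0 pst kmin Yk.
have Y0 : (0 < #|Y|)%N by move: Yk; case: #|Y| => //; rewrite muln0.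
have q0 : (0 < p ^ b)%N by rewrite expn_gt0 prime_gt0.
have q1 : (1 < p ^ b)%N := prime_power_gt1 p_pr b0.
pose J := exact_index p b S.
have cJ : #|exact_torsion p b S| = #|{: J}| by rewrite card_sig.
rewrite cJ; have [J0|Jpos] := posnP #|{: J}|; first by rewrite J0 muln0 muln_gt0 q0.
have [j1 _] := card_gt0P Jpos.
pose r := ((p ^ b) ^ #|{: J}|).+2.
have r0 : (0 < r)%N by [].
have [K pK cK] := pPrimePowerField p_pr r0.
have bigK : ((p ^ b) ^ #|{: J}| < #|K|.-1)%N.
  have : (r < p ^ r)%N by apply: ltn_expl; apply: prime_gt1.
  by rewrite -cK /r; lia.
have := covering_bound p_pr b0 pK j1 bigK.
pose N := exact_label p b S.
have pN : p_action (ext st N).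
  apply: (p_action_ext (k := b)) => //; first exact: exact_label_cocycle.
  by move=> a; apply/ffunP=> j; rewrite ffunMnE ffunE -mulr_natr pchar_Zp // mulr0.
rewrite !(rankE _ pK) => le.
have := kmin _ _ pN.
rewrite [X in (k * X <= _)%N](_ : _ = #|Y| * (p ^ b) ^ #|{: J}|)%N; last first.
  by rewrite card_prod card_ffun card_ord Zp_cast.
move=> le2; move: {cJ bigK r r0 K pK cK} #|{: J}| Jpos le le2 => c Jpos le le2.
have qc : ((p ^ b) ^ c = (p ^ b) ^ c.-1 * p ^ b)%N by rewrite -expnSr prednK.
have Q0 : (0 < (p ^ b) ^ c.-1)%N by rewrite expn_gt0 q0.
move: Yk Q0 q0 le le2; rewrite qc; move: (rank (ext st N)) (rank st) => z' z.
move: ((p ^ b) ^ c.-1)%N => Q; move: (p ^ b)%N #|Y| => q y Yk Q0 q0 le le2.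
rewrite -(ltn_pmul2l Q0).
have le' : (D * (z' + c * Q) <= D * (Q * q * z))%N by rewrite leq_mul2l le orbT.
have lt : (Q * q * (D * z) < Q * q * (k.+1 * y))%N by rewrite ltn_pmul2l ?muln_gt0 ?Q0.
move: le' lt le2; rewrite mulnDr mulSn mulnDr.
have -> : (D * (c * Q) = Q * (D * c))%N by ring.
have -> : (D * (Q * q * z) = Q * q * (D * z))%N by ring.
have -> : (k * (y * (Q * q)) = Q * q * (k * y))%N by ring.
have -> : (Q * (q * y) = Q * q * y)%N by ring.
lia.
Qed.

End PSets.

(** * An integral cocycle that is nontrivial modulo p *)

Section RelsumAlgebra.
Context {n : nat} {Y : Type} (st : 'I_n -> Y -> Y) {V : zmodType}.
Implicit Types f g : 'I_n * Y -> V.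

Lemma relsumD f g y w :
  relsum st (fun e => f e + g e) y w = relsum st f y w + relsum st g y w.
Proof. exact: big_split. Qed.

Lemma relsumB f g y w :
  relsum st (fun e => f e - g e) y w = relsum st f y w - relsum st g y w.
Proof. exact: sumrB. Qed.

Definition coboundary (psi : Y -> V) (e : 'I_n * Y) : V :=
  psi (st e.1 e.2) - psi e.2.

Lemma relsum_coboundary psi y w :
  relsum st (coboundary psi) y w = psi (run st y w) - psi y.
Proof.
elim: w y => [|x w IH] y; first by rewrite relsum_nil subrr.
by rewrite relsum_cons IH /coboundary /= addrC addrA subrK.
Qed.

End RelsumAlgebra.

Lemma relsum_intr n Y (st : 'I_n -> Y -> Y) (V : pzRingType) f y w :
  relsum st (fun e => (f e)%:~R : V) y w = (relsum st f y w)%:~R.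
Proof. by rewrite /relsum rmorph_sum. Qed.

Section Siegel.
Context {n m : nat} (rel : 'I_m -> seq 'I_n) (p : nat) (p_pr : prime p).

Section OneSet.
Context {Y : finType} (st : 'I_n -> Y -> Y) (pst : p_action rel p st).
Local Notation E := ('I_n * Y)%type.
Hypothesis loops : forall f : E -> int, cocycle rel st f ->
  forall y w, run st y w = y -> (p%:Z %| relsum st f y w)%Z.

(** Dividing by p the difference of a cocycle and a coboundary congruent to it
    leaves a cocycle, to which the hypothesis on loops applies again. *)
Lemma coboundary_modn a (f : E -> int) : cocycle rel st f ->
  exists psi : Y -> int, forall e, ((p ^ a)%N%:Z %| f e - coboundary st psi e)%Z.
Proof.
elim: a f => [|a IH] f cf; first by exists (fun=> 0) => e; rewrite dvd1z.
have [y w yw|psi psiP] :=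
    loops_coboundary (f := fun e => (f e)%:~R : 'F_p) (prime_gt0 p_pr) pst.
  by rewrite relsum_intr; apply/eqP; rewrite -(dvdz_pcharf (pchar_Fp p_pr)) loops.
pose psi1 y := (psi y : nat)%:Z.
have div e : (p%:Z %| f e - coboundary st psi1 e)%Z.
  rewrite (dvdz_pcharf (pchar_Fp p_pr)) rmorphB rmorphB /=.
  have lift y : (psi1 y)%:~R = psi y by exact: natr_Zp.
  by rewrite !lift; case: e => x y /=; rewrite psiP subrr.
have p0 : p%:Z != 0 by rewrite -lt0n prime_gt0.
pose f' e := ((f e - coboundary st psi1 e) %/ p)%Z.
have f'E e : f' e * p%:Z = f e - coboundary st psi1 e by rewrite /f' divzK.
have [i y|psi' psi'P] := IH f'.
  apply: (mulIf p0); rewrite mul0r mulr_suml.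
  under eq_bigr do rewrite f'E.
  rewrite -/(relsum st (fun e => f e - coboundary st psi1 e) y (rel i)).
  by rewrite relsumB cf relsum_coboundary (pst.1 i y) !subrr.
exists (fun y => psi1 y + psi' y * p%:Z) => e.
have -> : f e - coboundary st (fun y => psi1 y + psi' y * p%:Z) e =
   (f' e - coboundary st psi' e) * p%:Z.
  by rewrite mulrBl f'E /coboundary; ring.
by rewrite expnSr PoszM dvdz_mul.
Qed.

Context (a L : nat) (a_gt0 : (0 < a)%N).
Hypothesis relL : forall i, (size (rel i) <= L)%N.
Let q := (p ^ a)%N.

Let q_gt1 : (1 < q)%N.
Proof. exact: prime_power_gt1. Qed.

Lemma box_proof (v : 'Z_q) : ((v : nat) * L.+1 %/ q < L.+1)%N.
Proof.
rewrite ltn_divLR ?(ltnW q_gt1) // mulnC ltn_pmul2l //.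
by have := ltn_ord v; rewrite [X in (_ < X)%N]Zp_cast.
Qed.

(** The values modulo q are sorted into L + 1 intervals: along a relator two
    cocycles in the same box have sums, divisible by q, that differ by less than q. *)
Definition box (f : {ffun E -> 'Z_q}) : {ffun E -> 'I_L.+1} :=
  [ffun e => Ordinal (box_proof (f e))].

Lemma box_le (f g : {ffun E -> 'Z_q}) i y : f \in cocycle_set rel st _ ->
  g \in cocycle_set rel st _ -> box f = box g ->
  (relsum st (fun e => (f e : nat)) y (rel i) <=
   relsum st (fun e => (g e : nat)) y (rel i))%N.
Proof.
move=> /cocycle_setP cf /cocycle_setP cg fg.
have q0 : (0 < q)%N := ltnW q_gt1.
have div h : cocycle rel st h ->
    (q %| relsum st (fun e => (h e : 'Z_q) : nat) y (rel i))%N.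
  move=> ch; rewrite /dvdn -(val_Zp_nat q_gt1); apply/eqP.
  rewrite (_ : _%:R = 0 :> 'Z_q) //; rewrite -[RHS](ch i y) natr_sum.
  by apply: eq_bigr => e _; rewrite natr_Zp.
rewrite leqNgt; apply/negP => lt.
set Fg := (X in (X < _)%N) in lt; set Ff := (X in (_ < X)%N) in lt.
have [kf kfE] := dvdnP (div f cf); have [kg kgE] := dvdnP (div g cg).
have step : (Fg + q <= Ff)%N.
  rewrite /Ff kfE /Fg kgE -mulSnr leq_mul2r; apply/orP; right.
  by move: lt; rewrite /Ff kfE /Fg kgE ltn_pmul2r.
pose bx e := (box f e : nat).
have up : (Ff * L.+1 <= relsum st bx y (rel i) * q + q.-1 * size (rel i))%N.
  rewrite /Ff /relsum !big_distrl /= -(size_edges st y (rel i)).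
  elim: (edges _ _ _) => [|e s IH]; first by rewrite !big_nil.
  rewrite !big_cons /= (mulnS q.-1) addnACA; apply: leq_add => //.
  rewrite /bx ffunE /= {1}(divn_eq (f e * L.+1) q) leq_add2l.
  by rewrite -ltnS prednK // ltn_mod.
have low : (relsum st bx y (rel i) * q <= Fg * L.+1)%N.
  rewrite /Fg /relsum !big_distrl /=; apply: leq_sum => e _.
  by rewrite /bx fg ffunE /= leq_trunc_div.
have le1 : ((Fg + q) * L.+1 <= Ff * L.+1)%N by rewrite leq_mul2r step orbT.
have le2 : (q.-1 * size (rel i) < q * L.+1)%N.
  apply: leq_ltn_trans (leq_mul (leq_pred q) (relL i)) _.
  by rewrite ltn_pmul2l.
rewrite mulnDl in le1.
have := leq_trans le1 up; rewrite leqNgt => /negP; apply.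
by apply: leq_ltn_trans (leq_add low (leqnn _)) _; rewrite ltn_add2l.
Qed.

(** By box_le two cocycles modulo q in the same box differ by the reduction of an
    integral cocycle, hence by a coboundary modulo q. *)
Lemma siegel_count :
  (#|cocycle_set rel st 'Z_q| <= L.+1 ^ (n * #|Y|) * q ^ #|Y|)%N.
Proof.
pose r (t : {ffun E -> 'I_L.+1}) : {ffun E -> 'Z_q} :=
  odflt 0 [pick f in cocycle_set rel st 'Z_q | box f == t].
pose F (z : {ffun E -> 'I_L.+1} * {ffun Y -> 'Z_q}) : {ffun E -> 'Z_q} :=
  [ffun e => r z.1 e + coboundary st z.2 e].
have -> : (L.+1 ^ (n * #|Y|) * q ^ #|Y| =
     #|[set: {ffun E -> 'I_L.+1} * {ffun Y -> 'Z_q}]|)%N.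
  by rewrite cardsT card_prod !card_ffun !card_ord card_prod card_ord Zp_cast.
apply: leq_trans (leq_imset_card F _); apply: subset_leq_card; apply/subsetP => f cf.
have [g [cg gf rg]] : exists g, [/\ g \in cocycle_set rel st 'Z_q, box g = box f & r (box f) = g].
  rewrite /r; case: pickP => [g /andP [cg /eqP gf]|/(_ f)]; first by exists g.
  by rewrite cf eqxx.
pose k e := (f e : nat)%:Z - (g e : nat)%:Z.
have ck : cocycle rel st k.
  move=> i y; rewrite relsumB; apply/eqP; rewrite subr_eq0; apply/eqP.
  rewrite /relsum -!(big_morph Posz PoszD (erefl 0%:Z)); congr Posz.
  by apply/eqP; rewrite eqn_leq; apply/andP; split; apply: box_le.
have [psi psiP] := coboundary_modn a ck.
apply/imsetP; exists (box f, [ffun y => (psi y)%:~R]); rewrite ?inE //.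
apply/ffunP=> e; rewrite ffunE /= rg /coboundary !ffunE.
apply/eqP; rewrite -subr_eq0 opprD addrA subr_eq0.
have [c cE] := dvdzP (psiP e).
have := congr1 (fun z : int => z%:~R : 'Z_q) cE.
rewrite rmorphM !rmorphB /= -/q (_ : q%:Z%:~R = 0 :> 'Z_q) ?mulr0; last first.
  exact: (pchar_Zp q_gt1).
have lift (v : 'Z_q) : (v : nat)%:Z%:~R = v by exact: natr_Zp.
by rewrite !lift => /eqP; rewrite subr_eq0.
Qed.

End OneSet.

Lemma torsion_step (Y : finType) (st : 'I_n -> Y -> Y) (S : smith (incidence rel st)) b :
  #|torsion S (p ^ b)| = (#|torsion S (p ^ b.+1)| + #|exact_torsion p b S|)%N.
Proof.
rewrite /exact_torsion -expnSr -(cardsID (torsion S (p ^ b.+1)) (torsion S (p ^ b))).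
congr (_ + _)%N; apply: eq_card => i; rewrite !inE andbC andb_idr // => h.
by apply: dvdz_trans h; rewrite expnS; apply: dvdn_mull.
Qed.

(** The bounds on the exact torsion for b < a form a geometric series. *)
Lemma many_torsion l a (Y : finType) (st : 'I_n -> Y -> Y)
    (S : smith (incidence rel st)) : (0 < a)%N ->
  (l.+1 * #|Y| <= l * #|torsion S p|)%N ->
  (forall b, (0 < b)%N -> (2 * l * p ^ a * #|exact_torsion p b S| < p ^ b * #|Y|)%N) ->
  ((2 * l).+1 * #|Y| <= 2 * l * #|torsion S (p ^ a)|)%N.
Proof.
move=> a0 growth few.
have p1 := prime_gt1 p_pr.
have pa0 : (0 < p ^ a)%N by rewrite expn_gt0 prime_gt0.
have step b : (0 < b)%N -> (2 * l * p ^ a * #|torsion S p| <=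
    2 * l * p ^ a * #|torsion S (p ^ b)| + p ^ b * #|Y|)%N.
  case: b => // b _; elim: b => [|b IH]; first by rewrite expn1 leq_addr.
  apply: leq_trans IH _; rewrite torsion_step mulnDr -addnA leq_add2l.
  have := few b.+1 isT; rewrite (expnS p b.+1) => f.
  apply: leq_trans (leq_add (ltnW f) (leqnn _)) _.
  by rewrite addnn -mul2n -mulnA leq_mul2r p1 orbT.
have := step a a0; rewrite -!mulnA ![(l * (_ * _))%N]mulnCA ![(2 * (p ^ a * _))%N]mulnCA.
rewrite -mulnDr leq_pmul2l //; lia.
Qed.

(** On an almost minimal set most elementary divisors that vanish modulo p vanish
    modulo p ^ a; there are then too many cocycles modulo p ^ a for siegel_count
    as soon as p ^ a exceeds (L + 1) ^ (2 l n). *)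
Lemma nontrivial_integral_cocycle l : rank_bound rel p l.+1 l ->
  exists (Y : finType) (st : 'I_n -> Y -> Y) (f : 'I_n * Y -> int) y w,
    [/\ p_action rel p st, cocycle rel st f, run st y w = y
      & ~~ (p%:Z %| relsum st f y w)%Z].
Proof.
move=> growth.
pose L := \max_i size (rel i); pose a := (L.+1 ^ (2 * l * n))%N.
have a0 : (0 < a)%N by rewrite expn_gt0.
have aB : (L.+1 ^ (2 * l * n) < p ^ a)%N by apply: ltn_expl; apply: prime_gt1.
have [k [Y [st [pst kmin Yk]]]] := almost_minimal rel p (2 * l * p ^ a).
have [S] := smith_exists (incidence rel st).
have Y0 : (0 < #|Y|)%N by move: Yk; case: #|Y| => //; rewrite muln0.
apply: contrapT => no.
have loops f : cocycle rel st f -> forall y w, run st y w = y ->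
    (p%:Z %| relsum st f y w)%Z.
  move=> cf y w yw; apply/negP => nd; apply: no.
  by exists Y, st, f, y, w; split=> //; apply/negP.
have relL i : (size (rel i) <= L)%N by apply: leq_bigmax.
have upper := siegel_count pst loops a0 relL.
have lower : (#|'Z_(p ^ a)| ^ #|torsion S (p ^ a)| <= #|cocycle_set rel st 'Z_(p ^ a)|)%N.
  apply: (card_cocycles_ge (S := S)) => i; rewrite inE => /dvdzP [c ->] v.
  rewrite mulrC mulrzA -pmulrn -mulr_natr pchar_Zp ?mulr0 ?mul0rz //.
  by apply: leq_ltn_trans aB; rewrite expn_gt0.
have q1 : (1 < p ^ a)%N by apply: leq_ltn_trans aB; rewrite expn_gt0.
have le := leq_trans lower upper; rewrite card_ord Zp_cast // in le.
have := many_torsion (l := l) (S := S) a0.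
rewrite -(dim_cocycles S (pchar_Fp p_pr)) => /(_ (growth _ _ pst)) => big.
have {}big := big (fun b b0 => few_exact_torsion p_pr S b0 pst kmin Yk).
move: q1 le big aB => {lower upper}; move: Y0; move: #|torsion _ _| #|Y| => s y.
move: (p ^ a)%N => q y0 q1 le big aB.
have le2 : (q ^ ((2 * l).+1 * y) <= (L.+1 ^ (n * y) * q ^ y) ^ (2 * l))%N.
  apply: leq_trans (leq_pexp2l _ big) _; first exact: ltnW.
  by rewrite mulnC expnM; case: (2 * l)%N => // c; rewrite leq_exp2r.
move: le2; rewrite expnMn mulSn expnD -!(expnM q) [(y * (2 * l))%N]mulnC.
rewrite leq_pmul2r ?expn_gt0 ?(ltnW q1) // leqNgt => /negP; apply.
rewrite -expnM (_ : n * y * (2 * l) = 2 * l * n * y)%N; last by ring.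
by rewrite expnM ltn_exp2r.
Qed.

End Siegel.

(** * Finite p-groups as quotients *)

Section Quotients.
Context {n m : nat} (rel : 'I_m -> seq 'I_n) (p : nat) (p_pr : prime p).

Definition wprod {gT : finGroupType} (b : 'I_n -> gT) (w : seq 'I_n) : gT :=
  (\prod_(x <- w) b x)%g.

Lemma wprod_cat (gT : finGroupType) (b : 'I_n -> gT) w w' :
  wprod b (w ++ w') = (wprod b w * wprod b w')%g.
Proof. exact: big_cat. Qed.

Definition p_quotient {gT : finGroupType} (b : 'I_n -> gT) :=
  [/\ (p.-group [set: gT])%g, forall v, exists w, wprod b w = v
    & forall i, wprod b (rel i) = 1%g].

Definition reg {gT : finGroupType} (b : 'I_n -> gT) (x : 'I_n) (v : gT) : gT :=
  (v * b x)%g.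

Lemma run_reg (gT : finGroupType) (b : 'I_n -> gT) v w :
  run (reg b) v w = (v * wprod b w)%g.
Proof.
rewrite /wprod; elim: w v => [|x w IH] v /=; first by rewrite big_nil mulg1.
by rewrite IH big_cons mulgA.
Qed.

Lemma p_action_reg (gT : finGroupType) (b : 'I_n -> gT) :
  p_quotient b -> p_action rel p (reg b).
Proof.
move=> [pG _ relb]; split=> [i v|w]; first by rewrite run_reg relb mulg1.
have [k cG] := p_natP pG; exists k => v.
have it j : iter j (fun z => run (reg b) z w) v = (v * wprod b w ^+ j)%g.
  elim: j => [|j IH]; first by rewrite expg0 mulg1.
  by rewrite iterS IH run_reg expgSr mulgA.
by rewrite it -cG expg_cardG ?inE // mulg1.
Qed.

Lemma p_action_inj (Y : Type) (st : 'I_n -> Y -> Y) x :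
  p_action rel p st -> injective (st x).
Proof.
move=> [_ /(_ [:: x]) [k xk]] y z yz; rewrite -(xk y) -(xk z) /=.
have : (0 < p ^ k)%N by rewrite expn_gt0 prime_gt0.
by case: (p ^ k)%N => // N _; rewrite !iterSr /= yz.
Qed.

(** The group of permutations of Y generated by the letters; a prime dividing its
    order is p by Cauchy, because its elements act with p-power order. *)
Lemma reg_cover (Y : finType) (st : 'I_n -> Y -> Y) : p_action rel p st ->
  exists (gT : finGroupType) (b : 'I_n -> gT) (act : Y -> gT -> Y),
    [/\ p_quotient b, forall y w, act y (wprod b w) = run st y w
      & forall g h, (forall y, act y g = act y h) -> g = h].
Proof.
move=> pst; pose s x := perm (p_action_inj (x := x) pst).
pose G := <<[set s x | x in 'I_n]>>%G.
have sG x : s x \in G by rewrite mem_gen // imset_f.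
pose b x := subg G (s x); pose act y (g : subg_of G) := sgval g y.
have vb w : sgval (wprod b w) = (\prod_(x <- w) s x)%g.
  elim: w => [|x w IH]; rewrite /wprod ?big_nil // !big_cons.
  by rewrite [sgval _]/= -IH subgK.
have act_w y w : act y (wprod b w) = run st y w.
  rewrite /act vb; elim: w y => [|x w IH] y; first by rewrite big_nil perm1.
  by rewrite big_cons permM permE IH.
have faith g h : (forall y, act y g = act y h) -> g = h.
  by move=> gh; apply: val_inj; apply/permP => y; exact: gh.
have act1 y : act y 1%g = y by rewrite /act perm1.
have gen v : exists w, wprod b w = v.
  have [k [c cP vE]] := gen_prodgP (subgP v).
  have [x xP] : exists x : 'I_k -> 'I_n, forall i, c i = s (x i).
    have ex i : exists x, c i = s x.
      by have /imsetP [x _ ->] := cP i; exists x.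
    by have [x xP] := choice ex; exists x.
  exists [seq x i | i <- index_enum 'I_k]; apply: val_inj.
  by rewrite [LHS]vb [RHS]vE big_map; apply: eq_bigr => i _; rewrite xP.
exists (subg_of G), b, act; split=> //; split=> //; last first.
  by move=> i; apply: faith => y; rewrite act_w pst.1 act1.
apply/pgroupP => r r_pr /(Cauchy r_pr) [v _ vr].
have [w wv] := gen v; have [k wk] := pst.2 w.
have : (v ^+ (p ^ k) == 1)%g.
  apply/eqP/faith => y.
  have it j : act y (v ^+ j)%g = iter j (fun z => run st z w) y.
    elim: j => [|j IH]; first by rewrite expg0 /act /= perm1.
    by rewrite expgSr iterS -IH -act_w wv /act /= permM.
  by rewrite it wk act1.
rewrite -order_dvdn vr Euclid_dvdX // => /andP [rp _].
by rewrite inE -(dvdn_prime2 r_pr p_pr).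
Qed.

End Quotients.

Section PGroups.
Import GroupScope.

(** The quotient by a central subgroup of order p. *)
Lemma p_group_quotient (p : nat) (gT : finGroupType) : prime p ->
  (p.-group [set: gT])%g -> [set: gT] != 1%g ->
  exists (gT' : finGroupType) (h : gT -> gT'), [/\ {morph h : x y / (x * y)%g},
    (p.-group [set: gT'])%g, (#|gT'| < #|gT|)%N
    & forall x, h x = 1%g -> (x ^+ p = 1)%g /\ forall y, commute x y].
Proof.
move=> p_pr pG ntG.
have ntZ : 'Z([set: gT])%g != 1%g.
  by apply: contra ntG => /eqP /(trivg_center_pgroup pG) ->.
have [_ pZ _] := pgroup_pdiv (pgroupS (center_sub _) pG) ntZ.
have [z zZ oz] := Cauchy p_pr pZ.
have comm x : x \in <[z]>%g -> forall y, commute x y.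
  move=> xz y; have /centerP [_ /(_ y)] : x \in 'Z([set: gT])%g.
    by apply: subsetP x xz; rewrite cycle_subG.
  by rewrite inE => /(_ isT).
have nH x : x \in 'N(<[z]>)%g.
  by apply: (subsetP (cent_sub _)); apply/centP => y yz; apply/commute_sym/comm.
have GH : [set: coset_of (<[z]>)] = ([set: gT] / <[z]>)%g.
  by apply/setP => c; rewrite inE; have [x xN ->] := cosetP c; rewrite mem_quotient ?inE.
exists (coset_of <[z]>), (coset <[z]>); split.
- by move=> x y; rewrite morphM.
- by rewrite GH quotient_pgroup.
- rewrite -!cardsT GH ltn_quotient ?subsetT // cycle_eq1.
  by apply/eqP => z1; move: p_pr; rewrite -oz z1 order1.
move=> x x1; have xz : x \in <[z]>%g by apply: coset_idr.
by split; [rewrite -oz; apply: expg_cardG | apply: comm].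
Qed.

End PGroups.

(** * Independent cocycles with separated supports *)

Lemma edges_prefix n (Y : eqType) (st : 'I_n -> Y -> Y) y w e :
  e \in edges st y w -> exists w1 w2, w = w1 ++ w2 /\ e.2 = run st y w1.
Proof.
elim: w y => [//|x w IH] y; rewrite inE => /orP [/eqP -> | /IH [w1 [w2 [-> ->]]]].
  by exists [::], (x :: w).
by exists (x :: w1), w2.
Qed.

Lemma dimvD_le {K : fieldType} {V : vectType K} (U W : {vspace V}) :
  (\dim (U + W) <= \dim U + \dim W)%N.
Proof. by rewrite -dimv_sum_cap leq_addr. Qed.

(** One vector at a time: were all the A c not yet used contained in the span of B
    and the vectors already chosen, the used ones would be too small to fill Z. *)
Lemma greedy_independent {K : fieldType} {V : vectType K} (Z B : {vspace V}) k
    (A : 'I_k -> {vspace V}) s r :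
  (Z <= \sum_c A c)%VS -> (forall c, \dim (A c) <= s)%N ->
  (r * s.+1 + \dim B < \dim Z + s.+1)%N ->
  exists (c : 'I_r -> 'I_k) (f : 'I_r -> V), [/\ injective c,
    forall i, f i \in A (c i)
    & forall a : 'I_r -> K, \sum_i a i *: f i \in B -> forall i, a i = 0].
Proof.
move=> ZA As; elim: r => [|r IH] lt.
  have no T : 'I_0 -> T by case.
  by exists (no _), (no _); split; [by case | by case | by move=> a _; case].
have [|c [f [c_inj fA indep]]] := IH; first by rewrite mulSn in lt; lia.
pose U := (B + <<[seq f i | i <- enum 'I_r]>>)%VS.
have [c1 [f1 [c1P f1A f1U]]] : exists c1 f1, [/\ forall i, c i != c1, f1 \in A c1 & f1 \notin U].
  apply: contrapT => no.
  have sub : (Z <= \sum_i A (c i) + U)%VS.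
    apply: subv_trans ZA _; apply/subv_sumP => c1 _.
    have [/existsP [i /eqP <-]|/existsPn nc] := boolP [exists i, c i == c1].
      by apply: subv_trans (addvSl _ _); apply: (sumv_sup i).
    apply: subv_trans (addvSr _ _); apply/subvP => f1 f1A.
    by apply: contrapT => f1U; apply: no; exists c1, f1; split=> //; apply/negP.
  have dU : (\dim U <= \dim B + r)%N.
    apply: leq_trans (dimvD_le _ _) _; rewrite leq_add2l.
    by apply: leq_trans (dim_span _) _; rewrite size_map size_enum_ord.
  have dA : (\dim (\sum_i A (c i)) <= r * s)%N.
    apply: leq_trans (dimv_leq_sum _ _ _) _.
    rewrite -[X in (_ <= X * _)%N](card_ord r) -sum_nat_const.
    by apply: leq_sum => i _; apply: As.
  have := dimvS sub => dZ.
  have := leq_trans dZ (dimvD_le _ _).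
  by move: lt; rewrite mulSn mulnS; lia.
exists (fun i => oapp c c1 (unlift ord0 i)), (fun i => oapp f f1 (unlift ord0 i)).
split.
- move=> i j; case: unliftP => [i'|] ->; case: unliftP => [j'|] -> //=.
  + by move=> /c_inj ->.
  + by move=> E; have := c1P i'; rewrite E eqxx.
  + by move=> E; have := c1P j'; rewrite E eqxx.
- by move=> i; case: unliftP => [i'|] _ /=.
move=> a; rewrite big_ord_recl unlift_none /=.
under eq_bigr do rewrite liftK /=.
move=> aB; have a0 : a ord0 = 0.
  apply: contrapT => /eqP a0; case/negP: f1U.
  rewrite -[f1](scalerK a0) memvZ // -[_ *: f1](addrK (\sum_i a (lift ord0 i) *: f i)).
  rewrite rpredB ?(subvP (addvSl _ _) _ aB) //.
  apply: (subvP (addvSr _ _)); apply: memv_suml => i _; apply/memvZ/memv_span.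
  by apply: map_f; rewrite mem_enum.
move=> i; case: (unliftP ord0 i) => [i'|] -> //.
by apply: (indep (fun i => a (lift ord0 i))); rewrite a0 scale0r add0r in aB.
Qed.

Section Cutoff.
Context {K : finFieldType} {E : finType}.
Local Notation V := {ffun E -> K^o}.

Definition cutoff_fun (P : pred E) (f : V) : V := [ffun e => if P e then f e else 0].

Fact cutoff_linear P : linear (cutoff_fun P).
Proof.
by move=> a f g; apply/ffunP=> e; rewrite !ffunE; case: ifP; rewrite ?scaler0 ?addr0.
Qed.
HB.instance Definition _ P := GRing.isLinear.Build K V V _ _ (cutoff_linear P).

Definition cutoff P : 'End(V) := linfun (cutoff_fun P).

Lemma cutoffE P f e : cutoff P f e = if P e then f e else 0.
Proof. by rewrite lfunE ffunE. Qed.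

Lemma dim_cutoff P (U : {vspace V}) : (\dim (cutoff P @: U) <= #|P|)%N.
Proof.
pose D e : V := [ffun e' => (e' == e)%:R].
have sub : (cutoff P @: U <= <<[seq D e | e <- enum P]>>)%VS.
  apply/subvP => _ /memv_imgP [f _ ->].
  have -> : cutoff P f = \sum_(e in P) f e *: D e.
    rewrite [LHS]ffun_sum_delta [RHS]big_mkcond; apply: eq_bigr => e _.
    by rewrite cutoffE -[P e]/(e \in P); case: ifP; rewrite ?scale0r.
  by apply: memv_suml => e Pe; apply/memvZ/memv_span/map_f; rewrite mem_enum.
apply: leq_trans (dimvS sub) _; apply: leq_trans (dim_span _) _.
by rewrite size_map -cardE.
Qed.

Lemma dim_cutoff_ker P (U : {vspace V}) :
  (\dim U <= \dim (U :&: lker (cutoff P)) + #|P|)%N.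
Proof. by rewrite -(limg_ker_dim (cutoff P) U) leq_add2l dim_cutoff. Qed.

End Cutoff.

Section Heights.
Context {n m : nat} (rel : 'I_m -> seq 'I_n) (p : nat) (p_pr : prime p).

(** A map of the quotient, seen as the set of vertices of its Cayley graph, to a
    circle of length q that stretches the edges by at most C, and on which the left
    multiplication by g induces the rotation by one. *)
Definition height {gT : finGroupType} (b : 'I_n -> gT) C q (ht : gT -> 'Z_q)
    (f : 'I_n * gT -> int) (g : gT) :=
  [/\ forall x v, ht (v * b x)%g = ht v + (f (x, v))%:~R,
      forall e, (`|f e| <= C)%N & forall v, ht (g * v)%g = ht v + 1].

(** The second component of the covering of Y by the reductions modulo p ^ j of the
    integral cocycle, lifted to the permutation group of that covering. The bound C
    does not depend on j, and a power of the loop w0 serves as g. *)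
Lemma height_cover (Y : finType) (st : 'I_n -> Y -> Y) (f : 'I_n * Y -> int) y0 w0 :
  p_action rel p st -> cocycle rel st f -> run st y0 w0 = y0 ->
  ~~ (p%:Z %| relsum st f y0 w0)%Z ->
  exists C, forall j, (0 < j)%N -> exists (gT : finGroupType) (b : 'I_n -> gT),
    p_quotient rel p b /\
    exists (ht : gT -> 'Z_(p ^ j)) (f' : 'I_n * gT -> int) g, height b C ht f' g.
Proof.
move=> pst cf loop nd; exists (\max_e `|f e|%N) => j j0.
have q1 : (1 < p ^ j)%N := prime_power_gt1 p_pr j0.
pose k e : 'Z_(p ^ j) := (f e)%:~R.
have pk : p_action rel p (ext st k).
  apply: (p_action_ext (k := j)) => //.
    by move=> i y; rewrite relsum_intr cf.
  by move=> a; rewrite -mulr_natr pchar_Zp // mulr0.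
have [gT [b [act [qb act_w _]]]] := reg_cover p_pr pk.
have [_ gen _] := qb.
exists gT, b; split=> //.
have [c cP] : exists c : nat, (relsum st k y0 w0) *+ c = 1.
  have cop : coprimez (relsum st f y0 w0) (p ^ j)%N.
    rewrite /coprimez gcdzC -[gcdz _ _]/(Posz (gcdn _ _)) /= eqz_nat.
    by rewrite -/(coprime _ _) coprimeXl // prime_coprime.
  have [[u v] /= uv] := coprimezP _ _ cop.
  exists ((u%:~R : 'Z_(p ^ j)) : nat); rewrite -mulr_natr natr_Zp.
  have := congr1 (fun z : int => z%:~R : 'Z_(p ^ j)) uv.
  rewrite rmorphD !rmorphM /= [(p ^ j)%N%:~R](_ : _ = 0 :> 'Z_(p ^ j)); last exact: pchar_Zp.
  by rewrite mulr0 addr0 relsum_intr mulrC.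
have loopc i : run st y0 (repw i w0) = y0 /\
    relsum st k y0 (repw i w0) = relsum st k y0 w0 *+ i.
  elim: i => [|i [IH1 IH2]]; first by rewrite /= relsum_nil mulr0n.
  by rewrite /repw /= run_cat relsum_cat loop -/(repw i w0) IH1 IH2 mulrS.
exists (fun v => (act (y0, 0) v).2), (fun e => f (e.1, (act (y0, 0) e.2).1)),
  (wprod b (repw c w0)).
split=> [x v|e|v].
- have [w <-] := gen v.
  have -> : (wprod b w * b x)%g = wprod b (w ++ [:: x]).
    by rewrite /wprod big_cat big_seq1.
  by rewrite !act_w run_cat !run_ext /= relsum_cons relsum_nil addr0 add0r.
- exact: leq_bigmax.
have [w <-] := gen v.
have -> : (wprod b (repw c w0) * wprod b w)%g = wprod b (repw c w0 ++ w).
  by rewrite /wprod big_cat.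
have [r1 r2] := loopc c.
by rewrite !act_w !run_ext /= relsum_cat r1 r2 cP !add0r addrC.
Qed.

End Heights.

(** * Cutting a circle of heights into arcs *)

Lemma card_le_nat (T : finType) (P : pred T) (phi : T -> nat) N :
  {in P &, injective phi} -> (forall x, P x -> (phi x < N)%N) -> (#|P| <= N)%N.
Proof.
move=> inj lt; case: N lt => [|N] lt.
  by rewrite leqn0; apply/eqP/eq_card0 => x; apply/negP => /lt.
rewrite -[X in (_ <= X)%N](card_ord N.+1).
rewrite -(card_in_imset (f := fun x => inord (phi x) : 'I_N.+1)) ?max_card //.
move=> x y Px Py /(congr1 val) /=; rewrite !inordK; [exact: inj|exact: lt..].
Qed.

(** Cocycles that are independent modulo the coboundaries and so far from each
    other that no relator meets the supports of two of them. *)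
Record separated {n m : nat} (rel : 'I_m -> seq 'I_n) {p : nat} {gT : finGroupType}
    (b : 'I_n -> gT) {r : nat} (f : 'I_r -> 'I_n * gT -> 'F_p) : Prop := Separated {
  sep_cocycle : forall i, cocycle rel (reg b) (f i);
  sep_path : forall i j v a e e', e \in edges (reg b) v (rel a) ->
    e' \in edges (reg b) v (rel a) -> f i e != 0 -> f j e' != 0 -> i = j;
  sep_edge : forall i j e, f i e != 0 -> f j e != 0 -> i = j;
  sep_indep : forall (c : 'I_r -> 'F_p) (psi : gT -> 'F_p),
    (forall e, \sum_i c i * f i e = coboundary (reg b) psi e) -> forall i, c i = 0 }.

(** The circle of length q = k M is cut into k arcs of length M; D bounds the
    variation of the height along a relator. *)
Section Arcs.
Context {n m : nat} (rel : 'I_m -> seq 'I_n) (p : nat) (p_pr : prime p).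
Context {gT : finGroupType} (b : 'I_n -> gT) (qb : p_quotient rel p b).
Context (C q k M : nat) (q_gt1 : (1 < q)%N) (qE : q = (k * M)%N).
Context (ht : gT -> 'Z_q) (f' : 'I_n * gT -> int) (g : gT) (htP : height b C ht f' g).
Context (L : nat) (relL : forall i, (size (rel i) <= L)%N).
Let D := (2 * (C * L))%N.
Local Notation E := ('I_n * gT)%type.
Local Notation V := {ffun E -> ('F_p)^o}.
Local Notation st := (reg b).

Let M_gt0 : (0 < M)%N.
Proof. by move: q_gt1; rewrite qE; case: M => //; rewrite muln0. Qed.

Let ht_lt v : (ht v < q)%N.
Proof. by have := ltn_ord (ht v); rewrite [X in (_ < X)%N]Zp_cast. Qed.

(** The number of elements of any given height. *)
Definition level := #|[set v | ht v == 0]|.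

Lemma card_ht (P : pred 'Z_q) : #|[set v | P (ht v)]| = (#|P| * level)%N.
Proof.
have [_ _ htg] := htP.
have lev h : #|[set v | ht v == h]| = level.
  rewrite -[h]natr_Zp; elim: (h : nat) => [|i IH]; first by rewrite mulr0n.
  rewrite -IH -[RHS](card_imset _ (mulgI g)); apply: eq_card => v; rewrite !inE.
  apply/eqP/imsetP => [vh|[u + ->]]; last first.
    by rewrite inE htg => /eqP ->; rewrite mulrSr.
  exists (g^-1 * v)%g; last by rewrite mulKVg.
  by rewrite inE; apply/eqP/(addIr 1); rewrite -htg mulKVg vh mulrSr.
rewrite -sum1_card (partition_big ht P) => [|v]; last by rewrite inE.
rewrite -sum_nat_const; apply: eq_bigr => h Ph.
rewrite -(lev h) -sum1_card; apply: eq_bigl => v; rewrite !inE andb_idl // => /eqP ->.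
exact: Ph.
Qed.

Lemma card_level : #|gT| = (k * M * level)%N.
Proof.
rewrite -qE -[#|gT|]cardsT -(_ : [set v | predT (ht v)] = setT) ?card_ht.
  by rewrite card_ord Zp_cast.
by apply/setP => v; rewrite !inE.
Qed.

Definition arc v := (ht v %/ M)%N.

Lemma arc_lt v : (arc v < k)%N.
Proof. by rewrite ltn_divLR // -qE. Qed.

(** Away from the ends of its arc. *)
Definition good (e : E) := (D <= ht e.2 %% M < M - D)%N.

Lemma card_bad : (#|predC good| <= n * (2 * D * k * level))%N.
Proof.
pose P (h : 'Z_q) := ~~ (D <= h %% M < M - D)%N.
have -> : #|predC good| = (n * #|[set v | P (ht v)]|)%N.
  rewrite -[in RHS](card_ord n) -cardX; apply: eq_card => e; by rewrite !inE /=.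
rewrite card_ht leq_mul2l; apply/orP; right; rewrite leq_mul2r; apply/orP; right.
pose r h := (h %% M)%N.
pose i h := (if (r h < D)%N then r h else D + (M.-1 - r h))%N.
have rM h : (r h < M)%N by rewrite ltn_mod.
have iD (h : 'Z_q) : P h -> (i h < 2 * D)%N.
  by rewrite /P /i -/(r h) negb_and -ltnNge -leqNgt; have rh := rM h; case: (ltnP (r h)); lia.
have i_inj (h h' : 'Z_q) : P h -> P h' -> i h = i h' -> r h = r h'.
  move=> _ _; rewrite /i; have rh := rM h; have rh' := rM h'.
  by case: (ltnP (r h)) => ?; case: (ltnP (r h')) => ?; lia.
apply: (card_le_nat (phi := fun h : 'Z_q => (h %/ M * (2 * D) + i h)%N)).
  move=> h h' Ph Ph' E; have i1 := iD h Ph; have i2 := iD h' Ph'.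
  have D0 : (0 < 2 * D)%N by apply: leq_ltn_trans i1.
  have Ed : (h %/ M = h' %/ M)%N.
    have := congr1 (fun z => z %/ (2 * D))%N E.
    by rewrite /= !divnMDl // (divn_small i1) (divn_small i2) !addn0.
  have Ei : i h = i h' by apply/eqP; rewrite -(eqn_add2l (h %/ M * (2 * D))) {2}Ed E.
  apply: val_inj => /=; rewrite (divn_eq h M) (divn_eq h' M) Ed.
  by rewrite -/(r h) -/(r h') (i_inj h h').
move=> h Ph; have := iD h Ph; have hk : (h %/ M < k)%N.
  by rewrite ltn_divLR // -qE; have := ltn_ord h; rewrite [X in (_ < X)%N]Zp_cast.
move: (h %/ M)%N (i h) hk => c j ck jD.
apply: (@leq_trans (c.+1 * (2 * D))); first by rewrite mulSn addnC ltn_add2r.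
by rewrite [(2 * D * k)%N]mulnC leq_mul2r ck orbT.
Qed.

Lemma card_arc c : (#|[set v | arc v == c]| <= M * level)%N.
Proof.
rewrite (card_ht (fun h => h %/ M == c)%N) leq_mul2r; apply/orP; right.
apply: (card_le_nat (phi := fun h : 'Z_q => h %% M)%N).
  move=> h h' /eqP hc /eqP hc' E; apply: val_inj => /=.
  by rewrite (divn_eq h M) (divn_eq h' M) hc hc' E.
by move=> h _; rewrite ltn_mod.
Qed.

Lemma run_height v w : exists2 d : int, (`|d| <= C * size w)%N &
  ht (run st v w) = ht v + d%:~R.
Proof.
have [htx bnd _] := htP; elim: w v => [|x w IH] v.
  by exists 0; rewrite ?addr0.
have [d dw dE] := IH (v * b x)%g; exists (f' (x, v) + d).
  by have := bnd (x, v); rewrite /= mulnS; lia.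
by rewrite [run _ _ _]/= dE htx rmorphD addrA.
Qed.

(** The height varies by at most D along a relator path, and that of a good edge is
    at distance D at least from the ends of its arc. *)
Lemma arc_path v i e e' : e \in edges st v (rel i) -> e' \in edges st v (rel i) ->
  good e -> arc e'.2 = arc e.2.
Proof.
move=> /edges_prefix [w1 [w2 [E1 e1]]] /edges_prefix [w3 [w4 [E2 e2]]].
have [d1 d1w h1] := run_height v w1; have [d2 d2w h2] := run_height v w3.
have s1 : (size w1 <= L)%N by apply: leq_trans (relL i); rewrite E1 size_cat leq_addr.
have s2 : (size w3 <= L)%N by apply: leq_trans (relL i); rewrite E2 size_cat leq_addr.
have hE : ht e'.2 = ht e.2 + (d2 - d1)%:~R.
  by rewrite e1 e2 h1 h2 rmorphB; ring.
have dD : (`|(d2 - d1)%R| <= D)%N.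
  have : (C * size w1 <= C * L)%N by rewrite leq_mul2l s1 orbT.
  have : (C * size w3 <= C * L)%N by rewrite leq_mul2l s2 orbT.
  by rewrite /D; lia.
move: (d2 - d1) dD hE => d dD hE; rewrite /good => /andP [lo hi].
rewrite /arc; have := divn_eq (ht e.2) M; have := arc_lt e.2; rewrite /arc.
have := ht_lt e.2; move: (ht e.2 %/ M)%N (ht e.2 %% M)%N lo hi => c r lo hi htq ck hc.
have [s sE] : exists s : nat, s%:Z = r%:Z + d by exists `|(r%:Z + d)%R|%N; lia.
have sM : (s < M)%N by lia.
have lt : (c * M + s < q)%N.
  rewrite qE; apply: (@leq_trans (c.+1 * M)); first by rewrite mulSn addnC ltn_add2r.
  by rewrite leq_mul2r ck orbT.
have -> : ht e'.2 = (c * M + s)%:R :> 'Z_q.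
  rewrite hE -[ht e.2 in LHS]natr_Zp hc !natrD -addrA; congr (_ + _).
  by have := congr1 (fun z : int => z%:~R : 'Z_q) sE; rewrite rmorphD.
by rewrite val_Zp_nat // modn_small // divnMDl // divn_small ?addn0.
Qed.

Definition in_arc (c : 'I_k) : pred E := fun e => good e && (arc e.2 == c).

Local Notation Z := (cocycles rel 'F_p st).
Local Notation cutoffp P := (@cutoff 'F_p _ P).

Definition good_cocycles : {vspace V} := (Z :&: lker (cutoffp (predC good)))%VS.

Definition arc_cocycles (c : 'I_k) : {vspace V} :=
  (Z :&: lker (cutoffp (predC (in_arc c))))%VS.

Lemma cutoffCP (P : pred E) (f : V) :
  reflect (forall e, f e != 0 -> P e) (f \in lker (cutoffp (predC P))).
Proof.
rewrite memv_ker; apply: (iffP eqP) => [f0 e fe|h].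
  by apply: contraNT fe => nP; have /ffunP /(_ e) := f0; rewrite cutoffE /= nP ffunE => ->.
apply/ffunP=> e; rewrite cutoffE ffunE /=; case: ifP => // nP.
by apply: contraTeq nP => fe; rewrite negbK h.
Qed.

(** A relator path meets the good edges of at most one arc. *)
Lemma cutoff_arc_cocycle (f : V) c : f \in good_cocycles -> cutoffp (in_arc c) f \in Z.
Proof.
move=> /memv_capP [/cocyclesP cf /cutoffCP fg]; apply/cocyclesP => i v.
have [/existsP [e /andP [ein ge]]|/existsPn nog] :=
    boolP [exists e, (e \in edges st v (rel i)) && good e].
  have [ec|nec] := eqVneq (arc e.2) c.
    rewrite -[RHS](cf i v); apply: eq_big_seq => e' e'in.
    rewrite cutoffE /in_arc (arc_path ein e'in ge) ec eqxx andbT.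
    by case: ifP => // /negbT nge; apply/esym/eqP; apply: contraNT nge; apply: fg.
  rewrite /relsum big_seq big1 // => e' e'in.
  by rewrite cutoffE /in_arc (arc_path ein e'in ge) (negPf nec) andbF.
rewrite /relsum big_seq big1 // => e ein.
by have := nog e; rewrite ein cutoffE /in_arc /= => /negPf ->.
Qed.

Lemma good_cocycles_sub : (good_cocycles <= \sum_c arc_cocycles c)%VS.
Proof.
apply/subvP => f fg; have /memv_capP [_ /cutoffCP f0] := fg.
have -> : f = \sum_c cutoffp (in_arc c) f.
  apply/ffunP=> e; rewrite sum_ffunE.
  rewrite (bigD1 (Ordinal (arc_lt e.2))) //= big1 => [|c ne].
    rewrite addr0 cutoffE /in_arc eqxx andbT; case: ifP => // /negbT nge.
    by apply/eqP; apply: contraNT nge; apply: f0.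
  rewrite cutoffE /in_arc; case: ifP => // /andP [_ /eqP ec].
  by case/eqP: ne; apply: val_inj.
apply: memv_suml => c _.
have sc : (arc_cocycles c <= \sum_c arc_cocycles c)%VS by rewrite (bigD1 c) //= addvSl.
apply: (subvP sc).
apply/memv_capP; split; first exact: cutoff_arc_cocycle.
by apply/cutoffCP => e; rewrite cutoffE; case: ifP; rewrite ?eqxx.
Qed.

Lemma dim_arc_cocycles c : (\dim (arc_cocycles c) <= n * (M * level))%N.
Proof.
have sub : (arc_cocycles c <= cutoffp (in_arc c) @: Z)%VS.
  apply/subvP => f /memv_capP [cf /cutoffCP fc]; apply/memv_imgP; exists f => //.
  apply/ffunP=> e; rewrite cutoffE; case: ifP => // /negbT nce.
  by apply/eqP; apply: contraNT nce; apply: fc.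
apply: leq_trans (dimvS sub) _; apply: leq_trans (dim_cutoff _ _) _.
apply: (@leq_trans (n * #|[set v | arc v == c]|)); last by rewrite leq_mul2l card_arc orbT.
rewrite -[X in (_ <= X * _)%N](card_ord n) -cardX; apply: subset_leq_card.
by apply/subsetP => -[x v]; rewrite !inE /= unfold_in => /andP [_].
Qed.

Lemma rank_good : (rank rel p st <= \dim good_cocycles + n * (2 * D * k * level))%N.
Proof.
apply: leq_trans (dim_cutoff_ker (predC good) _) _.
by rewrite leq_add2l card_bad.
Qed.

Definition cob_fun (psi : {ffun gT -> ('F_p)^o}) : V := [ffun e => coboundary st psi e].

Fact cob_linear : linear cob_fun.
Proof.
move=> a f h; apply/ffunP=> e; rewrite !ffunE /coboundary !ffunE.
by rewrite scalerBr opprD addrACA.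
Qed.
HB.instance Definition _ :=
  GRing.isLinear.Build 'F_p {ffun gT -> ('F_p)^o} V _ cob_fun cob_linear.

Definition coboundaries : {vspace V} := limg (linfun cob_fun).

Lemma dim_coboundaries : (\dim coboundaries <= #|gT|)%N.
Proof.
rewrite -(dim_ffun 'F_p gT) -(limg_ker_dim (linfun cob_fun) fullv).
exact: leq_addl.
Qed.

Lemma arc_family r :
  (r * (n * (M * level)).+1 + #|gT| < \dim good_cocycles)%N ->
  exists f : 'I_r -> E -> 'F_p, separated rel b f.
Proof.
move=> lt; have dB := dim_coboundaries.
have [|c [f [c_inj fA indep]]] :=
    greedy_independent (B := coboundaries) (r := r) good_cocycles_sub dim_arc_cocycles.
  by lia.
have fP i e : f i e != 0 -> in_arc (c i) e.
  by have /memv_capP [_ /cutoffCP] := fA i; apply.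
exists (fun i e => f i e); split.
- by move=> i; have /memv_capP [/cocyclesP] := fA i.
- move=> i j v a e e' ein e'in /fP /andP [ge /eqP ei] /fP /andP [_ /eqP ej].
  by apply/c_inj/val_inj => /=; rewrite -ei -ej (arc_path ein e'in ge).
- move=> i j e /fP /andP [_ /eqP ei] /fP /andP [_ /eqP ej].
  by apply/c_inj/val_inj => /=; rewrite -ei -ej.
move=> l psi sumE; apply: indep; apply/memv_imgP.
exists [ffun v => psi v]; first exact: memvf.
apply/ffunP=> e.
rewrite lfunE ffunE /coboundary !ffunE -[RHS]sumE sum_ffunE.
by apply: eq_bigr => i _; rewrite ffunE.
Qed.

End Arcs.

(** The bad edges cost about 2 n D k level dimensions and an arc has n M level edges
    at most, while the rank exceeds the number k M level of elements by a fixed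
    proportion: it suffices that M and k be large. *)
Lemma separated_cocycles {n m : nat} (rel : 'I_m -> seq 'I_n) p (p_pr : prime p) l r :
  rank_bound rel p l.+1 l ->
  exists (gT : finGroupType) (b : 'I_n -> gT), p_quotient rel p b /\
  exists f : 'I_r -> 'I_n * gT -> 'F_p, separated rel b f.
Proof.
move=> growth.
have [Y [st [f0 [y0 [w0 [pst cf0 loop nd]]]]]] := nontrivial_integral_cocycle p_pr growth.
have [C hC] := height_cover p_pr pst cf0 loop nd.
pose L := \max_i size (rel i).
have relL i : (size (rel i) <= L)%N by apply: leq_bigmax.
pose D := (2 * (C * L))%N.
pose j1 := (2 * l * r * n.+1).+1; pose j2 := (4 * l * n * D + 1)%N.
have p1 := prime_gt1 p_pr.
have k1 : (j1 < p ^ j1)%N by apply: ltn_expl.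
have M1 : (j2 < p ^ j2)%N by apply: ltn_expl.
have jpos : (0 < j1 + j2)%N by rewrite addn_gt0.
have [gT [b [qb [ht [f' [g hP]]]]]] := hC _ jpos.
have q1 : (1 < p ^ (j1 + j2))%N := prime_power_gt1 p_pr jpos.
have qE := expnD p j1 j2.
exists gT, b; split=> //; apply: (arc_family p_pr q1 qE hP relL).
have lv : (0 < level ht)%N.
  have : (0 < #|gT|)%N by apply/card_gt0P; exists 1%g.
  by rewrite (card_level q1 qE hP) muln_gt0 => /andP [].
move: (growth _ _ (p_action_reg qb)) (rank_good rel p_pr q1 qE hP L).
rewrite (card_level q1 qE hP) -/D.
move: (\dim _) (rank _ _ _) (level ht) lv k1 M1 => z rk v v0.
move: (p ^ j1)%N (p ^ j2)%N => k M; rewrite /j1 /j2 => {hC j1 j2 jpos q1 qE ht hP} k1 M1 gr rg.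
have b1 : (2 * (l * (r * (n * (M * v)).+1)) < k * M * v)%N.
  apply: (@leq_ltn_trans (2 * l * r * n.+1 * (M * v))).
    have -> : (2 * l * r * n.+1 * (M * v) = 2 * (l * (r * (n.+1 * (M * v)))))%N by ring.
    have u0 : (0 < M * v)%N by rewrite muln_gt0 v0; lia.
    have le : ((n * (M * v)).+1 <= n.+1 * (M * v))%N by rewrite mulSn; lia.
    by rewrite !leq_mul2l le !orbT.
  rewrite -(mulnA k) ltn_pmul2r ?muln_gt0 ?v0 ?andbT; lia.
have b2 : (2 * (l * (n * (2 * D * k * v))) <= k * M * v)%N.
  have -> : (2 * (l * (n * (2 * D * k * v))) = k * (4 * l * n * D) * v)%N by ring.
  by rewrite leq_mul2r leq_mul2l; apply/orP; right; apply/orP; right; lia.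
have l0 : (0 < l)%N.
  case: l gr b1 {growth b2 k1 M1} => // gr b1; move: gr; rewrite mul1n mul0n => gr.
  by have := leq_trans b1 gr.
rewrite -(ltn_pmul2l l0) mulnDr.
have : (l * rk <= l * (z + n * (2 * D * k * v)))%N by rewrite leq_mul2l rg orbT.
rewrite mulnDr; move: gr; rewrite mulSn; lia.
Qed.

(** * A finite quotient with commuting translations *)

(** A coordinate of the projection along U that does not vanish at v. *)
Lemma linear_functional {K : finFieldType} {I : finType} (U : {vspace {ffun I -> K^o}}) v :
  v \notin U -> exists2 l : I -> K, exists i, l i != 0 &
    forall u : {ffun I -> K^o}, u \in U -> \sum_i l i * u i = 0.
Proof.
move=> vU; pose h u := u - projv U u.
have hU u : u \in U -> h u = 0 by move=> uU; rewrite /h projv_id ?subrr.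
have hv : h v != 0.
  by apply: contra vU; rewrite subr_eq0 => /eqP ->; rewrite memv_proj.
have [i0 hi0] : exists i0, h v i0 != 0.
  apply/existsP; apply: contraR hv => /existsPn h0; apply/eqP/ffunP => i.
  by rewrite [RHS]ffunE; apply/eqP; have := h0 i; rewrite negbK.
pose D i : {ffun I -> K^o} := [ffun j => (j == i)%:R].
have hE u : h u i0 = \sum_i h (D i) i0 * u i.
  rewrite {1}[u]ffun_sum_delta /h linear_sum -sumrB sum_ffunE; apply: eq_bigr => i _.
  by rewrite linearZ /= -scalerBr ffunE mulrC.
exists (fun i => h (D i) i0).
  have : ~~ [forall i, h (D i) i0 == 0].
    apply: contra hi0 => /forallP h0; rewrite hE big1 // => i _.
    by rewrite (eqP (h0 i)) mul0r.
  by move=> /forallPn.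
by move=> u uU; rewrite -hE hU // ffunE.
Qed.

Section Lift.
Context {n m : nat} (rel : 'I_m -> seq 'I_n) (p : nat) (p_pr : prime p).

(** On the group gT the cocycles F i are the coboundaries of functions phi i and no
    two of them meet along a relator; the commuting g j move phi j alone. *)
Record translations {gT : finGroupType} (b : 'I_n -> gT) {I : finType}
    (phi : I -> gT -> 'F_p) (F : I -> 'I_n * gT -> 'F_p) (g : I -> gT) : Prop :=
  Translations {
  tr_phi : forall i x v, phi i (v * b x)%g = phi i v + F i (x, v);
  tr_path : forall i j v a e e', e \in edges (reg b) v (rel a) ->
    e' \in edges (reg b) v (rel a) -> F i e != 0 -> F j e' != 0 -> i = j;
  tr_edge : forall i j e, F i e != 0 -> F j e != 0 -> i = j;
  tr_shift : forall i j v, phi i (g j * v)%g = phi i v + (i == j)%:R;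
  tr_inv : forall i j x v, F i (x, (g j * v)%g) = F i (x, v);
  tr_comm : forall i j, (g i * g j = g j * g i)%g }.

(** The permutation group of the covering of b by all the f i together. Its elements
    over 1 act by translations of the fibres, hence commute; independence modulo the
    coboundaries makes every translation available. *)
Lemma translations_exist {gT : finGroupType} (b : 'I_n -> gT) r
    (f : 'I_r -> 'I_n * gT -> 'F_p) : p_quotient rel p b ->
  separated rel b f ->
  exists (gT' : finGroupType) (b' : 'I_n -> gT') phi F (g : 'I_r -> gT'),
    p_quotient rel p b' /\ translations b' phi F g.
Proof.
move=> qb [cf fpath fedge indep].
pose A := {ffun 'I_r -> ('F_p)^o}.
pose k e : A := [ffun i => f i e].
have relk y w : relsum (reg b) k y w = [ffun i => relsum (reg b) (f i) y w].
  apply/ffunP=> i; rewrite [RHS]ffunE /relsum sum_ffunE.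
  by apply: eq_bigr => e _; rewrite ffunE.
have pk : p_action rel p (ext (reg b) k).
  apply: (p_action_ext (k := 1)); first exact: p_action_reg.
    by move=> i y; rewrite relk; apply/ffunP=> j; rewrite !ffunE cf.
  move=> a; rewrite expn1; apply/ffunP=> i; rewrite ffunMnE ffunE.
  by rewrite -mulr_natr (pcharf0 (pchar_Fp p_pr)) mulr0.
have [V [c [act [qc actw faith]]]] := reg_cover p_pr pk.
have [_ gen _] := qc.
have actE y a w : act (y, a) (wprod c w) = ((y * wprod b w)%g, a + relsum (reg b) k y w).
  by rewrite actw run_ext /= run_reg.
have wcat w w' : (wprod c w * wprod c w')%g = wprod c (w ++ w').
  by rewrite /wprod big_cat.
have wcatb w w' : (wprod b w * wprod b w')%g = wprod b (w ++ w').
  by rewrite /wprod big_cat.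
pose pr v := (act (1%g, 0) v).1; pose ph v := (act (1%g, 0) v).2.
have prw w : pr (wprod c w) = wprod b w by rewrite /pr actE /= mul1g.
have phw w : ph (wprod c w) = relsum (reg b) k 1%g w by rewrite /ph actE /= add0r.
have prx x v : pr (v * c x)%g = (pr v * b x)%g.
  have [w <-] := gen v; have -> : c x = wprod c [:: x] by rewrite /wprod big_seq1.
  by rewrite wcat !prw -wcatb /wprod big_seq1.
have phx x v : ph (v * c x)%g = ph v + k (x, pr v).
  have [w <-] := gen v; have -> : c x = wprod c [:: x] by rewrite /wprod big_seq1.
  by rewrite wcat !phw prw relsum_cat relsum_cons relsum_nil addr0 run_reg mul1g.
have vert g v : pr g = 1%g -> pr (g * v)%g = pr v /\ ph (g * v)%g = ph g + ph v.
  have [w <-] := gen g; have [w' <-] := gen v; rewrite wcat !prw !phw => w1.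
  by rewrite -wcatb w1 mul1g relsum_cat run_reg mul1g w1.
have vcomm g h : pr g = 1%g -> pr h = 1%g -> (g * h = h * g)%g.
  have [w <-] := gen g; have [w' <-] := gen h; rewrite !prw => w1 w1'.
  by apply: faith => -[y a]; rewrite !wcat !actE -!wcatb w1 w1' !relsum_cat !run_reg
    w1 w1' !mulg1 [X in (_, _ + X) = _]addrC.
(* The possible translations of the fibres. *)
pose vals u := exists2 v, pr v = 1%g & ph v = u.
have vals_sub u v : vals u -> vals v -> vals (u + v).
  move=> [g g1 <-] [h h1 <-]; exists (g * h)%g; first by rewrite (vert g h g1).1.
  by rewrite (vert g h g1).2.
have vals0 : vals 0.
  exists (wprod c [::]); first by rewrite prw /wprod big_nil.
  by rewrite phw relsum_nil.
have valsZ a u : vals u -> vals (a *: u).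
  move=> uv; rewrite -[a]natr_Zp scaler_nat.
  by elim: (a : nat) => [|i IH]; rewrite ?mulr0n // mulrS; apply: vals_sub.
pose X := [seq ph v | v <- enum V & pr v == 1%g].
have spanX u : u \in <<X>>%VS -> vals u.
  rewrite -[X]/(tval (in_tuple X)) => /coord_span ->.
  apply: big_ind => // i _; apply: valsZ.
  have : (in_tuple X)`_i \in X by apply: mem_nth; apply: ltn_ord.
  by move=> /mapP [v + ->]; rewrite mem_filter => /andP [/eqP v1 _]; exists v.
have Xw w : wprod b w = 1%g -> relsum (reg b) k 1%g w \in <<X>>%VS.
  move=> w1; rewrite -phw; apply/memv_span/map_f.
  by rewrite mem_filter prw w1 eqxx mem_enum.
have Xloop v w : wprod b w = 1%g -> relsum (reg b) k v w \in <<X>>%VS.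
  have [_ genb _] := qb; have [u uv] := genb v; have [u' u'v] := genb v^-1%g.
  move=> w1; have l1 : wprod b (u ++ u') = 1%g by rewrite -wcatb uv u'v mulgV.
  have l2 : wprod b (u ++ w ++ u') = 1%g by rewrite -!wcatb uv w1 u'v mul1g mulgV.
  have := rpredB (Xw _ l2) (Xw _ l1); rewrite !relsum_cat !run_reg mul1g uv w1 mulg1.
  by rewrite opprD addrACA subrr add0r addrK.
have ex j : exists g, pr g = 1%g /\ ph g = [ffun i => (i == j)%:R].
  suff /spanX [g g1 gE] : ([ffun i => (i == j)%:R] : A) \in <<X>>%VS by exists g.
  apply: contraT => /linear_functional [l [i li0] lX].
  have [v w vw|psi psiE] := loops_coboundary
      (f := fun e => \sum_i l i * f i e) (prime_gt0 p_pr) (p_action_reg qb).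
    rewrite -[RHS](lX (relsum (reg b) k v w)); last first.
      by apply: Xloop; move: vw; rewrite run_reg -{2}[v]mulg1 => /mulgI.
    rewrite /relsum exchange_big; apply: eq_bigr => i' _ /=.
    rewrite sum_ffunE mulr_sumr; apply: eq_bigr => e _.
    by rewrite ffunE.
  case/eqP: li0; apply: (indep l psi) => -[x v]; exact: psiE.
have [g gP] := choice ex.
have pathc v w : edges (reg b) (pr v) w = [seq (e.1, pr e.2) | e <- edges (reg c) v w].
  by apply: edges_map => x u; rewrite /reg prx.
exists V, c, (fun i v => ph v i), (fun i e => f i (e.1, pr e.2)), g; split=> //.
split.
- by move=> i x v; rewrite phx !ffunE.
- move=> i j v a e e' ein e'in.
  apply: (fpath i j (pr v) a); rewrite pathc; first exact: (map_f _ ein).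
  exact: (map_f _ e'in).
- by move=> i j e; apply: fedge.
- by move=> i j v; have [g1 gE] := gP j; rewrite (vert _ v g1).2 gE addrC !ffunE.
- by move=> i j x v /=; have [g1 _] := gP j; rewrite (vert _ v g1).1.
- by move=> i j; apply: vcomm; apply: (gP _).1.
Qed.
End Lift.

(** * Functions invariant on either side of a cut *)

Section Invariance.
Context {n m : nat} (rel : 'I_m -> seq 'I_n) (p : nat) (p_pr : prime p).
Context {gT : finGroupType} (b : 'I_n -> gT) (qb : p_quotient rel p b).
Context {r : nat} (phi : 'I_r.+1 -> gT -> 'F_p) (F : 'I_r.+1 -> 'I_n * gT -> 'F_p).
Context (g : 'I_r.+1 -> gT) (tr : translations rel b phi F g).

(** Remove from the Cayley graph of gT the edges in the supports of the F k with
    k != ord0: the components are the left pieces. The right pieces are obtained by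
    removing the support of F ord0, and the classes by removing all supports. Each
    class lies in one left and one right piece: classes are the edges of a graph
    whose vertices are the pieces, and a left (right) invariant function is a
    function on the left (right) vertices. *)
Definition left_inv {T : Type} (h : gT -> T) := forall x v,
  (forall k, k != ord0 -> F k (x, v) = 0) -> h (v * b x)%g = h v.

Definition right_inv {T : Type} (h : gT -> T) := forall x v,
  F ord0 (x, v) = 0 -> h (v * b x)%g = h v.

Definition class_fun {T : Type} (h : gT -> T) := forall x v,
  (forall k, F k (x, v) = 0) -> h (v * b x)%g = h v.

Lemma left_class T (h : gT -> T) : left_inv h -> class_fun h.
Proof. by move=> lh x v F0; apply: lh. Qed.

Lemma right_class T (h : gT -> T) : right_inv h -> class_fun h.
Proof. by move=> rh x v F0; apply: rh. Qed.

Lemma inv_const T (h : gT -> T) : left_inv h -> right_inv h -> forall v, h v = h 1%g.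
Proof.
move=> lh rh v; have [_ gen _] := qb; have [w <-] := gen v.
elim/last_ind: w => [|w x IH]; first by rewrite /wprod big_nil.
rewrite -IH /wprod big_rcons /= -/(wprod b w).
have [F0|F0] := eqVneq (F ord0 (x, wprod b w)) 0; first exact: rh.
apply: lh => k k0; apply/eqP; apply: contraNT k0 => Fk.
by apply/eqP; apply: (tr_edge tr Fk F0).
Qed.

Lemma left_shift (h : gT -> 'F_p) j : left_inv h -> left_inv (fun v => h (g j * v)%g).
Proof.
by move=> lh x v F0; rewrite mulgA; apply: lh => k k0; rewrite (tr_inv tr) F0.
Qed.

Lemma right_shift (h : gT -> 'F_p) j : right_inv h -> right_inv (fun v => h (g j * v)%g).
Proof. by move=> lh x v F0; rewrite mulgA; apply: lh; rewrite (tr_inv tr) F0. Qed.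

(** A function invariant on both sides is constant. Hence the translation by
    g (lift ord0 k) changes be by a k * phi ord0 and a constant, and that by g ord0 by
    a constant only. These translations commute and the second adds 1 to phi ord0,
    so that a k = 0. *)
Lemma products_indep (al be : gT -> 'F_p) (a : 'I_r -> 'F_p) :
  left_inv al -> right_inv be ->
  (forall v, \sum_k a k * (phi ord0 v * phi (lift ord0 k) v) = al v + be v) ->
  forall k, a k = 0.
Proof.
move=> lal rbe E k.
have rphi0 : right_inv (phi ord0).
  by move=> x v F0; rewrite (tr_phi tr) F0 addr0.
have lphi j : left_inv (phi (lift ord0 j)).
  by move=> x v F0; rewrite (tr_phi tr) F0 ?addr0.
pose D i (h : gT -> 'F_p) v := h (g i * v)%g - h v.
have Dk v : a k * phi ord0 v = D (lift ord0 k) al v + D (lift ord0 k) be v.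
  rewrite /D addrACA -opprD -!E -sumrB (bigD1 k) //= big1 => [|j jk].
    by rewrite !(tr_shift tr) eqxx /= addr0; ring.
  rewrite !(tr_shift tr) (inj_eq lift_inj) (negPf jk) /=; ring.
have D0 v : \sum_j a j * phi (lift ord0 j) v = D ord0 al v + D ord0 be v.
  rewrite /D addrACA -opprD -!E -sumrB; apply: eq_bigr => j _.
  by rewrite !(tr_shift tr) eqxx /=; ring.
have c1 v : D (lift ord0 k) al v = D (lift ord0 k) al 1%g.
  apply: inv_const.
    by move=> x u F0; rewrite /D left_shift // lal.
  move=> x u F0; have := Dk (u * b x)%g; have := Dk u.
  rewrite rphi0 // => ->; rewrite {2 4}/D right_shift // rbe //.
  by move=> /addIr.
have c2 v : D ord0 be v = D ord0 be 1%g.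
  apply: inv_const; last first.
    by move=> x u F0; rewrite /D right_shift // rbe.
  move=> x u F0; have := D0 (u * b x)%g; have := D0 u.
  under [X in _ -> X = _ -> _]eq_bigr do rewrite lphi //.
  move=> ->; rewrite {1 3}/D left_shift // lal //.
  by move=> /addrI.
have s1 v : be (g (lift ord0 k) * v)%g = be v + a k * phi ord0 v - D (lift ord0 k) al 1%g.
  by rewrite Dk c1 /D; ring.
have s2 v : be (g ord0 * v)%g = be v + D ord0 be 1%g by rewrite -(c2 v) /D addrC subrK.
have := s2 (g (lift ord0 k) * 1)%g; rewrite mulgA (tr_comm tr) -mulgA !s1 s2.
rewrite (tr_shift tr) eqxx mulrDr mulr1 => E1.
apply: (addrI (be 1%g + D ord0 be 1%g + a k * phi ord0 1%g - D (lift ord0 k) al 1%g)).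
rewrite addr0 [RHS](_ : _ = be 1%g + a k * phi ord0 1%g - D (lift ord0 k) al 1%g + D ord0 be 1%g).
  by rewrite -E1 /=; ring.
by ring.
Qed.

(** In terms of the graph, the edges in T connect all its vertices. *)
Definition spanning (T : {set gT}) := forall al be : gT -> bool,
  left_inv al -> right_inv be -> {in T, al =1 be} ->
  forall v, al v = be v /\ al v = al 1%g.

Lemma spanning_full : spanning [set: gT].
Proof.
move=> al be lal rbe E; have {}E v : al v = be v by apply: E; rewrite inE.
have ral : right_inv al by move=> x v F0; rewrite !E rbe.
by move=> v; split=> //; apply: inv_const.
Qed.

(** A minimal spanning set is a spanning tree: removing t0 disconnects the graph,
    and the indicators of one side give the delta function at t0. *)
Lemma minimal_spanning : exists2 T, spanning T &
  forall h : gT -> 'F_p, exists al be : gT -> 'F_p,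
    [/\ left_inv al, right_inv be & {in T, forall t, h t = al t + be t}].
Proof.
have ex : exists T, (fun T => `[< spanning T >]) T.
  by exists setT; apply/asboolP/spanning_full.
have [T /minsetP [/asboolP sT minT]] := ex_minset ex.
exists T => //.
have delta t0 : t0 \in T -> exists z : (gT -> 'F_p) * (gT -> 'F_p),
    [/\ left_inv z.1, right_inv z.2 & {in T, forall t, (t == t0)%:R = z.1 t + z.2 t}].
  move=> t0T; apply: contrapT => no.
  suff : T :\ t0 = T by move/setP/(_ t0); rewrite !inE eqxx t0T.
  apply: minT; last exact: subD1set.
  apply/asboolP => al be lal rbe E.
  have [E0|N0] := boolP (al t0 == be t0).
    apply: sT => // t tT; have [->|ne] := eqVneq t t0; first exact/eqP.
    by apply: E; rewrite !inE ne.
  case: no; pose s : 'F_p := (al t0)%:R - (be t0)%:R.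
  exists (fun v => s * (al v)%:R, fun v => - s * (be v)%:R); split=> /=.
  - by move=> x v F0; rewrite lal.
  - by move=> x v F0; rewrite rbe.
  move=> t tT; rewrite mulNr -mulrBr; have [->|ne] := eqVneq t t0.
    by move: N0; rewrite /s; case: (al t0); case: (be t0) => //= _; rewrite ?subr0 ?sub0r ?mulrNN mulr1.
  by rewrite E ?inE ?ne // subrr mulr0.
have ex2 t0 : exists z : (gT -> 'F_p) * (gT -> 'F_p), t0 \in T ->
    [/\ left_inv z.1, right_inv z.2 & {in T, forall t, (t == t0)%:R = z.1 t + z.2 t}].
  have [t0T|t0T] := boolP (t0 \in T); last by exists (fun=> 0, fun=> 0).
  by have [z zP] := delta t0 t0T; exists z.
move=> h; have [z zP] := choice ex2.
exists (fun v => \sum_(t0 in T) h t0 * (z t0).1 v), (fun v => \sum_(t0 in T) h t0 * (z t0).2 v).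
split.
- by move=> x v F0; apply: eq_bigr => t0 /zP [l _ _]; rewrite l.
- by move=> x v F0; apply: eq_bigr => t0 /zP [_ l _]; rewrite l.
move=> t tT; rewrite -big_split /= (bigD1 t) //= big1 => [|t0 /andP [t0T ne]].
  by rewrite -mulrDr; have [_ _ <- //] := zP t tT; rewrite eqxx mulr1 addr0.
by rewrite -mulrDr; have [_ _ <- //] := zP t0 t0T; rewrite eq_sym (negPf ne) mulr0.
Qed.

Definition still (v v' : gT) := [exists x, (v' == v * b x)%g && [forall k, F k (x, v) == 0]].

Definition same_class := connect (fun v v' => still v v' || still v' v).

Lemma same_class_sym : connect_sym (fun v v' => still v v' || still v' v).
Proof. by apply: sym_connect_sym => v v'; rewrite orbC. Qed.

Lemma class_fun_same T (h : gT -> T) v v' : class_fun h -> same_class v v' -> h v = h v'.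
Proof.
move=> ch /connectP [s + ->]; elim: s v => //= u s IH v /andP [vu /IH <-].
have st w w' : still w w' -> h w = h w'.
  move=> /existsP [x /andP [/eqP -> /forallP F0]].
  by rewrite ch // => k; apply/eqP.
by case/orP: vu => /st.
Qed.

Local Notation croot := (fingraph.root (fun v v' => still v v' || still v' v)).

Lemma croot_class : class_fun croot.
Proof.
move=> x v F0; apply/esym/(fingraph.rootP same_class_sym)/connect1/orP; left.
by apply/existsP; exists x; rewrite eqxx; apply/forallP => k; apply/eqP.
Qed.

(** The classes that avoid T, represented by their roots. *)
Definition free_roots (T : {set gT}) : {set gT} :=
  [set v | (croot v == v) && [forall t in T, croot t != v]].

(** The number of edges outside a spanning tree is the first Betti number of the
    graph, and the r products phi ord0 * phi k are independent modulo the sums of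
    a left and a right invariant function. *)
Lemma card_free_roots (T : {set gT}) : (forall h : gT -> 'F_p, exists al be : gT -> 'F_p,
    [/\ left_inv al, right_inv be & {in T, forall t, h t = al t + be t}]) ->
  (r <= #|free_roots T|)%N.
Proof.
move=> dec.
have ex k : exists z : (gT -> 'F_p) * (gT -> 'F_p), [/\ left_inv z.1, right_inv z.2
      & {in T, forall t, phi ord0 t * phi (lift ord0 k) t = z.1 t + z.2 t}].
  have [al [be P]] := dec (fun v => phi ord0 v * phi (lift ord0 k) v).
  by exists (al, be).
have [z zP] := choice ex.
pose psi k v := phi ord0 v * phi (lift ord0 k) v - ((z k).1 v + (z k).2 v).
have cphi k : class_fun (phi k) by move=> x v F0; rewrite (tr_phi tr) F0 addr0.
have cpsi k : class_fun (psi k).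
  move=> x v F0; have [l1 l2 _] := zP k.
  by rewrite /psi !cphi // (left_class l1) // (right_class l2).
have psiT k v t : t \in T -> croot t = croot v -> psi k v = 0.
  move=> tT /(fingraph.rootP same_class_sym) tv; rewrite -(class_fun_same (cpsi k) tv).
  by have [_ _ E] := zP k; rewrite /psi E // subrr.
pose Q := {v | v \in free_roots T}.
pose G (a : {ffun 'I_r -> 'F_p}) : {ffun Q -> 'F_p} := [ffun q => \sum_k a k * psi k (val q)].
have G_inj : injective G.
  move=> a a' aa; apply/ffunP=> k; apply/eqP; rewrite -subr_eq0; apply/eqP.
  have [E1 E2] : left_inv (fun v => \sum_k (a k - a' k) * (z k).1 v) /\
                 right_inv (fun v => \sum_k (a k - a' k) * (z k).2 v).
    split=> x v F0; apply: eq_bigr => j _; have [l1 l2 _] := zP j; by rewrite ?l1 ?l2.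
  apply: (products_indep (a := fun k => a k - a' k) E1 E2) => v; apply/eqP.
  rewrite -subr_eq0 -big_split -sumrB /=.
  rewrite (eq_bigr (fun k => (a k - a' k) * psi k v)) => [|j _]; last first.
    by rewrite /psi; ring.
  have [/existsP [t /andP [tT /eqP tv]]|nt] := boolP [exists t, (t \in T) && (croot t == croot v)].
    by rewrite big1 // => j _; rewrite (psiT j v t) // mulr0.
  have vQ : croot v \in free_roots T.
    rewrite inE (root_root same_class_sym) eqxx; apply/forall_inP => t tT.
    by apply: contraNneq nt => tv; apply/existsP; exists t; rewrite tT tv eqxx.
  have := congr1 (fun f : {ffun Q -> 'F_p} => f (exist (fun v => v \in free_roots T) _ vQ)) aa.
  rewrite !ffunE /= => /eqP; rewrite -subr_eq0 -sumrB => E.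
  rewrite (eq_bigr (fun j => a j * psi j (croot v) - a' j * psi j (croot v))) // => j _.
  rewrite -mulrBl; congr (_ * _); apply: class_fun_same (cpsi j) _.
  exact: connect_root.
have := leq_card G G_inj; rewrite !card_ffun (card_ord r) card_sig (card_Fp p_pr).
by rewrite leq_exp2l // prime_gt1.
Qed.

End Invariance.

(** * Labelling the quotient by a group *)

Section Labels.
Context {n m : nat} (rel : 'I_m -> seq 'I_n) (inv : 'I_n -> 'I_n).
Hypothesis rel_inv : forall x, exists i, rel i = [:: x; inv x].

Section Products.
Context {gT : finGroupType} (b : 'I_n -> gT) {H : groupType} (L : 'I_n * gT -> H).
Local Open Scope group_scope.

Fixpoint lprod (v : gT) (w : seq 'I_n) : H :=
  if w is x :: w' then L (x, v) * lprod (v * b x) w' else 1.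

Lemma lprod_cat v w1 w2 : lprod v (w1 ++ w2) = lprod v w1 * lprod (v * wprod b w1) w2.
Proof.
elim: w1 v => [|x w1 IH] v /=; first by rewrite /wprod big_nil mulg1 mul1g.
by rewrite IH /wprod big_cons !mulgA.
Qed.

Lemma lprod_telescope (lab : gT -> H) v w :
  {in edges (reg b) v w, forall e, L e = lab e.2 * (lab (e.2 * b e.1))^-1} ->
  lprod v w = lab v * (lab (v * wprod b w))^-1.
Proof.
elim: w v => [|x w IH] v tele /=; first by rewrite /wprod big_nil mulg1 mulgV.
rewrite IH => [|e ein]; last by apply: tele; rewrite inE ein orbT.
by rewrite tele ?mem_head //= /wprod big_cons mulgA mulgKV mulgA.
Qed.

Hypothesis relb : forall i, wprod b (rel i) = 1.
Hypothesis relL : forall i v, lprod v (rel i) = 1.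

Definition inv_word (w : seq 'I_n) := rev (map inv w).

Lemma b_inv x : b x * b (inv x) = 1.
Proof.
have [i E] := rel_inv x; have := relb i.
by rewrite E /wprod !big_cons big_nil mulg1.
Qed.

Lemma L_inv x v : L (inv x, v * b x) = (L (x, v))^-1.
Proof.
have [i E] := rel_inv x; have := relL i v; rewrite E /= mulg1 => E1.
by apply/(mulgI (L (x, v))); rewrite E1 mulgV.
Qed.

Lemma lprod_inv_word v w : wprod b w * wprod b (inv_word w) = 1 /\
  lprod v (w ++ inv_word w) = 1.
Proof.
elim: w v => [|x w IH] v; first by rewrite /wprod !big_nil mulg1.
rewrite /inv_word /= rev_cons -/(inv_word w).
have [b1 l1] := IH (v * b x).
have wb : wprod b (rcons (inv_word w) (inv x)) = wprod b (inv_word w) * b (inv x).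
  by rewrite /wprod big_rcons.
split.
  by rewrite wb {1}/wprod big_cons -/(wprod b w) mulgA -(mulgA (b x)) b1 mulg1 b_inv.
rewrite -rcons_cat -cats1 lprod_cat l1 mul1g.
have -> : wprod b (w ++ inv_word w) = 1 by rewrite wprod_cat.
by rewrite mulg1 /= mulg1 L_inv mulgV.
Qed.

Definition loop_value (h : H) := exists2 w, wprod b w = 1 & lprod 1 w = h.

Lemma loop_value_div w w' : wprod b w = wprod b w' ->
  loop_value (lprod 1 w * (lprod 1 w')^-1).
Proof.
move=> E; have [b1 l1] := lprod_inv_word 1 w'.
exists (w ++ inv_word w'); first by rewrite wprod_cat E.
rewrite lprod_cat E; congr (_ * _); apply: (mulgI (lprod 1 w')).
by rewrite -lprod_cat l1 mulgV.
Qed.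

Lemma loop_value1 : loop_value 1.
Proof. by exists [::]; rewrite // /wprod big_nil. Qed.

Lemma loop_valueM h h' : loop_value h -> loop_value h' -> loop_value (h * h').
Proof.
move=> [w w1 <-] [w' w1' <-]; exists (w ++ w').
  by rewrite wprod_cat w1 w1' mulg1.
by rewrite lprod_cat w1 mul1g.
Qed.

Lemma loop_valueV h : loop_value h -> loop_value h^-1.
Proof.
move=> [w w1 <-]; rewrite -[_^-1]mul1g.
by apply: (loop_value_div (w := [::])); rewrite w1 /wprod big_nil.
Qed.

End Products.
End Labels.

Section Labelling.
Context {n m : nat} (rel : 'I_m -> seq 'I_n) (inv : 'I_n -> 'I_n).
Hypothesis rel_inv : forall x, exists i, rel i = [:: x; inv x].
Context (p : nat) (p_pr : prime p).
Context {gT : finGroupType} (b : 'I_n -> gT) (qb : p_quotient rel p b).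
Context {r : nat} (phi : 'I_r.+1 -> gT -> 'F_p) (F : 'I_r.+1 -> 'I_n * gT -> 'F_p).
Context (g : 'I_r.+1 -> gT) (tr : translations rel b phi F g).
Context {H : groupType}.

(** The labels are the coboundary of lab on the support of F ord0 and trivial
    elsewhere: their product along a relator, which meets only one kind of support,
    is trivial. On the graph of pieces they define the homomorphism from the
    fundamental group to H that is trivial on T and takes the value lab v on the
    edge of v. *)
Lemma labels_onto (lab : gT -> H) (T : {set gT}) : class_fun b F lab ->
  {in T, forall t, lab t = 1%g} -> spanning b F T ->
  exists L : 'I_n * gT -> H, (forall i v, lprod b L v (rel i) = 1%g) /\
    forall v, loop_value b L (lab v).
Proof.
move=> clab labT sT.
pose L e : H := if F ord0 e == 0 then 1%g else (lab e.2 * (lab (e.2 * b e.1))^-1)%g.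
have [_ gen relb] := qb.
have relL i v : lprod b L v (rel i) = 1%g.
  have [/existsP [e /andP [ein F0]]|/existsPn none] :=
      boolP [exists e, (e \in edges (reg b) v (rel i)) && (F ord0 e != 0)].
    rewrite (lprod_telescope (lab := lab)) ?relb ?mulg1 ?mulgV // => -[x u] uin.
    rewrite /L; case: eqP => //= F0u; rewrite clab ?mulgV // => k.
    apply/eqP; apply: contraT => Fk.
    have k0 : k = ord0 by apply: (tr_path tr uin ein Fk F0).
    by rewrite k0 F0u eqxx in Fk.
  have Leq e : e \in edges (reg b) v (rel i) -> L e = 1%g.
    by move=> ein; have := none e; rewrite ein /L /= negbK => ->.
  rewrite (lprod_telescope (lab := fun=> 1%g)) => [|e ein]; first by rewrite mulgV.
  by rewrite Leq // mulgV.
have LV := L_inv rel_inv relL.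
exists L; split=> //.
pose path P v := `[< exists2 w, wprod b w = v & P (lprod b L 1%g w) >].
(* Some path from 1 to v has label (lab v)^-1, resp. 1, up to the label of a loop. *)
pose A v := path (fun h => loop_value b L (h * lab v)%g) v.
pose B v := path (loop_value b L) v.
have stepE x v : (v * b x * b (inv x))%g = v.
  by rewrite -mulgA (b_inv rel_inv relb) mulg1.
have pathx P P' x v : (forall h, P h -> P' (h * L (x, v))%g) -> path P v -> path P' (v * b x)%g.
  move=> PP' /asboolP [w wv Pw]; apply/asboolP; exists (w ++ [:: x]).
    by rewrite wprod_cat wv /wprod big_seq1.
  by rewrite lprod_cat /= wv mul1g mulg1; apply: PP'.
have rB : right_inv b F B.
  move=> x v F0; have L1 : L (x, v) = 1%g by rewrite /L F0 eqxx.
  apply/idP/idP; last by apply: pathx => h; rewrite L1 mulg1.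
  rewrite -[X in _ -> B X](stepE x v); apply: pathx => h.
  by rewrite LV L1 invg1 mulg1.
have lA : left_inv b F A.
  move=> x v F0; have Llab : (L (x, v) * lab (v * b x) = lab v)%g.
    rewrite /L; case: eqP => [F00|_] /=; last by rewrite mulgKV.
    rewrite mul1g clab // => k; have [->//|k0] := eqVneq k ord0; exact: F0.
  apply/idP/idP; last by apply: pathx => h; rewrite -mulgA Llab.
  rewrite -[X in _ -> A X](stepE x v); apply: pathx => h.
  by rewrite stepE LV -Llab -!mulgA mulKg.
have AB : {in T, A =1 B}.
  by move=> t tT; rewrite /A /B labT //; congr path; apply/funext => h; rewrite mulg1.
have B1 : B 1%g.
  by apply/asboolP; exists [::]; [rewrite /wprod big_nil|apply: loop_value1].
move=> v; have [ABv A1v] := sT A B lA rB AB v.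
have [AB1 _] := sT A B lA rB AB 1%g.
have Av : A v by rewrite A1v AB1.
have Bv : B v by rewrite -ABv.
move/asboolP: Av => [w wv h1]; move/asboolP: Bv => [w' wv' h2].
have h3 := loop_value_div rel_inv relb relL (etrans wv (esym wv')).
rewrite -[lab v](mulKg (lprod b L 1 w)); apply: loop_valueM => //.
apply: (loop_valueV rel_inv relb relL).
rewrite -[lprod b L 1 w](mulgKV (lprod b L 1 w')).
exact: loop_valueM.
Qed.

(** The given elements are placed on distinct classes that avoid the spanning set. *)
Lemma labels_realise (xs : seq H) : (size xs <= r)%N ->
  exists L : 'I_n * gT -> H, (forall i v, lprod b L v (rel i) = 1%g) /\
    forall x, x \in xs -> loop_value b L x.
Proof.
move=> sx; have [T sT dec] := minimal_spanning qb tr.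
have sQ := leq_trans sx (card_free_roots p_pr qb tr dec).
pose Q := free_roots b F T; pose R := fingraph.root (fun v v' => still b F v v' || still b F v' v).
pose lab v : H := if R v \in Q then nth 1%g xs (index (R v) (enum Q)) else 1%g.
have clab : class_fun b F lab by move=> x v F0; rewrite /lab /R croot_class.
have labT : {in T, forall t, lab t = 1%g}.
  move=> t tT; rewrite /lab ifF //; apply/negP; rewrite inE => /andP [_ /forall_inP /(_ t tT)].
  by rewrite eqxx.
have [L [relL loopL]] := labels_onto clab labT sT.
exists L; split=> // x xin.
suff <- : lab (nth 1%g (enum Q) (index x xs)) = x by apply: loopL.
have ix : (index x xs < size (enum Q))%N.
  by rewrite -cardE; apply: leq_trans sQ; rewrite index_mem.
have : nth 1%g (enum Q) (index x xs) \in Q by rewrite -mem_enum mem_nth.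
rewrite /lab => vQ; have /eqP -> : R (nth 1%g (enum Q) (index x xs)) == nth 1%g (enum Q) (index x xs).
  by move: vQ; rewrite inE => /andP [].
by rewrite vQ index_uniq ?enum_uniq // nth_index.
Qed.

End Labelling.

Lemma labelled_quotient {n m : nat} (rel : 'I_m -> seq 'I_n) (inv : 'I_n -> 'I_n) p l
    (H : groupType) (xs : seq H) : prime p ->
  (forall x, exists i, rel i = [:: x; inv x]) ->
  rank_bound rel p l.+1 l ->
  exists (gT : finGroupType) (b : 'I_n -> gT) (L : 'I_n * gT -> H),
    [/\ p_quotient rel p b, forall i v, lprod b L v (rel i) = 1%g
      & forall x, x \in xs -> loop_value b L x].
Proof.
move=> p_pr rel_inv growth.
have [gT0 [b0 [qb0 [f sepf]]]] := separated_cocycles p_pr (size xs).+1 growth.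
have [gT [b [phi [F [g [qb tr]]]]]] := translations_exist p_pr qb0 sepf.
have [L [relL loopL]] := labels_realise rel_inv p_pr qb tr (leqnn (size xs)).
by exists gT, b, L.
Qed.

(** * Comparing the ranks of two sets with an action *)

Lemma dim_leq_inj {K : finFieldType} {I J : finType} (U : {vspace {ffun I -> K^o}})
    (W : {vspace {ffun J -> K^o}}) (h : {ffun I -> K^o} -> {ffun J -> K^o}) :
  {in U &, injective h} -> (forall u, u \in U -> h u \in W) -> (\dim U <= \dim W)%N.
Proof.
move=> h_inj hUW; rewrite -(leq_exp2l _ _ (finNzRing_gt1 K)) -!card_vspace.
rewrite -(card_in_imset h_inj); apply: subset_leq_card.
by apply/subsetP => _ /imsetP [u uU ->]; apply: hUW.
Qed.

Section Diagonal.
Context {n m : nat} (rel : 'I_m -> seq 'I_n) (p : nat) (p_pr : prime p).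
Context {gT : finGroupType} (b : 'I_n -> gT) (qb : p_quotient rel p b).
Context {Y : finType} (st : 'I_n -> Y -> Y) (pst : p_action rel p st).
Hypothesis factor : forall w w', wprod b w = wprod b w' ->
  forall y, run st y w = run st y w'.

Definition diag (x : 'I_n) (z : gT * Y) : gT * Y := ((z.1 * b x)%g, st x z.2).

Local Notation V := {ffun 'I_n * (gT * Y) -> ('F_p)^o}.
Local Notation M := (cocycles rel 'F_p diag).

Definition deck_fun (g : gT) (f : V) : V := [ffun e => f (e.1, ((g^-1 * e.2.1)%g, e.2.2))].

Fact deck_linear g : linear (deck_fun g).
Proof. by move=> a f h; apply/ffunP=> e; rewrite !ffunE. Qed.
HB.instance Definition _ g := GRing.isLinear.Build 'F_p V V _ _ (deck_linear g).

Definition deck g : 'End(V) := linfun (deck_fun g).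

Lemma deckE g f e : deck g f e = f (e.1, ((g^-1 * e.2.1)%g, e.2.2)).
Proof. by rewrite lfunE ffunE. Qed.

Lemma deck1 f : deck 1%g f = f.
Proof. by apply/ffunP=> -[x [v y]]; rewrite deckE /= invg1 mul1g. Qed.

Lemma deckM g h f : deck (g * h)%g f = deck g (deck h f).
Proof. by apply/ffunP=> -[x [v y]]; rewrite !deckE /= invMg mulgA. Qed.

Lemma deck_cocycle g f : f \in M -> deck g f \in M.
Proof.
move=> /cocyclesP cf; apply/cocyclesP => i z.
rewrite -[RHS](cf i ((g^-1 * z.1)%g, z.2)).
rewrite (@relsum_map _ _ _ _ diag diag (fun z => ((g^-1 * z.1)%g, z.2)) _ z).
  by apply: eq_bigr => e _; rewrite deckE.
by move=> x u; rewrite /diag /= mulgA.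
Qed.

(** The p-group gT acts on the cocycles of gT x Y by deck transformations of the
    projection to Y, and its invariants are the cocycles of Y. *)
Lemma rank_diag_le : (rank rel p diag <= #|gT| * rank rel p st)%N.
Proof.
have [pG _ _] := qb.
have := dim_invariants (pchar_Fp p_pr) deck1 deckM (Q := [set: gT]%G) (U := M) pG.
rewrite cardsT => /(_ _) le; apply: leq_trans (le _) _.
  by move=> g _; apply/subvP => _ /memv_imgP [f cf ->]; apply: deck_cocycle.
rewrite leq_mul2l; apply/orP; right.
pose R (f : V) : {ffun 'I_n * Y -> ('F_p)^o} := [ffun e => f (e.1, (1%g, e.2))].
have RE (k : V) : (forall g, g \in [set: gT] -> deck g k = k) ->
    forall x v y, k (x, (v, y)) = R k (x, y).
  move=> ki x v y; have /ffunP /(_ (x, (v, y))) := ki v (in_setT v).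
  by rewrite deckE /= mulVg ffunE.
have R_inj : {in invariants deck M [set: gT] &, injective R}.
  move=> f h /invariantsP [_ fi] /invariantsP [_ hi] fh; apply/ffunP=> -[x [v y]].
  by rewrite (RE f fi) (RE h hi) fh.
apply: (dim_leq_inj R_inj) => f /invariantsP [/cocyclesP cf fi].
apply/cocyclesP => i y.
rewrite -[RHS](cf i (1%g, y)).
rewrite -[y in LHS]/((fun z : gT * Y => z.2) (1%g, y)).
rewrite (relsum_map (st := diag)) //.
by apply: eq_bigr => -[x [v u]] _ /=; rewrite (RE f fi).
Qed.

(** The action of the letters on Y factors through gT, so that gT x Y is a disjoint
    union of copies of gT: the level sets of (v, y) |-> y v^-1. *)
Lemma rank_diag_ge : (#|Y| * rank rel p (reg b) <= rank rel p diag)%N.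
Proof.
have [_ gen _] := qb.
have [wd wdP] := choice gen.
pose k (z : gT * Y) := run st z.2 (wd z.1^-1%g).
have kst x z : k (diag x z) = k z.
  rewrite /k /diag /=; apply: (factor (w := x :: wd _)).
  by rewrite -cat1s wprod_cat !wdP /wprod big_seq1 invMg mulKVg.
pose G (f : {ffun Y -> {ffun 'I_n * gT -> ('F_p)^o}}) : V :=
  [ffun e => f (k e.2) (e.1, e.2.1)].
have Gc (f : {ffun Y -> {ffun 'I_n * gT -> ('F_p)^o}}) :
    (forall y, f y \in cocycles rel 'F_p (reg b)) -> G f \in M.
  move=> cf; apply/cocyclesP => i z.
  have /cocyclesP /(_ i z.1) := cf (k z).
  rewrite -[z.1]/((fun z : gT * Y => z.1) z) (relsum_map (st := diag)) //.
  move=> <-; rewrite /relsum.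
  suff : {in edges diag z (rel i), forall e, k e.2 = k z}.
    move=> kE; apply: eq_big_seq => -[x u] ein; rewrite ffunE /=.
    by have := kE _ ein => /= ->.
  elim: (rel i) z => //= x w IH z e; rewrite inE => /orP [/eqP -> //|ein].
  by rewrite (IH _ _ ein) kst.
have G_inj : injective G.
  move=> f h fh; apply/ffunP=> y; apply/ffunP=> -[x v].
  have ky : k (v, run st y (wd v)) = y.
    rewrite /k /= -run_cat -[RHS]/(run st y [::]); apply: factor.
    by rewrite wprod_cat !wdP mulgV /wprod big_nil.
  have /ffunP /(_ (x, (v, run st y (wd v)))) := fh.
  by rewrite !ffunE /= ky.
pose Z0 := cocycles rel 'F_p (reg b).
have := card_ffun_on Y (mem Z0).
rewrite (card_vspace Z0) -expnM; set c := (X in X = _) => cE.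
have : (c <= #|M|)%N.
  rewrite /c -(card_imset _ G_inj); apply: subset_leq_card.
  by apply/subsetP => _ /imsetP [f /ffun_onP cf ->]; apply: Gc.
rewrite cE card_vspace leq_exp2l ?finNzRing_gt1 // mulnC; exact.
Qed.

Lemma rank_ratio : (#|Y| * rank rel p (reg b) <= #|gT| * rank rel p st)%N.
Proof. exact: leq_trans rank_diag_ge rank_diag_le. Qed.

End Diagonal.

Local Open Scope classical_set_scope.
Local Open Scope group_scope.

(** * Finitely presented groups and their actions *)

Lemma mul_morph1 (F G : groupType) (f : F -> G) : {morph f : x y / x * y} -> f 1 = 1.
Proof. by move=> fM; apply: (mulIg (f 1)); rewrite -fM !mul1g. Qed.

Lemma mul_morphV (F G : groupType) (f : F -> G) : {morph f : x y / x * y} ->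
  {morph f : x / x^-1}.
Proof.
by move=> fM x; apply: (mulgI (f x)); rewrite -fM !mulgV (mul_morph1 fM).
Qed.

(** The freeness of F is only about homomorphisms to groups: a subgroup has to be
    made into a group of its own. *)
Record subgroup_type {F : groupType} (A : set F) (sA : is_subgroup A) :=
  SubgroupElt { subgroup_val : F; _ : `[< A subgroup_val >] }.

Section SubgroupType.
Context {F : groupType} (A : set F) (sA : is_subgroup A).
HB.instance Definition _ := [isSub for @subgroup_val F A sA].
HB.instance Definition _ := [Choice of subgroup_type sA by <:].

Fact subgroup_closed : group_closed (fun x => `[< A x >]).
Proof.
have [A1 AB] := sA; split; first exact/asboolP.
by move=> x y /asboolP Ax /asboolP Ay; apply/asboolP/AB.
Qed.
HB.instance Definition _ :=
  SubChoice_isSubGroup.Build F _ (subgroup_type sA) subgroup_closed.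
End SubgroupType.

(** The identity of F factors through any subgroup that contains X. *)
Lemma free_generation (F : groupType) (X A : set F) : free_on X -> is_subgroup A ->
  X `<=` A -> forall f, A f.
Proof.
move=> freeX sA XA.
pose H : groupType := subgroup_type sA.
have AX x : X x -> `[< A x >] by move=> /XA /asboolP.
pose f0 x : H := if pselect (X x) is left Xx then SubgroupElt sA (AX x Xx) else 1.
have [phi [[phiM phiX] _]] := freeX H f0.
have [psi [_ uniq_psi]] := freeX F id.
have e1 : psi = id by apply: uniq_psi; split.
have e2 : psi = (fun f => subgroup_val (phi f)).
  apply: uniq_psi; split=> [x y|x Xx]; first by rewrite phiM.
  by rewrite phiX // /f0; case: pselect.
move=> f; have -> : f = subgroup_val (phi f) by rewrite -[LHS]/(id f) -e1 e2.
by case: (phi f) => g /= /asboolP.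
Qed.

(** The group acts on Y from the right: permutations compose from left to right. *)
Record permutation (Y : Type) := Permutation {
  perm_fun : Y -> Y; perm_inv : Y -> Y;
  perm_funK : cancel perm_fun perm_inv; perm_invK : cancel perm_inv perm_fun }.

Section PermutationGroup.
Context {Y : Type}.
HB.instance Definition _ := gen_eqMixin (permutation Y).
HB.instance Definition _ := gen_choiceMixin (permutation Y).

Lemma permutationP (s t : permutation Y) : perm_fun s =1 perm_fun t -> s = t.
Proof.
case: s t => [f f' fK f'K] [g g' gK g'K] /= /funext fg; subst g.
have e : f' = g' by apply/funext => y; rewrite -{1}(g'K y) fK.
by subst g'; congr Permutation; apply: Prop_irrelevance.
Qed.

Definition perm_one := @Permutation Y id id (fun _ => erefl) (fun _ => erefl).
Definition perm_opp (s : permutation Y) := Permutation (perm_invK s) (perm_funK s).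
Definition perm_comp (s t : permutation Y) :=
  Permutation (can_comp (perm_funK t) (perm_funK s))
              (can_comp (perm_invK s) (perm_invK t)).

Fact perm_compA : associative perm_comp. Proof. by move=> s t u; apply: permutationP. Qed.
Fact perm_comp1 : left_id perm_one perm_comp. Proof. by move=> s; apply: permutationP. Qed.
Fact perm_1comp : right_id perm_one perm_comp. Proof. by move=> s; apply: permutationP. Qed.
Fact perm_compV : left_inverse perm_one perm_opp perm_comp.
Proof. by move=> s; apply: permutationP => y /=; rewrite perm_invK. Qed.
Fact perm_Vcomp : right_inverse perm_one perm_opp perm_comp.
Proof. by move=> s; apply: permutationP => y /=; rewrite perm_funK. Qed.
HB.instance Definition _ := isGroup.Build (permutation Y)
  perm_compA perm_comp1 perm_1comp perm_compV perm_Vcomp.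
End PermutationGroup.

Definition gword {n} {G : groupType} (a : 'I_n -> G) (w : seq 'I_n) : G :=
  foldr (fun x g => a x * g) 1 w.

Lemma gword_cat n (G : groupType) (a : 'I_n -> G) w w' :
  gword a (w ++ w') = gword a w * gword a w'.
Proof. by elim: w => [|x w IH] /=; rewrite ?mul1g // IH mulgA. Qed.

Lemma gword_morph n (F G : groupType) (a : 'I_n -> F) (f : F -> G) w :
  {morph f : x y / x * y} -> f (gword a w) = gword (fun x => f (a x)) w.
Proof.
by move=> fM; elim: w => [|x w IH] /=; rewrite ?(mul_morph1 fM) // fM IH.
Qed.

Section Presentation.
Context {F G : groupType} (xs ss : seq F) (pi : F -> G).
Hypothesis freeX : free_on [set` xs].
Hypothesis uniq_xs : uniq xs.
Hypothesis piM : {morph pi : x y / x * y}.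
Hypothesis pi_onto : range pi = [set: G].
Hypothesis pi_ker : pi @^-1` [set 1] = normal_closure [set` ss].
Local Notation r := (size xs).
Local Notation n := (r + r)%N.

Definition letter (i : 'I_n) : F :=
  match split i with inl j => tnth (in_tuple xs) j | inr j => (tnth (in_tuple xs) j)^-1 end.

Definition inv_letter (i : 'I_n) : 'I_n :=
  match split i with inl j => rshift r j | inr j => lshift r j end.

Lemma split_lshift (j : 'I_r) : split (lshift r j) = inl j.
Proof. exact: (unsplitK (inl j)). Qed.

Lemma split_rshift (j : 'I_r) : split (rshift r j) = inr j.
Proof. exact: (unsplitK (inr j)). Qed.

Lemma letter_inv i : letter (inv_letter i) = (letter i)^-1.
Proof.
rewrite /letter /inv_letter; case: (split i) => j.
  by rewrite split_rshift.
by rewrite split_lshift invgK.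
Qed.

Lemma inv_letterK : involutive inv_letter.
Proof.
move=> i; rewrite -[i in RHS]splitK /inv_letter; case: (split i) => j.
  by rewrite split_rshift.
by rewrite split_lshift.
Qed.

Lemma gword_inv w : gword letter (rev (map inv_letter w)) = (gword letter w)^-1.
Proof.
elim: w => [|x w IH] /=; first by rewrite invg1.
by rewrite rev_cons -cats1 gword_cat IH /= mulg1 letter_inv invMg.
Qed.

Lemma letters_generate f : exists w, gword letter w = f.
Proof.
apply: (free_generation (A := [set f | exists w, gword letter w = f]) freeX).
  split; first by exists [::].
  move=> x y [w <-] [w' <-]; exists (w ++ rev (map inv_letter w')).
  by rewrite gword_cat gword_inv.
move=> x /= xin; have /tnthP [j ->] : x \in in_tuple xs by [].
by exists [:: lshift r j]; rewrite /= mulg1 /letter split_lshift.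
Qed.

(** The inverses of the generators are letters of their own, subject to the relators
    x x^-1, so that all relators are positive words. The universal property holds
    for actions on any set Y because the permutations of Y form a group. *)
Lemma positive_presentation : exists m (rel : 'I_m -> seq 'I_n),
  [/\ forall x, exists i, rel i = [:: x; inv_letter x],
      forall i, gword (pi \o letter) (rel i) = 1
    & forall (Y : Type) (st : 'I_n -> Y -> Y), is_action rel st ->
      exists act : Y -> G -> Y, (forall y g h, act y (g * h) = act (act y g) h) /\
        forall y w, act y (gword (pi \o letter) w) = run st y w].
Proof.
have [wd wdP] := choice letters_generate.
pose rels := [seq wd s | s <- ss] ++ [seq [:: x; inv_letter x] | x <- enum 'I_n].
have piS s : s \in ss -> pi s = 1.
  move=> sin; suff : (pi @^-1` [set 1]) s by [].
  by rewrite pi_ker => A [_ sA]; apply: sA.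
have pig w : gword (pi \o letter) w = pi (gword letter w) by rewrite (gword_morph _ w piM).
exists (size rels), (fun i => tnth (in_tuple rels) i); split.
- move=> x; have /tnthP [i iE] : [:: x; inv_letter x] \in in_tuple rels.
    by rewrite mem_cat; apply/orP; right; apply: map_f; rewrite mem_enum.
  by exists i; rewrite -iE.
- move=> i; have := mem_tnth i (in_tuple rels); rewrite mem_cat pig.
  case/orP => /mapP [x xin ->]; first by rewrite wdP piS.
  by rewrite /= mulg1 letter_inv mulgV (mul_morph1 piM).
move=> Y st ast.
have run_rel w y : w \in rels -> run st y w = y.
  by move=> /(tnthP (in_tuple rels)) [i ->]; apply: ast.
have stK x : cancel (st x) (st (inv_letter x)).
  move=> y; apply: (run_rel [:: x; inv_letter x]).
  by rewrite mem_cat; apply/orP; right; apply: map_f; rewrite mem_enum.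
have stK' x : cancel (st (inv_letter x)) (st x).
  by move=> y; rewrite -{1}(inv_letterK x) stK.
pose s x : permutation Y := Permutation (stK x) (stK' x).
pose f0 f : permutation Y := if [pick j | tnth (in_tuple xs) j == f] is Some j
   then s (lshift r j) else 1.
have [phi [[phiM phiX] _]] := freeX f0.
have phi1 := mul_morph1 phiM; have phiV := mul_morphV phiM.
have phil j : phi (tnth (in_tuple xs) j) = s (lshift r j).
  rewrite phiX; last by rewrite /= mem_tnth.
  rewrite /f0; case: pickP => [j' /eqP|/(_ j)]; last by rewrite eqxx.
  by move=> /(tuple_uniqP (in_tuple xs) uniq_xs) ->.
have phiL x : phi (letter x) = s x.
  rewrite -[x]splitK /letter; case: (split x) => j /=.
    by rewrite split_lshift phil.
  rewrite split_rshift phiV phil; apply: permutationP => y /=.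
  by rewrite /inv_letter split_lshift.
have phiw w y : perm_fun (phi (gword letter w)) y = run st y w.
  elim: w y => [|x w IH] y /=; first by rewrite phi1.
  by rewrite phiM phiL /= IH.
have phi_ker f : pi f = 1 -> phi f = 1.
  move=> f1; have : (pi @^-1` [set 1]) f by [].
  rewrite pi_ker => /(_ [set f' | phi f' = 1]); apply; split.
    split; first split=> // x y /= x1 y1; first by rewrite phiM phiV x1 y1 mulgV.
    by move=> x g /= x1; rewrite conjgE !phiM x1 phiV ?mul1g ?mulg1 mulVg.
  move=> t tin /=; rewrite -(wdP t); apply: permutationP => y; rewrite phiw.
  by apply: run_rel; rewrite mem_cat map_f.
have ex g : exists f, pi f = g.
  have : [set: G] g by [].
  by rewrite -pi_onto => -[f _ <-]; exists f.
have [sec secP] := choice ex.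
have phiE f f' : pi f = pi f' -> phi f = phi f'.
  move=> ff; apply: (mulIg (phi f')^-1); rewrite mulgV -phiV -phiM.
  by apply: phi_ker; rewrite piM (mul_morphV piM) ff mulgV.
exists (fun y g => perm_fun (phi (sec g)) y); split=> [y g h|y w].
  by rewrite (phiE (sec (g * h)) (sec g * sec h)) ?phiM // piM !secP.
by rewrite (phiE _ (gword letter w)) ?phiw // secP pig.
Qed.

(** A cocycle on a point is a homomorphism, determined by its values on generators. *)
Lemma rank_point m (rel : 'I_m -> seq 'I_n) p : prime p ->
  (forall x, exists i, rel i = [:: x; inv_letter x]) ->
  (rank rel p (fun _ (u : unit) => u) <= r)%N.
Proof.
move=> p_pr rel_inv.
rewrite -[X in (_ <= X)%N](card_ord r) -(dim_ffun 'F_p 'I_r).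
pose h (f : {ffun 'I_n * unit -> ('F_p)^o}) : {ffun 'I_r -> ('F_p)^o} :=
  [ffun j => f (lshift r j, tt)].
apply: (dim_leq_inj (h := h)) => [f k cf ck fk|f _]; last exact: memvf.
have El (f' : {ffun 'I_n * unit -> ('F_p)^o}) : f' \in cocycles rel 'F_p (fun _ u => u) ->
    forall j, f' (rshift r j, tt) = (- f' (lshift r j, tt))%R.
  move=> /cocyclesP cf' j; have [i iE] := rel_inv (lshift r j).
  have := cf' i tt; rewrite iE !relsum_cons relsum_nil addr0 /inv_letter split_lshift.
  by move=> /eqP; rewrite addrC addr_eq0 => /eqP.
apply/ffunP=> -[x []]; rewrite -[x]splitK; case: (split x) => j /=.
  by have /ffunP /(_ j) := fk; rewrite !ffunE.
by rewrite !El //; have /ffunP /(_ j) := fk; rewrite !ffunE => ->.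
Qed.

End Presentation.

(** Two free generators can be sent to transpositions of three points that do not
    commute. *)
Lemma free_nonabelian (F : groupType) (xs : seq F) : free_on [set` xs] -> uniq xs ->
  (1 < size xs)%N -> ~ is_abelian F.
Proof.
case: xs => [|x [|y xs]] // freeX /= /andP [xy _] _ ab.
have {}xy : x != y by apply: contraNneq xy => ->; rewrite mem_head.
pose i0 : 'I_3 := Ordinal (isT : 0 < 3)%N; pose i1 : 'I_3 := Ordinal (isT : 1 < 3)%N.
pose i2 : 'I_3 := Ordinal (isT : 2 < 3)%N.
have [phi [[phiM phiX] _]] := freeX {perm 'I_3}
  (fun f => if f == x then tperm i0 i1 else tperm i1 i2).
have px : phi x = tperm i0 i1 by rewrite phiX ?eqxx //= mem_head.
have py : phi y = tperm i1 i2.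
  by rewrite phiX ?[y == x]eq_sym ?(negPf xy) //= !inE eqxx orbT.
have := congr1 phi (ab x y); rewrite !phiM px py => /permP /(_ i0).
by rewrite !permM !tpermL (@tpermD _ i1 i2) // tpermL.
Qed.

(** * The lower central p-series *)

Section Subgroups.
Context {G : groupType}.
Implicit Types A B N : set G.

Lemma generated_subgroup A : is_subgroup (Defs.generated A).
Proof.
split; first by move=> B [[B1 _] _].
move=> x y Ax Ay B BA; have [[_ BB] _] := BA.
by apply: BB; [apply: Ax | apply: Ay].
Qed.

Lemma sub_generated A : A `<=` Defs.generated A.
Proof. by move=> x Ax B [_]; apply. Qed.

Lemma generated_sub A B : is_subgroup B -> A `<=` B -> Defs.generated A `<=` B.
Proof. by move=> sB AB x; apply. Qed.

Lemma subgroupV N x : is_subgroup N -> N x -> N x^-1.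
Proof. by move=> [N1 NB] Nx; rewrite -[x^-1]div1g; apply: NB. Qed.

Lemma subgroupM N x y : is_subgroup N -> N x -> N y -> N (x * y).
Proof.
move=> sN Nx Ny; rewrite -[y]invgK; apply: sN.2 => //; exact: subgroupV.
Qed.

Lemma subgroupX N x k : is_subgroup N -> N x -> N (x ^+ k).
Proof.
move=> sN Nx; elim: k => [|k IH]; first by rewrite expg0; apply: sN.1.
by rewrite expgS; apply: subgroupM.
Qed.

Lemma generated_normal A : (forall x g, A x -> A (x ^ g)) -> is_normal (Defs.generated A).
Proof.
move=> AJ; split; first exact: generated_subgroup.
move=> x g; apply: (generated_sub (B := [set y | Defs.generated A (y ^ g)])).
  have [A1 AB] := generated_subgroup A; split; first by rewrite /= conj1g.
  by move=> y z /= Ay Az; rewrite conjMg conjVg; apply: AB.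
by move=> y Ay /=; apply: sub_generated; apply: AJ.
Qed.

Lemma product_normal A B : is_normal A -> is_normal B ->
  is_normal [set x * y | x in A & y in B].
Proof.
move=> [sA AJ] [sB BJ]; split; first split.
- by exists 1; [exact: sA.1|exists 1; [exact: sB.1|rewrite mulg1]].
- move=> _ _ [x Ax [y By <-]] [x' Ax' [y' By' <-]].
  exists (x * (x'^-1 ^ (y * y'^-1)^-1)).
    by apply: subgroupM => //; by apply: AJ; apply: subgroupV.
  exists (y * y'^-1); first by apply: subgroupM => //; apply: subgroupV.
  by set z := y * y'^-1; rewrite conjgE invgK -!mulgA mulVg mulg1 /z invMg ?mulgA.
- move=> _ g [x Ax [y By <-]]; exists (x ^ g); first exact: AJ.
  by exists (y ^ g); [exact: BJ | rewrite conjMg].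
Qed.

Context (p : nat).
Local Notation N := (lower_central_p G p).

Lemma lcp_normal i : is_normal (N i).
Proof.
elim: i => [|i IH]; first by split; [split|].
apply: product_normal; apply: generated_normal.
  move=> _ g [x Nx [y _ <-]]; exists (x ^ g); first exact: IH.2.
  by exists (y ^ g) => //; rewrite conjRg.
by move=> _ g [x Nx <-]; exists (x ^ g); [exact: IH.2 | rewrite conjXg].
Qed.

Lemma lcp_sub i : N i.+1 `<=` N i.
Proof.
have [sN NJ] := lcp_normal i.
move=> _ [x Ax [y By <-]]; apply: subgroupM => //.
  apply: (generated_sub sN _ Ax) => _ [z Nz [u _ <-]].
  by rewrite commgEl; apply: subgroupM => //; [apply: subgroupV | apply: NJ].
by apply: (generated_sub sN _ By) => _ [z Nz <-]; apply: subgroupX.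
Qed.

Lemma lcp_mono i j : (i <= j)%N -> N j `<=` N i.
Proof.
move=> /subnK <-; elim: (j - i)%N => // k IH; rewrite addSn.
by move=> x /lcp_sub; apply: IH.
Qed.

Lemma lcp_expg i x : N i x -> N i.+1 (x ^+ p).
Proof.
move=> Nx; exists 1; first exact: (generated_subgroup _).1.
by exists (x ^+ p); [apply: sub_generated; exists x | rewrite mul1g].
Qed.

Lemma lcp_exp i x : N i (x ^+ (p ^ i)).
Proof.
elim: i => [|i IH] //; rewrite expnSr expgM.
exact: lcp_expg.
Qed.

(** A homomorphism to a finite p-group kills some term of the series: modulo a
    central subgroup of order p by induction, and one term further there. *)
Lemma lcp_killed (gT : finGroupType) (f : G -> gT) : prime p ->
  p.-group (finset.setTfor gT) -> {morph f : x y / x * y} ->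
  exists i, forall x, N i x -> f x = 1.
Proof.
move=> p_pr; have [k] := ubnP #|gT|; elim: k gT f => // k IH gT f gTk pG fM.
have f1 := mul_morph1 fM; have fV := mul_morphV fM.
have fX x j : f (x ^+ j) = f x ^+ j.
  by elim: j => [|j IHj]; rewrite ?expg0 // !expgS fM IHj.
have [G1|ntG] := eqVneq (finset.setTfor gT) 1%g.
  by exists 0%N => x _; apply/set1P; rewrite -[_ 1]G1 inE.
have [gT' [h [hM pG' ltk hker]]] := p_group_quotient p_pr pG ntG.
have [i iP] := IH gT' (h \o f) (leq_trans ltk gTk) pG' (fun x y => etrans (congr1 h (fM x y)) (hM _ _)).
have sK : is_subgroup [set x | f x = 1].
  by split=> // x y /= x1 y1; rewrite fM fV x1 y1 mulgV.
exists i.+1 => _ [x Ax [y By <-]]; rewrite fM.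
rewrite (generated_sub sK _ Ax) => [|_ [u Nu [v _ <-]] /=]; last first.
  have [_ uc] := hker _ (iP u Nu).
  by rewrite commgEl conjgE !fM !fV (uc (f v)) mulKg mulVg.
rewrite (generated_sub sK _ By) ?mulg1 // => _ [u Nu <-] /=.
by rewrite fX (hker _ (iP u Nu)).1.
Qed.

End Subgroups.

(** * Finite quotients by normal subgroups *)

Section CosetQuotient.
Context {G : groupType} {n m : nat} (rel : 'I_m -> seq 'I_n) (a : 'I_n -> G).
Hypothesis rel1 : forall i, gword a (rel i) = 1.
Context (p : nat) (p_pr : prime p) (N : set G).
Hypothesis normN : is_normal N.
Hypothesis finN : finite_index N.
Hypothesis expN : exists k, forall x, N (x ^+ (p ^ k)).

Definition coset_fset := fset_set (left_cosets N).

Definition left_coset (g : G) : set G := [set g * h | h in N].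

Lemma left_cosetP (C : coset_fset) : exists g, val C = left_coset g.
Proof.
have : val C \in coset_fset by apply: valP.
rewrite in_fset_set // => /set_mem [g _ <-]; by exists g.
Qed.

Lemma left_coset_fset g : left_coset g \in coset_fset.
Proof. by rewrite in_fset_set //; apply/mem_set; exists g. Qed.

Lemma left_coset_eq g h : left_coset g = left_coset h <-> N (g^-1 * h).
Proof.
have [sN _] := normN; split=> [E|Ngh].
  have : left_coset h h by exists 1; rewrite ?mulg1 //; apply: sN.1.
  by rewrite -E => -[x Nx <-]; rewrite mulKg.
apply/seteqP; split=> _ [x Nx <-].
  exists (h^-1 * g * x); last by rewrite -!mulgA mulKVg.
  apply: subgroupM => //; rewrite -[h^-1 * g]invgK; apply: subgroupV => //.
  by rewrite invMg invgK.
exists (g^-1 * h * x); last by rewrite -!mulgA mulKVg.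
exact: subgroupM.
Qed.

Definition coset_step (x : 'I_n) (C : coset_fset) : coset_fset :=
  insubd C [set c * a x | c in val C].

Lemma coset_stepE x (C : coset_fset) g : val C = left_coset g ->
  val (coset_step x C) = left_coset (g * a x).
Proof.
have [sN NJ] := normN.
move=> CE; rewrite /coset_step CE.
have -> : [set c * a x | c in left_coset g] = left_coset (g * a x).
  apply/seteqP; split=> y.
    move=> [_ [h Nh <-] <-]; exists (h ^ a x); first exact: NJ.
    by rewrite conjgE !mulgA mulgK.
  move=> [h Nh <-]; exists (g * (h ^ (a x)^-1)).
    by exists (h ^ (a x)^-1) => //; apply: NJ.
  by rewrite conjgE invgK -!mulgA mulVg mulg1.
by rewrite insubdK // left_coset_fset.
Qed.

Lemma coset_runE w (C : coset_fset) g : val C = left_coset g ->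
  val (run coset_step C w) = left_coset (g * gword a w).
Proof.
elim: w C g => [|x w IH] C g CE /=; first by rewrite mulg1.
by rewrite (IH _ (g * a x)) ?mulgA //; apply: coset_stepE.
Qed.

Lemma gword_repw k w : gword a (repw k w) = gword a w ^+ k.
Proof. by elim: k => // k IH; rewrite /repw /= gword_cat expgS -IH. Qed.

(** The group of permutations of the left cosets of N; N acts trivially, being
    normal, so that the group is no larger than the set. *)
Lemma coset_quotient : exists (gT : finGroupType) (b : 'I_n -> gT),
  [/\ p_quotient rel p b, (#|gT| <= subgroup_index N)%N
    & forall w, wprod b w = 1 <-> N (gword a w)].
Proof.
have [sN NJ] := normN.
have pst : p_action rel p coset_step.
  split=> [i C|w].
    have [g CE] := left_cosetP C; apply: val_inj.
    by rewrite (coset_runE _ CE) rel1 mulg1.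
  have [k Nk] := expN; exists k => C; have [g CE] := left_cosetP C.
  apply: val_inj; rewrite -run_repw (coset_runE _ CE) gword_repw CE.
  by apply/esym/left_coset_eq; rewrite mulKg.
have [gT [b [act [qb actw faith]]]] := reg_cover p_pr pst.
have ker w : wprod b w = 1 <-> N (gword a w).
  split=> [w1|Nw].
    pose C1 : coset_fset := [` left_coset_fset 1]%fset.
    have := actw C1 w; rewrite w1 -[1](_ : wprod b [::] = 1) ?actw /=; last by rewrite /wprod big_nil.
    move=> /(congr1 val); rewrite (coset_runE w (g := 1)) //= mul1g.
    by move=> /left_coset_eq; rewrite invg1 mul1g.
  apply: faith => C; have [g CE] := left_cosetP C.
  have -> : (1 : gT) = wprod b [::] by rewrite /wprod big_nil.
  rewrite !actw; apply: val_inj; rewrite (coset_runE _ CE) [RHS]CE.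
  by apply/esym/left_coset_eq; rewrite mulKg.
exists gT, b; split=> //.
have [_ genb _] := qb.
pose C1 : coset_fset := [` left_coset_fset 1]%fset.
have inj : injective (act C1).
  move=> v v'; have [w <-] := genb v; have [w' <-] := genb v'.
  have [u uE] := genb (wprod b w)^-1.
  rewrite !actw => /(congr1 val); rewrite !(coset_runE _ (g := 1)) // !mul1g.
  move=> /left_coset_eq Nw.
  have Nu : N (gword a w * gword a u).
    by rewrite -gword_cat; apply/ker; rewrite wprod_cat uE mulgV.
  apply/esym; apply: (mulgI (wprod b w)^-1); rewrite mulVg -uE -wprod_cat; apply/ker.
  rewrite gword_cat.
  have -> : gword a u * gword a w' =
     ((gword a w * gword a u) ^ gword a w) * ((gword a w)^-1 * gword a w').
    by rewrite conjgE -!mulgA mulKVg mulKg.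
  by apply: subgroupM => //; apply: NJ.
have := leq_card _ inj; rewrite -cardfE; exact.
Qed.

End CosetQuotient.

(** * Homomorphisms to F_p on a subgroup *)

Section Homology.
Import freeg.
Context {G : groupType} (p : nat) (p_pr : prime p) (N : set G).
Hypothesis sN : is_subgroup N.
Local Open Scope ring_scope.
Local Notation Z := (bar_chains1 p N).
Local Notation B := (bar_boundary2 p @` bar_chains2 p N).

Definition bar_edge (g : G * G) : {freeg G / 'F_p} :=
  << g.2 >> - << (g.1 * g.2)%g >> + << g.1 >>.

Lemma bar_boundary2E c : bar_boundary2 p c = fglift bar_edge c.
Proof. by rewrite -[in RHS](Freeg_dom c) fglift_Freeg /prelift big_map. Qed.

Lemma bar_boundary2B (c d : {freeg (G * G)%type / 'F_p}) :
  bar_boundary2 p (c - d) = bar_boundary2 p c - bar_boundary2 p d.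
Proof. by rewrite !bar_boundary2E; apply: lift_is_additive. Qed.

Lemma boundaries0 : B 0.
Proof.
exists 0; first by move=> g; rewrite dom0.
by rewrite -[0 in LHS](subrr 0) bar_boundary2B subrr.
Qed.

Lemma boundariesB x y : B x -> B y -> B (x - y).
Proof.
move=> [c cZ <-] [d dZ <-]; exists (c - d); last exact: bar_boundary2B.
move=> g /domB; rewrite mem_cat => /orP []; [exact: cZ | exact: dZ].
Qed.

Lemma boundariesD x y : B x -> B y -> B (x + y).
Proof.
move=> Bx By; rewrite -[y]opprK -[- y]sub0r; apply: boundariesB => //.
by apply: boundariesB => //; apply: boundaries0.
Qed.

Lemma boundariesMn x k : B x -> B (x *+ k).
Proof.
by move=> Bx; elim: k => [|k IH]; rewrite ?mulr0n ?mulrS; [exact: boundaries0 | exact: boundariesD].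
Qed.

Lemma boundariesZ a x : B x -> B (a *: x).
Proof. by move=> Bx; rewrite -[a]natr_Zp scaler_nat; apply: boundariesMn. Qed.

Lemma chains1_gen g : N g -> Z << g >>.
Proof. by move=> Ng h; rewrite domU1 inE => /eqP ->. Qed.

(** The coordinates of the classes of the chains [x] in a basis of H_1: they are
    additive because the boundary of [x | y] is [y] - [x y] + [x]. Positivity of
    dim_H1 makes sure that a basis exists. *)
Lemma homs_of_H1 : (0 < dim_H1 p N)%N ->
  exists al : 'I_(dim_H1 p N) -> G -> 'F_p,
    (forall k x y, N x -> N y -> al k (x * y)%g = al k x + al k y) /\
    (forall c : 'I_(dim_H1 p N) -> 'F_p,
       (forall x, N x -> \sum_k c k * al k x = 0) -> forall k, c k = 0).
Proof.
move=> dpos.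
have [e [eZ eB]] : exists e : 'I_(dim_H1 p N) -> {freeg G / 'F_p}, is_quotient_basis Z B e.
  rewrite /dim_H1 /quotient_dim.
  have [ex|nex] := pselect (exists k, [set k : nat | exists e : 'I_k -> {freeg G / 'F_p},
      is_quotient_basis Z B e] k).
    exact: xgetPex ex.
  by move: dpos; rewrite /dim_H1 /quotient_dim xgetPN // => k Pk; apply: nex; exists k.
move: (dim_H1 p N) e eZ eB {dpos} => d e eZ eB.
have ex z : exists c : {ffun 'I_d -> 'F_p}, Z z -> B (z - \sum_i c i *: e i) /\
    forall c' : {ffun 'I_d -> 'F_p}, B (z - \sum_i c' i *: e i) -> c = c'.
  have [/eB [c [cB cu]]|nz] := pselect (Z z); first by exists c.
  by exists 0.
have [A AP] := choice ex.
have Au z (c : {ffun 'I_d -> 'F_p}) : Z z -> B (z - \sum_i c i *: e i) -> A z = c by move=> /AP [_]; apply.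
have ZD x y : Z x -> Z y -> Z (x + y).
  by move=> Zx Zy g /domD_subset; rewrite mem_cat => /orP []; [exact: Zx | exact: Zy].
have ZZ c x : Z x -> Z (c *: x) by move=> Zx g /domZ_subset; apply: Zx.
have AD x y : Z x -> Z y -> A (x + y) = A x + A y.
  move=> Zx Zy; apply: Au; first exact: ZD.
  under eq_bigr do rewrite ffunE scalerDl.
  rewrite big_split /= opprD addrACA.
  by apply: boundariesD; [have [] := AP x Zx | have [] := AP y Zy].
have AZ c x : Z x -> A (c *: x) = [ffun k => c * A x k].
  move=> Zx; apply: Au; first exact: ZZ.
  under eq_bigr do rewrite ffunE -scalerA.
  by rewrite -scaler_sumr -scalerBr; apply: boundariesZ; have [] := AP x Zx.
have A0 x : Z x -> B x -> A x = 0.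
  move=> Zx Bx; apply: Au => //.
  by rewrite big1 ?subr0 // => i _; rewrite ffunE scale0r.
exists (fun k x => A << x >> k); split.
  move=> k x y Nx Ny; have Nxy : N (x * y)%g by apply: subgroupM.
  have Zx := chains1_gen Nx; have Zy := chains1_gen Ny; have Zxy := chains1_gen Nxy.
  have ZN : Z (- << (x * y)%g >>) by rewrite -scaleN1r; apply: ZZ.
  have E : A (<< y >> - << (x * y)%g >> + << x >>) = 0.
    apply: A0; first by apply: (ZD _ _ (ZD _ _ Zy ZN) Zx).
    exists << (x, y) >>; first by move=> h; rewrite domU1 inE => /eqP ->.
    by rewrite bar_boundary2E liftU scale1r.
  have AN : A (- << (x * y)%g >>) = - A << (x * y)%g >>.
    by rewrite -scaleN1r AZ //; apply/ffunP=> i; rewrite !ffunE mulN1r.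
  have := congr1 (fun f : {ffun 'I_d -> 'F_p} => f k) E.
  rewrite AD //; last exact: ZD.
  rewrite AD // AN !ffunE => /eqP; rewrite addrAC subr_eq0 addrC => /eqP <-.
  by [].
move=> c cE k.
have cZ z : Z z -> \sum_k c k * A z k = 0.
  move=> Zz; rewrite -(freeg_sumE z).
  have : forall s : seq G, (forall g, g \in s -> N g) ->
      Z (\sum_(g <- s) << (coeff g z) *g g >>) /\
      \sum_k c k * A (\sum_(g <- s) << (coeff g z) *g g >>) k = 0.
    elim=> [|g s IH] sNs.
      rewrite big_nil A0; first by split=> [h|]; rewrite ?dom0 // big1 // => i _; rewrite ffunE mulr0.
        by move=> h; rewrite dom0.
      exact: boundaries0.
    have [h hs|Zs Es] := IH; first by apply: sNs; rewrite inE hs orbT.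
    have Ng := sNs g (mem_head _ _).
    have UE : << (coeff g z) *g g >> = coeff g z *: << g >> :> {freeg G / 'F_p}.
      by apply/eqP/freeg_eqP => h; rewrite coeffZ !coeffU mul1r.
    have ZU := ZZ (coeff g z) _ (chains1_gen Ng).
    rewrite big_cons UE; split; first exact: ZD.
    rewrite (AD _ _ ZU Zs) (AZ _ _ (chains1_gen Ng)).
    transitivity (\sum_k (coeff g z * (c k * A << g >> k) +
       c k * A (\sum_(h <- s) << (coeff h z) *g h >>) k)).
      by apply: eq_bigr => i _; rewrite !ffunE mulrDr mulrCA.
    by rewrite big_split /= Es -mulr_sumr cE // mulr0 addr0.
  by move=> /(_ (dom z)) [] //; apply: Zz.
have Ae : A (e k) = [ffun i => (i == k)%:R].
  apply: Au => //; rewrite (bigD1 k) //= big1 => [|i ik].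
    by rewrite ffunE eqxx scale1r addr0 subrr; apply: boundaries0.
  by rewrite ffunE (negPf ik) scale0r.
have := cZ _ (eZ k); rewrite Ae (bigD1 k) //= big1 => [|i ik].
  by rewrite ffunE eqxx mulr1 addr0.
by rewrite ffunE (negPf ik) mulr0.
Qed.

End Homology.

(** * From growth of homology to growth of ranks *)

Section RankBound.
Context {G : groupType} {n m : nat} (rel : 'I_m -> seq 'I_n) (a : 'I_n -> G).
Hypothesis gen : forall g, exists w, gword a w = g.
Hypothesis rel1 : forall i, gword a (rel i) = 1.
Context (p : nat) (p_pr : prime p) (N : set G).
Hypothesis sN : is_subgroup N.
Context {gT : finGroupType} (b : 'I_n -> gT) (qb : p_quotient rel p b).
Hypothesis ker : forall w, wprod b w = 1 <-> N (gword a w).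

Lemma ker_eq w w' : wprod b w = wprod b w' -> N (gword a w * (gword a w')^-1).
Proof.
have [_ genb _] := qb; have [u uE] := genb (wprod b w')^-1.
have Nu w2 : wprod b w2 = wprod b w' -> N (gword a w2 * gword a u).
  by move=> E; rewrite -gword_cat; apply/ker; rewrite wprod_cat uE E mulgV.
move=> E; have -> : gword a w * (gword a w')^-1 =
    (gword a w * gword a u) * (gword a w' * gword a u)^-1.
  by rewrite invMg -!mulgA mulKVg.
by apply: subgroupM => //; [apply: Nu | apply: subgroupV => //; apply: Nu].
Qed.

(** An edge carries the value of al at the element of N that it spells between
    representatives s of its ends; 1 represents the base point. *)
Lemma hom_cocycle (al : G -> 'F_p) :
  (forall x y, N x -> N y -> al (x * y) = (al x + al y)%R) ->
  exists2 f : 'I_n * gT -> 'F_p, cocycle rel (reg b) f &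
    forall w, wprod b w = 1 -> relsum (reg b) f 1 w = al (gword a w).
Proof.
move=> alM; have [_ genb relb] := qb; have [wd wdP] := choice genb.
have N1 : N 1 := sN.1.
have al1 : al 1 = 0%R by apply: (addrI (al 1)); rewrite -alM // mulg1 addr0.
pose wd1 v := if v == 1 then [::] else wd v.
have wd1P v : wprod b (wd1 v) = v.
  by rewrite /wd1; case: eqP => [->|_]; rewrite ?wdP // /wprod big_nil.
pose s v := gword a (wd1 v).
have s1 : s 1 = 1 by rewrite /s /wd1 eqxx.
have Nth v w : N (s v * gword a w * (s (v * wprod b w))^-1).
  by rewrite -gword_cat; apply: ker_eq; rewrite wprod_cat !wd1P.
pose th (e : 'I_n * gT) := s e.2 * a e.1 * (s (e.2 * b e.1))^-1.
have thN e : N (th e).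
  have := Nth e.2 [:: e.1]; by rewrite /= mulg1 /wprod big_seq1.
have path v w : relsum (reg b) (fun e => al (th e)) v w =
    al (s v * gword a w * (s (v * wprod b w))^-1).
  elim: w v => [|x w IH] v.
    by rewrite relsum_nil /= mulg1 /wprod big_nil mulg1 mulgV al1.
  rewrite relsum_cons IH -alM //; congr al.
  by rewrite /th /reg /= /wprod big_cons !mulgA mulgKV.
exists (fun e => al (th e)) => [i v|w w1].
  by rewrite path relb mulg1 rel1 mulg1 mulgV.
by rewrite path w1 mulg1 s1 mul1g invg1 mulg1.
Qed.

(** The cocycles of hom_cocycle are independent modulo the coboundaries, which are
    the functions on gT modulo constants: here, the functions zero at 1. *)
Lemma rank_ge_homs d (al : 'I_d -> G -> 'F_p) :
  (forall k x y, N x -> N y -> al k (x * y) = (al k x + al k y)%R) ->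
  (forall c : 'I_d -> 'F_p,
     (forall x, N x -> (\sum_k c k * al k x)%R = 0%R) -> forall k, c k = 0%R) ->
  (d + #|gT|.-1 <= rank rel p (reg b))%N.
Proof.
move=> alM al_indep; have [_ genb relb] := qb; have [wd wdP] := choice genb.
have ex k : exists f : 'I_n * gT -> 'F_p, cocycle rel (reg b) f /\
    forall w, wprod b w = 1 -> relsum (reg b) f 1 w = al k (gword a w).
  by have [f cf fP] := hom_cocycle (alM k); exists f.
have [f fP] := choice ex.
pose ext0 (psi : {ffun {v : gT | v != 1} -> 'F_p}) v : 'F_p :=
  if insub v is Some u then psi u else 0%R.
have ext01 psi : ext0 psi 1 = 0%R by rewrite /ext0 insubF // eqxx.
pose H (z : {ffun 'I_d -> 'F_p} * {ffun {v : gT | v != 1} -> 'F_p}) :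
    {ffun 'I_n * gT -> ('F_p)^o} :=
  [ffun e => (\sum_k z.1 k * f k e + coboundary (reg b) (ext0 z.2) e)%R].
have relH z v w : relsum (reg b) (H z) v w =
    (\sum_k z.1 k * relsum (reg b) (f k) v w +
     (ext0 z.2 (v * wprod b w)%g - ext0 z.2 v))%R.
  rewrite (_ : relsum _ _ _ _ = relsum (reg b) (fun e => \sum_k z.1 k * f k e +
     coboundary (reg b) (ext0 z.2) e)%R v w); last first.
    by apply: eq_bigr => e _; rewrite ffunE.
  rewrite relsumD relsum_coboundary run_reg; congr (_ + _)%R.
  rewrite /relsum exchange_big; apply: eq_bigr => k _ /=.
  by rewrite mulr_sumr.
have Hc z : H z \in cocycles rel 'F_p (reg b).
  apply/cocyclesP => i v; rewrite relH relb mulg1 subrr addr0.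
  by rewrite big1 // => k _; rewrite (fP k).1 mulr0.
have H_inj : injective H.
  move=> [c psi] [c' psi'] E.
  have EE w : relsum (reg b) (H (c, psi)) 1 w = relsum (reg b) (H (c', psi')) 1 w.
    by rewrite E.
  have cE : c = c'.
    apply/ffunP=> k; apply/eqP; rewrite -subr_eq0; apply/eqP.
    apply: (al_indep (fun k => c k - c' k)%R) => x Nx.
    have [w wx] := gen x; have w1 : wprod b w = 1 by apply/ker; rewrite wx.
    have := EE w; rewrite !relH /= w1 mulg1 !subrr !addr0 => E1.
    have al_f j : al j x = relsum (reg b) (f j) 1 w by rewrite (fP j).2 // wx.
    under eq_bigr do rewrite al_f mulrBl.
    by rewrite sumrB E1 subrr.
  subst c'; congr (_, _); apply/ffunP=> u.
  have := EE (wd (val u)); rewrite !relH /= wdP mul1g !ext01 !subr0 => /addrI.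
  by rewrite /ext0 !valK.
have le : (#|{: {ffun 'I_d -> 'F_p} * {ffun {v : gT | v != 1%g} -> 'F_p}}| <=
    #|cocycles rel 'F_p (reg b)|)%N.
  rewrite -cardsT -(card_imset _ H_inj); apply: subset_leq_card.
  by apply/subsetP => _ /imsetP [z _ ->].
move: le; rewrite card_prod !card_ffun card_vspace (card_ord d) card_sig cardC1.
by rewrite -expnD leq_exp2l // card_Fp // prime_gt1.
Qed.

End RankBound.

Section Growth.
Context {G : groupType} {n m : nat} (rel : 'I_m -> seq 'I_n) (a : 'I_n -> G).
Hypothesis gen : forall g, exists w, gword a w = g.
Hypothesis rel1 : forall i, gword a (rel i) = 1.
Hypothesis universal : forall (Y : Type) (st : 'I_n -> Y -> Y), is_action rel st ->
  exists act : Y -> G -> Y, (forall y g h, act y (g * h) = act (act y g) h) /\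
    forall y w, act y (gword a w) = run st y w.
Context (p : nat) (p_pr : prime p).
Local Notation N := (lower_central_p G p).

Lemma p_quotient_morph (gT : finGroupType) (b : 'I_n -> gT) : p_quotient rel p b ->
  exists2 f : G -> gT, {morph f : x y / x * y} & forall w, f (gword a w) = wprod b w.
Proof.
move=> qb; have ast := (p_action_reg qb).1.
have [act [actM actw]] := universal ast.
have fw w : act 1 (gword a w) = wprod b w by rewrite actw run_reg mul1g.
exists (act 1) => // x y; have [w <-] := gen x; have [w' <-] := gen y.
by rewrite -gword_cat !fw wprod_cat.
Qed.

(** The action is that of a finite p-group, and lcp_killed applies. *)
Lemma p_action_killed (Y : finType) (st : 'I_n -> Y -> Y) : p_action rel p st ->
  exists i, forall w, N i (gword a w) -> forall y, run st y w = y.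
Proof.
move=> pst; have [gT [b [act [qb actw _]]]] := reg_cover p_pr pst.
have [f fM fw] := p_quotient_morph qb.
have [pG _ _] := qb.
have [i iP] := lcp_killed p_pr pG fM; exists i => w /iP.
rewrite fw => w1 y; rewrite -actw w1 -[1](_ : wprod b [::] = 1) ?actw //.
by rewrite /wprod big_nil.
Qed.

(** By rank_ratio it suffices to compare Y with G / N i, where i is large enough for
    N i to act trivially on Y. By rank_ge_homs, l * rank of G / N i is at least
    |G / N i| + l * (|G / N i| - 1); the 1 is absorbed in doubling l because these
    quotients grow without bound, a nonzero homomorphism from N i to F_p leading to
    a larger one. *)
Lemma growth_of_p_actions l : (0 < l)%N -> (forall i, finite_index (N i)) ->
  (forall i, (subgroup_index (N i) <= l * dim_H1 p (N i))%N) ->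
  exists l', rank_bound rel p l'.+1 l'.
Proof.
move=> l0 finN lin; exists (2 * l)%N.
pose Q i (gT : finGroupType) (f : G -> gT) := [/\ {morph f : x y / x * y},
  forall v, exists g, f g = v & forall g, f g = 1 <-> N i g].
have quo i : exists (gT : finGroupType) (b : 'I_n -> gT) (f : G -> gT),
    [/\ p_quotient rel p b, (#|gT| <= subgroup_index (N i))%N, Q i gT f
      & forall w, f (gword a w) = wprod b w].
  have [gT [b [qb le ker]]] :=
    coset_quotient rel1 p_pr (lcp_normal p i) (finN i) (ex_intro _ i (@lcp_exp G p i)).
  have [f fM fw] := p_quotient_morph qb; exists gT, b, f; split=> //; split=> //.
    by move=> v; have [_ genb _] := qb; have [w <-] := genb v; exists (gword a w).
  by move=> g; have [w <-] := gen g; rewrite fw.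
have Q_lt i j (gT gT' : finGroupType) f f' : Q i gT f -> Q j gT' f' -> (i <= j)%N ->
    (#|gT| <= #|gT'|)%N /\ forall g, N i g -> ~ N j g -> (#|gT| < #|gT'|)%N.
  move=> [fM fsurj fker] [f'M f'surj f'ker] ij.
  have [s' s'P] := choice f'surj; pose h v := f (s' v).
  have fV := mul_morphV fM; have f'1 := mul_morph1 f'M; have f'V := mul_morphV f'M.
  have hf g : h (f' g) = f g.
    apply: (mulIg (f g)^-1); rewrite mulgV -fV -fM; apply/fker/(lcp_mono ij)/f'ker.
    by rewrite f'M f'V s'P mulgV.
  have hsurj v : exists u, h u = v by have [g <-] := fsurj v; exists (f' g).
  have [t tP] := choice hsurj; have t_inj : injective t by apply: can_inj tP.
  split; first exact: leq_card t t_inj.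
  move=> g Ng nNg; have v1 : f' g != 1 by apply/eqP => /f'ker.
  have hv1 : h (f' g) = 1 by rewrite hf; apply/fker.
  have h1 : h 1 = 1 by rewrite -f'1 hf; apply/fker; apply: (lcp_normal p i).1.1.
  pose T (o : option gT) : gT' := if o is Some v then t v else
    if t 1 == f' g then 1 else f' g.
  rewrite -card_option; apply: (leq_card T).
  have no v : t v <> T None.
    rewrite /T; case: eqP => [t1|t1] tv.
      have v1' : v = 1 by rewrite -(tP v) tv.
      by move: v1; rewrite -t1 -v1' tv eqxx.
    by apply: t1; rewrite -tv -hv1 -tv tP.
  case=> [v|] [v'|] //; last by move=> E; case: (no v').
    by move=> /t_inj ->.
  by move=> E; case: (no v).
have homs i (gT : finGroupType) : (0 < #|gT| <= subgroup_index (N i))%N ->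
    exists al : 'I_(dim_H1 p (N i)) -> G -> 'F_p,
    (forall k x y, N i x -> N i y -> al k (x * y)%g = al k x + al k y)%R /\
    (forall c : 'I_(dim_H1 p (N i)) -> 'F_p,
       (forall x, N i x -> (\sum_k c k * al k x)%R = 0%R) -> forall k, c k = 0%R).
  move=> /andP [g0 le]; apply: homs_of_H1; first exact: (lcp_normal p i).1.
  have := leq_trans g0 (leq_trans le (lin i)).
  by rewrite muln_gt0 => /andP [].
have pos (gT : finGroupType) : (0 < #|gT|)%N by apply/card_gt0P; exists 1.
have unbounded c : exists i, forall (gT : finGroupType) (f : G -> gT), Q i gT f -> (c <= #|gT|)%N.
  elim: c => [|c [i iP]]; first by exists 0%N.
  have [gT [b [f [qb le fQ fw]]]] := quo i.
  have ker w : wprod b w = 1 <-> N i (gword a w) by have [_ _ fk] := fQ; rewrite -fw.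
  have [|al [alM al_indep]] := homs i gT; first by rewrite pos le.
  have d0 : (0 < dim_H1 p (N i))%N.
    have := leq_trans (pos gT) (leq_trans le (lin i)).
    by rewrite muln_gt0 => /andP [].
  have [g [Ng ng0]] : exists g, N i g /\ al (Ordinal d0) g <> 0%R.
    apply: contrapT => no; have := al_indep (fun k => (k == Ordinal d0)%:R%R).
    have h x : N i x -> (\sum_k (k == Ordinal d0)%:R * al k x)%R = 0%R.
      move=> Nx; rewrite (bigD1 (Ordinal d0)) // eqxx big1 => [|k /negPf ->]; last by rewrite mul0r.
      rewrite /= mul1r addr0; apply: contrapT => nz; apply: no; by exists x.
    by move=> /(_ h (Ordinal d0)) /eqP; rewrite eqxx oner_eq0.
  have [k ck kE] := hom_cocycle rel1 (lcp_normal p i).1 qb ker (alM (Ordinal d0)).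
  have pk : p_action rel p (ext (reg b) k).
    apply: (p_action_ext (k := 1)) => //; first exact: p_action_reg.
    by move=> v; rewrite expn1 -mulr_natr (pcharf0 (pchar_Fp p_pr)) mulr0.
  have [j jP] := p_action_killed pk.
  have nNj : ~ N (maxn i j) g.
    move=> /(lcp_mono (leq_maxr i j)); have [w gw] := gen g; rewrite -gw => Nw.
    have w1 : wprod b w = 1 by apply/ker; rewrite gw.
    have := jP w Nw (1, 0%R); rewrite run_ext /= add0r kE // gw => -[_].
    exact: ng0.
  exists (maxn i j) => gT' f' Q'.
  have [_ lt] := Q_lt _ _ _ _ _ _ fQ Q' (leq_maxl i j).
  exact: leq_ltn_trans (iP gT f fQ) (lt g Ng nNj).
move=> Y st pst.
have [i1 kill] := p_action_killed pst; have [i2 big2] := unbounded (2 * l)%N.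
pose i := maxn i1 i2.
have [gT [b [f [qb le fQ fw]]]] := quo i.
have [gT2 [b2 [f2 [_ _ fQ2 _]]]] := quo i2.
have sz : (2 * l <= #|gT|)%N.
  apply: leq_trans (big2 gT2 f2 fQ2) _.
  by have [] := Q_lt _ _ _ _ _ _ fQ2 fQ (leq_maxr i1 i2).
have ker w : wprod b w = 1 <-> N i (gword a w) by have [_ _ fk] := fQ; rewrite -fw.
have [|al [alM al_indep]] := homs i gT; first by rewrite pos le.
have rk := rank_ge_homs gen rel1 p_pr (lcp_normal p i).1 qb ker alM al_indep.
have factor w w' : wprod b w = wprod b w' -> forall y, run st y w = run st y w'.
  move=> E y; have [act [actM actw]] := universal pst.1.
  have [u uE] := gen ((gword a w')^-1 * gword a w).
  have Nu : N i1 (gword a u).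
    apply: (lcp_mono (leq_maxl i1 i2)).
    have [sNi NJ] := @lcp_normal G p i.
    have := NJ _ (gword a w') (ker_eq sNi qb ker E).
    by rewrite conjgE mulgKV uE.
  rewrite -!actw -[gword a w](mulKVg (gword a w')) actM -uE actw.
  by rewrite (kill u Nu).
have ratio := rank_ratio p_pr qb factor.
have g0 := pos gT.
rewrite -(leq_pmul2l g0).
have l1 : (l * (dim_H1 p (N i) + #|gT|.-1) <= l * rank rel p (reg b))%N.
  by rewrite leq_mul2l rk orbT.
have l2 := leq_trans le (lin i).
have l3 : ((2 * l).+1 * #|gT| <= 2 * l * rank rel p (reg b))%N.
  rewrite mulSn; move: l1; rewrite mulnDr -subn1 mulnBr muln1 -!mulnA.
  have : (l <= l * #|gT|)%N by rewrite leq_pmulr.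
  lia.
have l4 : (2 * l * (#|Y| * rank rel p (reg b)) <= 2 * l * (#|gT| * rank rel p st))%N.
  by rewrite leq_mul2l ratio orbT.
have l5 : (#|Y| * ((2 * l).+1 * #|gT|) <= #|Y| * (2 * l * rank rel p (reg b)))%N.
  by rewrite leq_mul2l l3 orbT.
rewrite mulnA [(#|gT| * _)%N]mulnC [((2 * l).+1 * _ * _)%N]mulnC.
apply: leq_trans l5 _; rewrite mulnCA; apply: leq_trans l4 _.
by rewrite mulnCA.
Qed.

End Growth.

(** * Large quotients *)

Lemma linear_growth_nat (R : realType) (G : groupType) (p : nat) (N : nat -> set G) :
  linear_growth R p N -> exists2 l, (0 < l)%N & forall i,
    finite_index (N i) /\ (subgroup_index (N i) <= l * dim_H1 p (N i))%N.
Proof.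
rewrite /linear_growth; set E := [set _ | _ in _] => infE.
have bound i : (inf E <= (dim_H1 p (N i))%:R / (subgroup_index (N i))%:R)%R.
  apply: ge_inf; last by exists i.
  by exists 0%R => _ [j _ <-]; rewrite divr_ge0 ?ler0n.
have inv0 : (0 <= (inf E)^-1)%R by rewrite invr_ge0 ltW.
exists (Num.bound (inf E)^-1).
  by rewrite -(ltr0n R); apply: le_lt_trans inv0 (archi_boundP inv0).
move=> i; have b := bound i.
have idx0 : (0 < subgroup_index (N i))%N.
  rewrite lt0n; apply/negP => /eqP i0.
  by move: b; rewrite i0 invr0 mulr0 leNgt infE.
split.
  apply: contrapT => nfin; move: idx0; rewrite /subgroup_index.
  by rewrite /fset_set; case: pselect => //; rewrite cardfs0.
have idxR : (0 < (subgroup_index (N i))%:R :> R)%R by rewrite ltr0n.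
rewrite -(ler_nat R) natrM.
have h1 : (inf E * (subgroup_index (N i))%:R <= (dim_H1 p (N i))%:R)%R.
  by rewrite -ler_pdivlMr.
have h2 : ((subgroup_index (N i))%:R <= (inf E)^-1 * (dim_H1 p (N i))%:R)%R.
  by rewrite ler_pdivlMl.
apply: le_trans h2 _; apply: ler_wpM2r; first exact: ler0n.
exact: ltW (archi_boundP inv0).
Qed.

Lemma kernel_index (G : groupType) (gT : finGroupType) (f : G -> gT) :
  {morph f : x y / x * y} -> (forall v, exists g, f g = v) ->
  [/\ is_normal [set g | f g = 1], finite_index [set g | f g = 1]
    & subgroup_index [set g | f g = 1] = #|gT|].
Proof.
move=> fM fsurj.
have f1 := mul_morph1 fM; have fV := mul_morphV fM.
pose C v : set G := [set g | f g = v].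
have C_inj : injective C.
  move=> v v'; have [g gv] := fsurj v => E.
  by have : C v g by []; rewrite E /C /= gv.
have cosE : left_cosets [set g | f g = 1] = [set` [fset C v | v in enum gT]%fset].
  apply/seteqP; split=> A /=.
    move=> [g _ <-]; apply/imfsetP; exists (f g); first by rewrite /= mem_enum.
    apply/seteqP; split=> x; first by move=> [h h1 <-]; rewrite /C /= fM h1 mulg1.
    by move=> xg; rewrite /C /= in xg; exists (g^-1 * x); rewrite ?mulKVg //= fM fV xg mulVg.
  move=> /imfsetP [v _ ->]; have [g gv] := fsurj v; exists g => //.
  apply/seteqP; split=> x; first by move=> [h h1 <-]; rewrite /C /= fM h1 mulg1.
  by move=> xv; rewrite /C /= in xv; exists (g^-1 * x); rewrite ?mulKVg //= fM fV xv gv mulVg.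
split.
- split; first by split=> // x y /= x1 y1; rewrite fM fV x1 y1 mulgV.
  by move=> x g /= x1; rewrite conjgE !fM fV x1 mul1g mulVg.
- by rewrite /finite_index cosE; apply: finite_fset.
by rewrite /subgroup_index cosE set_fsetK card_imfset //= undup_id ?enum_uniq // -cardE.
Qed.

Theorem corollary1p13 (R : realType) (G : groupType) (p : nat) :
  finitely_presented G -> prime p ->
  linear_growth R p (lower_central_p G p) -> p_large p G.
Proof.
move=> [F [X [S [pi [[freeX /finite_seqP [xs0 XE]] piM pi_onto pi_ker /finite_seqP [ss SE]]]]]].
move=> p_pr lin; have [l0 l0pos growth0] := linear_growth_nat lin.
pose xs := undup xs0.
have {XE} XE : X = [set` xs].
  by rewrite XE; apply/seteqP; split=> x /=; rewrite mem_undup.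
subst X S.
have [m [rel [rel_inv rel1 universal]]] :=
  positive_presentation freeX (undup_uniq xs0) piM pi_onto pi_ker.
pose a x := pi (letter (xs := xs) x).
have gen g : exists w, gword a w = g.
  have : [set: G] g by [].
  rewrite -pi_onto => -[f _ <-]; have [w <-] := letters_generate freeX f.
  by exists w; rewrite (gword_morph _ w piM).
have [l growth] := growth_of_p_actions gen rel1 universal p_pr l0pos
  (fun i => (growth0 i).1) (fun i => (growth0 i).2).
have [gT [b [L [qb relL loopL]]]] := labelled_quotient xs p_pr rel_inv growth.
have [pG genb relb] := qb.
(* The product of the labels along the relators being 1, G acts on gT x F. *)
pose st x (z : gT * F) := ((z.1 * b x)%g, z.2 * L (x, z.1)).
have runE w z : run st z w = ((z.1 * wprod b w)%g, z.2 * lprod b L z.1 w).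
  elim: w z => [|x w IH] z /=; first by rewrite /wprod big_nil !mulg1; case: z.
  by rewrite IH /= /wprod big_cons !mulgA.
have ast : is_action rel st.
  by move=> i z; rewrite runE relb relL !mulg1; case: z.
have [act [actM actw]] := universal _ _ ast.
pose rho g := (act (1, 1) g).1; pose f g := (act (1, 1) g).2.
have rhow w : rho (gword a w) = wprod b w by rewrite /rho actw runE /= mul1g.
have fw w : f (gword a w) = lprod b L 1 w by rewrite /f actw runE /= mul1g.
have rhoM : {morph rho : x y / x * y}.
  move=> x y; have [w <-] := gen x; have [w' <-] := gen y.
  by rewrite -gword_cat !rhow wprod_cat.
have rho_surj v : exists g, rho g = v.
  by have [w <-] := genb v; exists (gword a w).
have [normN finN idxN] := kernel_index rhoM rho_surj.
exists [set g | rho g = 1]; split=> //.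
  have [k cG] := p_natP pG; exists k.
  by rewrite idxN -cG cardsT.
exists F, f; split.
- by exists [set` xs].
- apply: (free_nonabelian freeX (undup_uniq xs0)); rewrite ltnNge; apply/negP => small.
  (* On a point, growth makes the rank, hence the number of generators, exceed 1. *)
  have := growth _ _ (p_action_point rel p); rewrite card_unit muln1 ltnNge => /negP; apply.
  rewrite -[X in (_ <= X)%N]muln1 leq_mul2l; apply/orP; right.
  exact: leq_trans (rank_point p_pr rel_inv) small.
- move=> x y; have [w <-] := gen x; have [w' <-] := gen y; rewrite /= rhow => w1 _.
  by rewrite -gword_cat !fw lprod_cat w1 mul1g.
apply/seteqP; split=> // h _.
have [w w1 <-] : loop_value b L h.
  apply: (free_generation (A := [set h | loop_value b L h]) freeX); last first.
    by move=> x /= xin; apply: loopL.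
  split; first exact: loop_value1.
  move=> x y /= lx ly; apply: loop_valueM => //.
  exact: (loop_valueV rel_inv relb relL).
by exists (gword a w); rewrite ?fw //= rhow.
Qed.
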